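(* Let $\{g_n\}_{n=0}^{\infty}$ be a frame and not a Riesz basis in a Hilbert space $H$. Then $H(g_n)=H(b)$ for some inner function $b(z)$ if and only if there exists a bounded operator on $H$ that maps $g_n$ to $g_{n+1}$ for all $n\ge 0$.
   Context: A sequence $\{g_n\}$ in $H$ is a frame if there are $A,B>0$ with $A\|f\|^2\le\sum_n|\langle f,g_n\rangle|^2\le B\|f\|^2$ for all $f\in H$. It is a Riesz basis if it is a frame and, for $\{c_n\}\in\ell^2$, $\sum c_ng_n=0$ implies $c_n=0$ for all $n$. $H^2(\mathbb D)$ is the Hardy space of analytic functions on the unit disk $\mathbb D$ with square-summable power series coefficients, with the $\ell^2$ inner product of coefficients. For a frame (or Bessel sequence) $\{g_n\}_{n=0}^\infty$ in $H$, $H(g_n)\subseteq H^2(\mathbb D)$ denotes the image of the map $A_{g_n}:H\to H^2(\mathbb D)$, $A_{g_n}(f)(z)=\sum_{n=0}^\infty\langle f,g_n\rangle z^n$. For an inner function $b$, $H(b)=H^2(\mathbb D)\ominus b(z)H^2(\mathbb D)$ is the model space. *)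

(* Defs.v *)
From HB Require Import structures.
From mathcomp Require Import all_boot all_order all_algebra.
From mathcomp Require Import all_classical all_reals all_analysis.
From mathcomp Require Import complex.

Set Implicit Arguments.
Unset Strict Implicit.
Unset Printing Implicit Defensive.

Import Order.TTheory GRing.Theory Num.Theory.
Import numFieldNormedType.Exports.

Local Open Scope classical_set_scope.
Local Open Scope ring_scope.
Local Open Scope complex_scope.

(* The topology and norm of the complex numbers R[i] are those the library
   puts on the regular module R[i]^o; norms are R[i]-valued (with zero
   imaginary part), so normsq takes a real part. *)

Definition normsq (R : realType) (V : normedModType R[i]) (x : V) : R :=
  complex.Re `|x| ^+ 2.

Definition square_summable (R : realType) (a : nat -> R[i]) : Prop :=
  (\sum_(0 <= n <oo) (normsq (a n : R[i]^o))%:E < +oo)%E.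

Section HilbertSequences.
Variables (R : realType) (H : completeNormedModType R[i]).

(* The inner product is linear in its first argument and conjugate-linear in
   its second one. *)
Definition hilbert_inner (ip : {dot H for Num.conj}) : Prop :=
  forall x : H, ip x x = `|x| ^+ 2.

Definition frame (ip : H -> H -> R[i]) (g : nat -> H) : Prop :=
  exists A B : R, [/\ 0 < A, 0 < B & forall f : H,
    ((A * normsq f)%:E <= \sum_(0 <= n <oo) (normsq (ip f (g n) : R[i]^o))%:E
      <= (B * normsq f)%:E)%E].

Definition riesz_basis (ip : H -> H -> R[i]) (g : nat -> H) : Prop :=
  frame ip g /\
  forall c : nat -> R[i], square_summable c ->
    series (fun n => c n *: g n) @ \oo --> (0 : H) -> forall n, c n = 0.

Definition bounded_operator (T : {linear H -> H}) : Prop :=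
  exists M : R, forall x : H, `|T x| <= M%:C * `|x|.

End HilbertSequences.

Section HardySpace.
Variable R : realType.

Definition disk := {z : R[i] | `|z| < 1}.

Definition power_series (f : disk -> R[i]) (a : nat -> R[i]) : Prop :=
  forall z : disk,
    (series (fun n => a n * val z ^+ n) : nat -> R[i]^o) @ \oo
      --> (f z : R[i]^o).

Definition analytic_disk (f : disk -> R[i]) : Prop :=
  exists a, power_series f a.

Definition H2 : set (disk -> R[i]) :=
  [set f | exists2 a, square_summable a & power_series f a].

(* Junk value 0 for functions that are not analytic. *)
Definition coefs (f : disk -> R[i]) : nat -> R[i] :=
  xget (fun=> 0) [set a | power_series f a].

Definition H2_inner (f h : disk -> R[i]) : R[i] :=
  lim ((series (fun n => coefs f n * Num.conj (coefs h n)) : nat -> R[i]^o)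
    @ \oo).

Definition disk_ext (f : disk -> R[i]) (z : R[i]) : R[i] :=
  if insub z is Some w then f w else 0.

Definition expi (t : R) : R[i] := cos t +i* sin t.

Definition radial_limit (f : disk -> R[i]) (t : R) (l : R[i]) : Prop :=
  (disk_ext f (r%:C * expi t) : R[i]^o) @[r --> 1^'-] --> (l : R[i]^o).

(* By periodicity, almost every t in R amounts to almost every point of the
   unit circle.  Unimodular constants are inner. *)
Definition inner_function (b : disk -> R[i]) : Prop :=
  [/\ analytic_disk b,
      exists M : R, forall z, `|b z| <= M%:C &
      {ae @lebesgue_measure R,
        forall t : R, exists2 l, radial_limit b t l & `|l| = 1}].

Definition model_space (b : disk -> R[i]) : set (disk -> R[i]) :=
  [set f | H2 f /\ forall h, H2 h -> H2_inner f (b \* h) = 0].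

Definition analysis_map (H : completeNormedModType R[i])
    (ip : H -> H -> R[i]) (g : nat -> H) (f : H) : disk -> R[i] :=
  fun z => lim ((series (fun n => ip f (g n) * val z ^+ n) : nat -> R[i]^o)
    @ \oo).

Definition frame_space (H : completeNormedModType R[i])
    (ip : H -> H -> R[i]) (g : nat -> H) : set (disk -> R[i]) :=
  range (analysis_map ip g).

End HardySpace.

(* Main.v *)
(* The coefficient sequences of the functions in H(g_n) form the orthogonal
   complement of the kernel of the synthesis operator c |-> \sum c_n g_n, and a
   bounded operator g_n |-> g_(n+1) exists if and only if this kernel is invariant
   under the forward shift.  If H(g_n) = H(b), the complement is invariant under
   the backward shift, whence the operator.  Conversely, a nonzero shift-invariant
   kernel is generated by one unit vector phi orthogonal to its own shifts
   (Beurling), and b is the power series of phi.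

   That b is inner is obtained without Fourier integrals: suitable truncated
   dilates of b are trigonometric polynomials that are nearly bounded by 1 and
   converge fast in mean square, hence almost everywhere, to boundary values of
   modulus one; and Abel summation recovers these values at each Lebesgue point
   through the derivative of the Poisson kernel. *)

Require Import Defs.
From HB Require Import structures.
From mathcomp Require Import all_boot all_order all_algebra.
From mathcomp Require Import all_classical all_reals all_analysis.
From mathcomp Require Import complex.
From mathcomp Require Import measurable_realfun.
From mathcomp Require Import ring lra zify.

Set Implicit Arguments.
Unset Strict Implicit.
Unset Printing Implicit Defensive.

Import Order.TTheory GRing.Theory Num.Theory.
Import numFieldNormedType.Exports.

Local Open Scope classical_set_scope.
Local Open Scope ring_scope.
Local Open Scope complex_scope.

Local Notation cj := (@Num.conj _).

(** * Complex sequences *)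

(** Two obstacles shape the argument. The first is the kernel. No projection theorem is invoked: the
    frame operator is inverted explicitly, so every square-summable sequence is an analysis sequence
    plus a kernel sequence, and that residual serves as the orthogonal projection onto the kernel.
    Nor is the kernel decomposed into wandering subspaces: if a kernel sequence psi is orthogonal to
    all shifts of phi, then, phi being orthogonal to the positive shifts of psi, the whole two-sided
    correlation of psi and phi vanishes, although its norm is that of psi. The second is the
    boundary. Mean-square convergence gives limits along a sequence of polynomials, whereas a radial
    limit concerns every r. The passage uses primitives: the symmetric difference at t of a
    primitive of Re b is, up to a linear term, a sine series in the step s, whose derivative at s =
    0 comes from Lebesgue's theorem; the Abel means of the differentiated series are then compared
    with that derivative by a positivity argument. *)

Section ComplexBasics.
Variable R : realType.
Implicit Types (z w : R[i]).

(** The norm of [R[i]] is [R[i]]-valued; the squared modulus in [R] can be ordered, summed and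
    estimated as a real number. *)
Definition sqn (z : R[i]) : R := complex.Re z ^+ 2 + complex.Im z ^+ 2.

Lemma sqn_ge0 z : 0 <= sqn z.
Proof. by rewrite addr_ge0 ?sqr_ge0. Qed.

Lemma sqnE z : (sqn z)%:C = `|z| ^+ 2.
Proof. exact: add_Re2_Im2. Qed.

Lemma normcEsqrt z : `|z| = (Num.sqrt (sqn z))%:C.
Proof. exact: normc_def. Qed.

Lemma normsqE z : normsq (z : R[i]^o) = sqn z.
Proof.
by rewrite /normsq [`|_|]normcEsqrt /= sqr_sqrtr ?sqn_ge0.
Qed.

Lemma mulC_conj z : z * (cj z) = (sqn z)%:C.
Proof. by rewrite sqnE sqr_normc. Qed.

Lemma sqnM z w : sqn (z * w) = sqn z * sqn w.
Proof. by case: z w => a b [c d]; rewrite /sqn /=; ring. Qed.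

Lemma sqn_conj z : sqn (cj z) = sqn z.
Proof. by case: z => a b; rewrite /sqn /=; ring. Qed.

Lemma sqn0 : sqn 0 = 0.
Proof. by rewrite /sqn /=; ring. Qed.

Lemma sqn1 : sqn 1 = 1.
Proof. by rewrite /sqn /=; ring. Qed.

Lemma sqnX z n : sqn (z ^+ n) = sqn z ^+ n.
Proof. by elim: n => [|n IH]; rewrite ?expr0 ?sqn1// !exprS sqnM IH. Qed.

Lemma sqnN z : sqn (- z) = sqn z.
Proof. by case: z => a b; rewrite /sqn /=; ring. Qed.

Lemma sqn_real (x : R) : sqn x%:C = x ^+ 2.
Proof. by rewrite /sqn /=; ring. Qed.

Lemma sqn_eq0 z : (sqn z == 0) = (z == 0).
Proof. by rewrite paddr_eq0 ?sqr_ge0// !sqrf_eq0 eq_complex. Qed.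

Lemma sqnD_le z w : sqn (z + w) <= 2 * (sqn z + sqn w).
Proof.
rewrite -subr_ge0.
have -> : 2 * (sqn z + sqn w) - sqn (z + w) = sqn (z - w).
  by case: z w => a b [c d]; rewrite /sqn /=; ring.
exact: sqn_ge0.
Qed.

Lemma sqr_Re_le z : complex.Re z ^+ 2 <= sqn z.
Proof. by rewrite lerDl sqr_ge0. Qed.

Lemma sqr_Im_le z : complex.Im z ^+ 2 <= sqn z.
Proof. by rewrite lerDr sqr_ge0. Qed.

Lemma norm_lt_sqn z (e : R) : 0 < e -> (`|z| < e%:C) = (sqn z < e ^+ 2).
Proof.
move=> e0; rewrite normcEsqrt ltcR -(@ltr_pXn2r _ 2) ?nnegrE ?sqrtr_ge0 ?ltW//.
by rewrite sqr_sqrtr ?sqn_ge0.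
Qed.

Lemma gt0_real_complex (e : R[i]) : 0 < e -> e = (complex.Re e)%:C /\ 0 < complex.Re e.
Proof. by case: e => a b; rewrite ltcE /= => /andP[/eqP -> a0]. Qed.

Lemma ReD z w : complex.Re (z + w) = complex.Re z + complex.Re w.
Proof. by case: z w => ? ? []. Qed.
Lemma ImD z w : complex.Im (z + w) = complex.Im z + complex.Im w.
Proof. by case: z w => ? ? []. Qed.
Lemma ReB z w : complex.Re (z - w) = complex.Re z - complex.Re w.
Proof. by case: z w => ? ? []. Qed.
Lemma ImB z w : complex.Im (z - w) = complex.Im z - complex.Im w.
Proof. by case: z w => ? ? []. Qed.
Lemma ReM z w : complex.Re (z * w) =
  complex.Re z * complex.Re w - complex.Im z * complex.Im w.
Proof. by case: z w => ? ? []. Qed.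
Lemma ImM z w : complex.Im (z * w) =
  complex.Re z * complex.Im w + complex.Im z * complex.Re w.
Proof. by case: z w => ? ? []. Qed.
Lemma Re_conj z : complex.Re (cj z) = complex.Re z. Proof. by case: z. Qed.
Lemma Im_conj z : complex.Im (cj z) = - complex.Im z. Proof. by case: z. Qed.

Lemma Re_sum (I : Type) (r : seq I) (P : pred I) (F : I -> R[i]) :
  complex.Re (\sum_(i <- r | P i) F i) = \sum_(i <- r | P i) complex.Re (F i).
Proof. by rewrite (big_morph (@complex.Re R) ReD erefl). Qed.
Lemma Im_sum (I : Type) (r : seq I) (P : pred I) (F : I -> R[i]) :
  complex.Im (\sum_(i <- r | P i) F i) = \sum_(i <- r | P i) complex.Im (F i).
Proof. by rewrite (big_morph (@complex.Im R) ImD erefl). Qed.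

Lemma complex_ext z w : complex.Re z = complex.Re w ->
  complex.Im z = complex.Im w -> z = w.
Proof. by case: z w => a b [c d] /= -> ->. Qed.

Lemma cvg_complexP (T : Type) (F : set_system T) {FF : Filter F}
    (u : T -> R[i]) (l : R[i]) :
  (u : T -> R[i]^o) @ F --> (l : R[i]^o) <->
  (fun x => complex.Re (u x)) @ F --> complex.Re l /\
  (fun x => complex.Im (u x)) @ F --> complex.Im l.
Proof.
split.
- move=> /cvgrPdist_lt ul; split; apply/cvgrPdist_lt => e e0.
  + have := ul (e%:C); rewrite ltcR => /(_ e0); apply: filterS => x.
    rewrite norm_lt_sqn// => h.
    rewrite -ltr_sqr ?nnegrE ?normr_ge0 ?ltW// real_normK ?num_real//.
    by apply: le_lt_trans h; rewrite -ReB sqr_Re_le.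
  + have := ul (e%:C); rewrite ltcR => /(_ e0); apply: filterS => x.
    rewrite norm_lt_sqn// => h.
    rewrite -ltr_sqr ?nnegrE ?normr_ge0 ?ltW// real_normK ?num_real//.
    by apply: le_lt_trans h; rewrite -ImB sqr_Im_le.
- move=> [/cvgrPdist_lt ur /cvgrPdist_lt ui]; apply/cvgrPdist_lt => e.
  move=> /gt0_real_complex [-> e0].
  have e2 : 0 < complex.Re e / 2 by rewrite divr_gt0.
  near=> x; rewrite norm_lt_sqn//.
  have h1 : `|complex.Re l - complex.Re (u x)| < complex.Re e / 2.
    by near: x; exact: ur.
  have h2 : `|complex.Im l - complex.Im (u x)| < complex.Re e / 2.
    by near: x; exact: ui.
  rewrite /sqn ReB ImB.
  move: h1 h2; rewrite -ltr_sqr ?nnegrE ?normr_ge0 ?ltW// real_normK ?num_real//.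
  move=> h1; rewrite -ltr_sqr ?nnegrE ?normr_ge0 ?ltW// real_normK ?num_real//.
  move=> h2; nra.
Unshelve. all: by end_near.
Qed.

Lemma cvg_complex_unique (T : Type) (F : set_system T) {FF : ProperFilter F}
    (u : T -> R[i]) (l l' : R[i]) :
  (u : T -> R[i]^o) @ F --> (l : R[i]^o) ->
  (u : T -> R[i]^o) @ F --> (l' : R[i]^o) -> l = l'.
Proof.
move=> /cvg_complexP[h1 h2] /cvg_complexP[h3 h4].
by apply: complex_ext; [exact: cvg_unique h1 h3|exact: cvg_unique h2 h4].
Qed.

Lemma cvg_complex_lim (T : Type) (F : set_system T) {FF : ProperFilter F}
    (u : T -> R[i]) (l : R[i]) :
  (u : T -> R[i]^o) @ F --> (l : R[i]^o) ->
  lim ((u : T -> R[i]^o) @ F) = l.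
Proof. by move=> h; apply: cvg_lim. Qed.

Lemma cvg_conj (T : Type) (F : set_system T) {FF : Filter F}
    (u : T -> R[i]) (l : R[i]) :
  (u : T -> R[i]^o) @ F --> (l : R[i]^o) ->
  ((fun x => (cj (u x))) : T -> R[i]^o) @ F --> (cj l : R[i]^o).
Proof.
move=> /cvg_complexP [h1 h2]; apply/cvg_complexP; split.
  by under eq_cvg => x do rewrite Re_conj; rewrite Re_conj.
under eq_cvg => x do rewrite Im_conj.
by rewrite Im_conj; exact: cvgN.
Qed.

Lemma cvg_sqn (T : Type) (F : set_system T) {FF : Filter F}
    (u : T -> R[i]) (l : R[i]) :
  (u : T -> R[i]^o) @ F --> (l : R[i]^o) -> (fun x => sqn (u x)) @ F --> sqn l.
Proof.
move=> /cvg_complexP [h1 h2]; rewrite /sqn.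
by apply: cvgD; rewrite expr2; under eq_cvg do rewrite expr2; exact: cvgM.
Qed.

Lemma cvg0_sqn (T : Type) (F : set_system T) {FF : Filter F} (u : T -> R[i]) :
  (fun x => sqn (u x)) @ F --> (0 : R) ->
  (u : T -> R[i]^o) @ F --> (0 : R[i]^o).
Proof.
move=> /cvgrPdist_lt h; apply/cvgrPdist_lt => e /gt0_real_complex [-> e0].
have := h _ (exprn_gt0 2 e0); apply: filterS => x.
by rewrite !sub0r !normrN ger0_norm ?sqn_ge0// norm_lt_sqn.
Qed.

(** Expanding the nonnegative sum of [sqn (C a_n - S c_n)] gives C (C A - |S|^2). Dividing by C
    needs C nonzero, and C = 0 makes every c_n vanish. *)
Lemma sum_cauchy_schwarz (I : Type) (r : seq I) (a c : I -> R[i]) :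
  sqn (\sum_(n <- r) a n * (cj (c n))) <=
  (\sum_(n <- r) sqn (a n)) * (\sum_(n <- r) sqn (c n)).
Proof.
set A := \sum_(n <- r) sqn (a n); set C := \sum_(n <- r) sqn (c n).
set S := \sum_(n <- r) _.
have A0 : 0 <= A by apply: sumr_ge0 => i _; exact: sqn_ge0.
have C0 : 0 <= C by apply: sumr_ge0 => i _; exact: sqn_ge0.
have E : \sum_(n <- r) sqn (C%:C * a n - S * c n) = C * (C * A - sqn S).
  have e n : sqn (C%:C * a n - S * c n) = C ^+ 2 * sqn (a n)
      - 2 * C * complex.Re ((cj S) * (a n * (cj (c n)))) + sqn S * sqn (c n).
    by case: S (a n) (c n) => s1 s2 [a1 a2] [c1 c2]; rewrite /sqn /=; ring.
  under eq_bigr do rewrite e.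
  rewrite big_split sumrB /= -!mulr_sumr -Re_sum -mulr_sumr -/A -/C -/S.
  by case: S {e} => s1 s2; rewrite /sqn /=; ring.
have : 0 <= C * (C * A - sqn S) by rewrite -E sumr_ge0// => i _; exact: sqn_ge0.
have [C00 _|Cn0 h] := eqVneq C 0; last first.
  have Cp : 0 < C by rewrite lt_def Cn0.
  by move: h; rewrite pmulr_rge0// subr_ge0 mulrC.
rewrite C00 mulr0.
suff -> : S = 0 by rewrite sqn0.
move: C00; rewrite /C /S; move=> {E A0 C0 A C S}; elim: r => [|i r IH]; first by rewrite !big_nil.
rewrite !big_cons => /eqP; rewrite paddr_eq0 ?sqn_ge0//; last first.
  by apply: sumr_ge0 => j _; exact: sqn_ge0.
by move=> /andP[]; rewrite sqn_eq0 => /eqP -> /eqP /IH ->; rewrite rmorph0 mulr0 addr0.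
Qed.

End ComplexBasics.

(** * Limits, absolute convergence and inner products of complex sequences *)

Section SequenceBasics.
Variable R : realType.
Implicit Types (a c : nat -> R[i]).

Definition ccvg (u : nat -> R[i]) (l : R[i]) :=
  (u : nat -> R[i]^o) @ \oo --> (l : R[i]^o).

Lemma ccvgP u l : ccvg u l <->
  (fun n => complex.Re (u n)) @ \oo --> complex.Re l /\
  (fun n => complex.Im (u n)) @ \oo --> complex.Im l.
Proof. exact: cvg_complexP. Qed.

Lemma ccvg_ext u v l : (forall n, u n = v n) -> ccvg u l -> ccvg v l.
Proof. by move=> /funext ->. Qed.

Lemma ccvg_unique u l l' : ccvg u l -> ccvg u l' -> l = l'.
Proof. exact: cvg_complex_unique. Qed.

Lemma ccvg_lim u l : ccvg u l -> lim ((u : nat -> R[i]^o) @ \oo) = l.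
Proof. exact: cvg_complex_lim. Qed.

Lemma ccvg_cst l : ccvg (fun=> l) l.
Proof. exact: cvg_cst. Qed.

Lemma ccvgD u v l k : ccvg u l -> ccvg v k -> ccvg (fun n => u n + v n) (l + k).
Proof. by move=> ul vk; exact: (@cvgD _ R[i]^o _ _ _ u v l k ul vk). Qed.

Lemma ccvgM u v l k : ccvg u l -> ccvg v k -> ccvg (fun n => u n * v n) (l * k).
Proof. by move=> ul vk; exact: (@cvgM R[i] _ _ _ u v l k ul vk). Qed.

Lemma ccvgZ (k : R[i]) (u : nat -> R[i]) l : ccvg u l -> ccvg (fun n => k * u n) (k * l).
Proof. by move=> ul; exact: (@ccvgM (fun=> k) u k l (@ccvg_cst k) ul). Qed.

Lemma ccvgN u l : ccvg u l -> ccvg (fun n => - u n) (- l).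
Proof.
move=> h; have := @ccvgZ (-1) _ _ h; rewrite mulN1r; apply: ccvg_ext => n.
by rewrite mulN1r.
Qed.

Lemma ccvgB u v l k : ccvg u l -> ccvg v k -> ccvg (fun n => u n - v n) (l - k).
Proof. by move=> ul /ccvgN; exact: ccvgD. Qed.

Lemma ccvg_sum (I : Type) (r : seq I) (F : I -> nat -> R[i]) (l : I -> R[i]) :
  (forall i, ccvg (F i) (l i)) ->
  ccvg (fun n => \sum_(i <- r) F i n) (\sum_(i <- r) l i).
Proof.
move=> h; elim: r => [|i r IH].
  rewrite big_nil; apply: (@ccvg_ext (fun=> 0)); last exact: ccvg_cst.
  by move=> n; rewrite big_nil.
rewrite big_cons; have := ccvgD (h i) IH; apply: ccvg_ext => n.
by rewrite big_cons.
Qed.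

Lemma ccvg_conj u l : ccvg u l -> ccvg (fun n => cj (u n)) (cj l).
Proof. exact: cvg_conj. Qed.

Lemma ccvg_sqn u l : ccvg u l -> (fun n => sqn (u n)) @ \oo --> sqn l.
Proof. exact: cvg_sqn. Qed.

Lemma ccvg0_sqn u : (fun n => sqn (u n)) @ \oo --> (0 : R) -> ccvg u 0.
Proof. exact: cvg0_sqn. Qed.

Lemma ccvg_shiftS u l : ccvg (fun n => u n.+1) l <-> ccvg u l.
Proof. by rewrite /ccvg -(@cvg_shiftS R[i]^o u (nbhs (l : R[i]^o))). Qed.

Lemma ccvg_real (x : nat -> R) (l : R) : x @ \oo --> l ->
  ccvg (fun n => (x n)%:C) l%:C.
Proof. by move=> h; apply/ccvgP; split => //=; exact: cvg_cst. Qed.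

Definition cabs (z : R[i]) : R := Num.sqrt (sqn z).

Lemma cabsE z : `|z| = (cabs z)%:C.
Proof. exact: normcEsqrt. Qed.

Lemma cabs_ge0 z : 0 <= cabs z.
Proof. exact: sqrtr_ge0. Qed.

Lemma sqr_cabs z : cabs z ^+ 2 = sqn z.
Proof. by rewrite sqr_sqrtr ?sqn_ge0. Qed.

Lemma cabsM z w : cabs (z * w) = cabs z * cabs w.
Proof. by rewrite /cabs sqnM sqrtrM ?sqn_ge0. Qed.

Lemma cabsX z n : cabs (z ^+ n) = cabs z ^+ n.
Proof. by apply: complexI; rewrite -cabsE normrX cabsE rmorphXn. Qed.

Lemma cabsD_le z w : cabs (z + w) <= cabs z + cabs w.
Proof. by rewrite -lecR rmorphD /= -!cabsE ler_normD. Qed.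

Lemma cabsN z : cabs (- z) = cabs z.
Proof. by rewrite /cabs sqnN. Qed.

Lemma cabs0 : cabs 0 = 0.
Proof. by rewrite /cabs sqn0 sqrtr0. Qed.

Lemma cabs_conj z : cabs (cj z) = cabs z.
Proof. by rewrite /cabs sqn_conj. Qed.

Lemma cabs_sum (I : Type) (r : seq I) (P : pred I) (F : I -> R[i]) :
  cabs (\sum_(i <- r | P i) F i) <= \sum_(i <- r | P i) cabs (F i).
Proof.
elim/big_rec2: _ => [|i x y _ h]; first by rewrite cabs0.
by rewrite (le_trans (cabsD_le _ _))// lerD2l.
Qed.

Lemma Re_le_cabs z : `|complex.Re z| <= cabs z.
Proof.
rewrite -ler_sqr ?nnegrE ?normr_ge0 ?cabs_ge0// sqr_cabs real_normK ?num_real//.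
exact: sqr_Re_le.
Qed.

Lemma Im_le_cabs z : `|complex.Im z| <= cabs z.
Proof.
rewrite -ler_sqr ?nnegrE ?normr_ge0 ?cabs_ge0// sqr_cabs real_normK ?num_real//.
exact: sqr_Im_le.
Qed.

Lemma nneg_series_cvg (x : nat -> R) (B : R) : (forall n, 0 <= x n) ->
  (forall N, \sum_(0 <= n < N) x n <= B) -> cvgn (series x).
Proof.
move=> x0 xB; apply: nondecreasing_is_cvgn; first by apply: nondecreasing_series => n _ _; exact: x0.
exists B => _ [n _ <-]; exact: xB.
Qed.

Lemma nneg_series_tail (x : nat -> R) (B : R) : (forall n, 0 <= x n) ->
  (forall N, \sum_(0 <= n < N) x n <= B) ->
  forall e, 0 < e -> exists N, forall n m, (N <= n)%N ->
    \sum_(n <= k < m) x k <= e.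
Proof.
move=> x0 xB e e0; have xc := nneg_series_cvg x0 xB.
have /cvgrPdist_lt /(_ e e0) [N _ hN] := xc.
exists N => n m Nn.
have [mn|/ltnW nm] := leqP m n; first by rewrite big_geq ?ltW.
have -> : \sum_(n <= k < m) x k = series x m - series x n.
  by rewrite /series /= (big_cat_nat (leq0n n) nm) /= addrAC subrr add0r.
have h1 : series x m <= limn (series x).
  by apply: nondecreasing_cvgn_le xc _; apply: nondecreasing_series => i _ _; exact: x0.
by have /ltW := hN _ Nn; rewrite ler_norml => /andP[_ h2]; lra.
Qed.

Lemma geo_sum_le (s : R) N : 0 <= s < 1 ->
  \sum_(0 <= k < N) s ^+ k <= (1 - s)^-1.
Proof.
move=> /andP[s0 s1]; have s1' : 0 < 1 - s by rewrite subr_gt0.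
suff e : (1 - s) * \sum_(0 <= k < N) s ^+ k = 1 - s ^+ N.
  by rewrite -(ler_pM2l s1') e divff ?gt_eqF// gerBl exprn_ge0.
elim: N => [|N IH]; first by rewrite big_geq// expr0 mulr0 subrr.
by rewrite big_nat_recr//= mulrDr IH exprS; ring.
Qed.

Lemma abs_series_cvg (u : nat -> R[i]) (B : R) :
  (forall N, \sum_(0 <= n < N) cabs (u n) <= B) ->
  exists l, ccvg (series u) l /\ cabs l <= B.
Proof.
move=> uB.
have cre (f : R[i] -> R) : (forall z, `|f z| <= cabs z) -> cvgn (series (f \o u)).
  move=> fle; apply: normed_cvg.
  apply: (@nneg_series_cvg _ B) => [n|N]; first exact: normr_ge0.
  apply: le_trans (uB N).
  by apply: ler_sum => i _; exact: fle.
have h1 := cre _ Re_le_cabs; have h2 := cre _ Im_le_cabs.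
have h : ccvg (series u)
    (limn (series (@complex.Re R \o u)) +i* limn (series (@complex.Im R \o u))).
  apply/ccvgP; split => /=.
    by under eq_cvg do rewrite Re_sum; exact: h1.
  by under eq_cvg do rewrite Im_sum; exact: h2.
eexists; split; first exact: h.
have B0 : 0 <= B by have := uB 0%N; rewrite big_geq.
rewrite -ler_sqr ?nnegrE ?cabs_ge0// sqr_cabs.
have hs := ccvg_sqn h.
rewrite -(cvg_lim _ hs)//.
apply: limr_le; first by apply/cvg_ex; eexists; exact: hs.
apply: nearW => N; rewrite -sqr_cabs ler_sqr ?nnegrE ?cabs_ge0//.
exact: le_trans (cabs_sum _ _ _) (uB N).
Qed.

(** Square-summability with an explicit bound on partial sums, so that estimates never handle the
    value of an infinite sum. *)
Definition l2bd a (B : R) := forall N, \sum_(0 <= n < N) sqn (a n) <= B.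

Lemma l2bd_ge0 a B : l2bd a B -> 0 <= B.
Proof. by move=> /(_ 0%N); rewrite big_geq. Qed.

Lemma l2bd_term a B n : l2bd a B -> sqn (a n) <= B.
Proof.
move=> /(_ n.+1); apply: le_trans; rewrite big_nat_recr//= lerDr.
by apply: sumr_ge0 => i _; exact: sqn_ge0.
Qed.

Lemma nneseries_leP a B :
  (\sum_(0 <= n <oo) (normsq (a n : R[i]^o))%:E <= B%:E)%E <-> l2bd a B.
Proof.
split => [h N|h].
  have := nneseries_lim_ge (P := xpredT) (m := 0)
    (u_ := fun n => (normsq (a n : R[i]^o))%:E) N.
  move=> /(_ _)/le_trans -/(_ _ _ h); rewrite sumEFin lee_fin.
  under eq_bigr do rewrite normsqE; apply => n _ _.
  by rewrite lee_fin normsqE sqn_ge0.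
apply: lime_le.
  by apply: is_cvg_nneseries => n _ _; rewrite lee_fin normsqE sqn_ge0.
apply: nearW => N; rewrite sumEFin lee_fin.
by under eq_bigr do rewrite normsqE; exact: h.
Qed.

Lemma square_summableP a : square_summable a <-> exists B, l2bd a B.
Proof.
rewrite /square_summable; split; last first.
  by move=> [B /nneseries_leP h]; rewrite (le_lt_trans h)// ltry.
set S := (X in (X < _)%E).
have S0 : (0 <= S)%E.
  by apply: nneseries_ge0 => n _ _; rewrite lee_fin normsqE sqn_ge0.
move=> h; exists (fine S); apply/nneseries_leP.
by rewrite fineK// ge0_fin_numE.
Qed.

Lemma l2bd_tail a B : l2bd a B -> forall e, 0 < e -> exists N, forall n m,
  (N <= n)%N -> \sum_(n <= k < m) sqn (a k) <= e.
Proof. by move=> aB; apply: nneg_series_tail aB => n; exact: sqn_ge0. Qed.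

Lemma l2bdD a c A C : l2bd a A -> l2bd c C ->
  l2bd (fun n => a n + c n) (2 * (A + C)).
Proof.
move=> aA cC N; apply: (@le_trans _ _
  (\sum_(0 <= n < N) 2 * (sqn (a n) + sqn (c n)))).
  by apply: ler_sum => i _; exact: sqnD_le.
by rewrite -mulr_sumr big_split /= ler_pM2l// lerD.
Qed.

Lemma l2bd_ext a c B : (forall n, a n = c n) -> l2bd a B -> l2bd c B.
Proof. by move=> ac aB N; under eq_bigr do rewrite -ac. Qed.

Lemma l2bdZ (k : R[i]) a A : l2bd a A -> l2bd (fun n => k * a n) (sqn k * A).
Proof.
move=> aA N; under eq_bigr do rewrite sqnM.
by rewrite -mulr_sumr ler_wpM2l ?sqn_ge0.
Qed.

Lemma l2bdB a c A C : l2bd a A -> l2bd c C -> l2bd (fun n => a n - c n) (2 * (A + C)).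
Proof.
move=> aA /(l2bdZ (-1)); rewrite sqnN sqn1 mul1r => /(l2bdD aA).
by apply: l2bd_ext => n; rewrite mulN1r.
Qed.

(** The l^2 inner product as a relation: its value is carried as a limit, and existence is a
    separate matter ([dotcvg_exists]). *)
Definition dotcvg a c l :=
  ccvg (series (fun n => a n * cj (c n))) l.

Lemma dotcvg_exists a c A C : l2bd a A -> l2bd c C -> exists l, dotcvg a c l.
Proof.
move=> aA cC.
suff [l [h _]] : exists l, dotcvg a c l /\ cabs l <= A + C by exists l.
apply: abs_series_cvg => N.
apply: (@le_trans _ _ (\sum_(0 <= n < N) (sqn (a n) + sqn (c n)))).
  apply: ler_sum => n _; rewrite cabsM cabs_conj -!sqr_cabs.
  have := sqr_ge0 (cabs (a n) - cabs (c n)).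
  have := sqr_ge0 (cabs (a n)); have := sqr_ge0 (cabs (c n)).
  rewrite sqrrB; nra.
by rewrite big_split lerD.
Qed.

Lemma dotcvg_conj a c l : dotcvg a c l -> dotcvg c a (cj l).
Proof.
move=> /ccvg_conj; apply: ccvg_ext => N; rewrite /series /= rmorph_sum /=.
by apply: eq_bigr => i _; rewrite rmorphM /= conjCK mulrC.
Qed.

Lemma dotcvgZ (k : R[i]) a c l : dotcvg a c l ->
  dotcvg (fun n => k * a n) c (k * l).
Proof.
move=> h; have := @ccvgZ k _ _ h; apply: ccvg_ext => N; rewrite /series /= mulr_sumr.
by apply: eq_bigr => i _; rewrite mulrA.
Qed.

Lemma dotcvgB a b c l l' : dotcvg a c l -> dotcvg b c l' ->
  dotcvg (fun n => a n - b n) c (l - l').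
Proof.
move=> h /(ccvgB h); apply: ccvg_ext => N; rewrite /series /= -sumrB /=.
by apply: eq_bigr => i _; rewrite mulrBl.
Qed.

Lemma dotcvg_unique a c l l' : dotcvg a c l -> dotcvg a c l' -> l = l'.
Proof. exact: ccvg_unique. Qed.

Lemma dotcvg_self_eq0 a : dotcvg a a 0 -> forall n, a n = 0.
Proof.
move=> /ccvgP[h _] n; apply/eqP; rewrite -sqn_eq0.
rewrite eq_le sqn_ge0 andbT.
have e N : complex.Re (series (fun n => a n * (cj (a n))) N) =
    series (fun n => sqn (a n)) N.
  by rewrite /series /= Re_sum; apply: eq_bigr => i _; rewrite mulC_conj.
move: h; under eq_cvg do rewrite e; rewrite /= => h.
apply: (@le_trans _ _ (series (fun n => sqn (a n)) n.+1)).
  rewrite /series /= big_nat_recr//= lerDr sumr_ge0// => i _; exact: sqn_ge0.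
rewrite -(cvg_lim _ h)//; apply: nondecreasing_cvgn_le.
  by apply: nondecreasing_series => i _ _; exact: sqn_ge0.
by apply/cvg_ex; exists 0.
Qed.

Lemma sum_nat_eq (V : zmodType) (F : nat -> V) n m : (n <= m)%N ->
  \sum_(0 <= k < m) F k - \sum_(0 <= k < n) F k = \sum_(n <= k < m) F k.
Proof.
by move=> nm; rewrite (big_cat_nat (leq0n n) nm) /= addrAC subrr add0r.
Qed.

End SequenceBasics.

(** * Frames and their synthesis operator *)

Section HilbertFrames.
Variables (R : realType) (H : completeNormedModType R[i]).
Variables (ip : {dot H for Num.conj}) (Hip : hilbert_inner ip).
Implicit Types (x y z : H).

Definition hn x : R := complex.Re `|x|.

Lemma hnE x : `|x| = (hn x)%:C.
Proof.
have := normr_ge0 x; rewrite /hn; case: `|x| => a b.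
by rewrite lecE /= => /andP[/eqP -> _].
Qed.

Lemma hn_ge0 x : 0 <= hn x.
Proof. by have := normr_ge0 x; rewrite hnE lecR. Qed.

Lemma normsq_hn x : normsq x = hn x ^+ 2.
Proof. by []. Qed.

Lemma hnD_le x y : hn (x + y) <= hn x + hn y.
Proof. by rewrite -lecR rmorphD /= -!hnE ler_normD. Qed.

Lemma hn0 : hn 0 = 0.
Proof. by rewrite /hn normr0. Qed.

Lemma hnN x : hn (- x) = hn x.
Proof. by rewrite /hn normrN. Qed.

Lemma hn_sum (I : Type) (r : seq I) (P : pred I) (F : I -> H) :
  hn (\sum_(i <- r | P i) F i) <= \sum_(i <- r | P i) hn (F i).
Proof.
elim/big_rec2: _ => [|i x y _ h]; first by rewrite hn0.
by rewrite (le_trans (hnD_le _ _))// lerD2l.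
Qed.

Lemma normsq_ge0 x : 0 <= normsq x.
Proof. by rewrite normsq_hn sqr_ge0. Qed.

Lemma normsq_eq0 x : normsq x = 0 -> x = 0.
Proof.
by move=> /eqP; rewrite normsq_hn sqrf_eq0 => /eqP h; apply: normr0_eq0; rewrite hnE h.
Qed.

Lemma hcvgP (u : nat -> H) (l : H) :
  u @ \oo --> l <-> (fun n => normsq (u n - l)) @ \oo --> (0 : R).
Proof.
split.
- move=> /cvgrPdist_lt h; apply/cvgrPdist_lt => e e0.
  have := h (Num.sqrt e)%:C; rewrite ltcR sqrtr_gt0 => /(_ e0).
  apply: filterS => n; rewrite sub0r normrN distrC hnE ltcR normsq_hn => h1.
  rewrite ger0_norm ?sqr_ge0// -(sqr_sqrtr (ltW e0)).
  by rewrite ltr_sqr ?nnegrE ?hn_ge0 ?sqrtr_ge0.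
- move=> /cvgrPdist_lt h; apply/cvgrPdist_lt => e /gt0_real_complex [-> e0].
  have := h _ (exprn_gt0 2 e0).
  apply: filterS => n; rewrite sub0r normrN distrC hnE ltcR normsq_hn.
  by rewrite ger0_norm ?sqr_ge0// ltr_sqr ?nnegrE ?hn_ge0// ltW.
Qed.

Lemma h_complete (u : nat -> H) :
  (forall e : R, 0 < e -> exists N, forall n m, (N <= n)%N -> (n <= m)%N ->
     hn (u m - u n) <= e) -> exists l : H, u @ \oo --> l.
Proof.
move=> h; apply/cvg_ex; apply/cauchy_cvgP/cauchy_exP => e /gt0_real_complex [-> e0].
have [N hN] := h (complex.Re e / 2) (divr_gt0 e0 (ltr0Sn _ 1)).
exists (u N); exists N => // n /= Nn; rewrite -ball_normE /= distrC hnE ltcR.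
apply: le_lt_trans (hN _ _ (leqnn N) Nn) _.
by rewrite ltr_pdivrMr// mulr_natr mulr2n ltrDl.
Qed.

Lemma ipC x y : ip x y = cj (ip y x).
Proof. by rewrite hermC expr0 mul1r. Qed.

Lemma ipDl x y z : ip (x + y) z = ip x z + ip y z.
Proof. exact: linearDl. Qed.
Lemma ipBl x y z : ip (x - y) z = ip x z - ip y z.
Proof. exact: linearBl. Qed.
Lemma ipZl (a : R[i]) x z : ip (a *: x) z = a * ip x z.
Proof. exact: linearZl_LR. Qed.
Lemma ip0l z : ip 0 z = 0.
Proof. exact: linear0l. Qed.
Lemma ip_suml (I : Type) (r : seq I) (P : pred I) (F : I -> H) z :
  ip (\sum_(i <- r | P i) F i) z = \sum_(i <- r | P i) ip (F i) z.
Proof. exact: linear_sumlz. Qed.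

Lemma normsqE_ip x : (normsq x)%:C = ip x x.
Proof. by rewrite Hip hnE normsq_hn rmorphXn. Qed.

Lemma ipBr x y z : ip x (y - z) = ip x y - ip x z.
Proof. by rewrite ipC ipBl rmorphB /= -!ipC. Qed.

Lemma normsqRe x : normsq x = complex.Re (ip x x).
Proof. by rewrite -normsqE_ip. Qed.

Lemma normsqB x y :
  normsq (x - y) = normsq x - 2 * complex.Re (ip y x) + normsq y.
Proof.
rewrite !normsqRe ipBl !ipBr !ReB [ip x y]ipC Re_conj; ring.
Qed.

Lemma normsqZ (a : R[i]) x : normsq (a *: x) = sqn a * normsq x.
Proof.
by apply: complexI; rewrite normsqE_ip dnormZ rmorphM /= sqnE normsqE_ip.
Qed.

Lemma normsqD_le x y : normsq (x + y) <= 2 * (normsq x + normsq y).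
Proof.
rewrite !normsq_hn; have := hnD_le x y; have := hn_ge0 x; have := hn_ge0 y.
have := hn_ge0 (x + y); have := sqr_ge0 (hn x - hn y); rewrite sqrrB; nra.
Qed.

Lemma ip_cauchy_schwarz x y : sqn (ip x y) <= normsq x * normsq y.
Proof.
have [->|y0] := eqVneq y 0.
  rewrite ipC ip0l sqn_conj sqn0 mulr_ge0 ?normsq_ge0//.
have Y0 : 0 < normsq y.
  rewrite lt_def normsq_ge0 andbT; apply: contra_neq y0; exact: normsq_eq0.
have := normsq_ge0 ((normsq y)%:C *: x - ip x y *: y).
rewrite normsqB !normsqZ sqn_real.
rewrite ipZl [ip y _]ipC ipZl rmorphM /= -ipC.
set s := ip x y; set a := normsq x; set b := normsq y in Y0 *.
have -> : complex.Re (s * (cj b%:C * ip y x)) = b * sqn s.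
  by rewrite [ip y x]ipC -/s; case: s => s1 s2; rewrite /sqn /=; ring.
move=> h; have {}h : 0 <= b * (a * b - sqn s) by lra.
by move: h; rewrite pmulr_rge0// subr_ge0.
Qed.

Lemma hcvg_ip (u : nat -> H) (l x : H) :
  u @ \oo --> l -> ccvg (fun n => ip (u n) x) (ip l x).
Proof.
move=> /hcvgP h.
have h0 : ccvg (fun n => ip (u n - l) x) 0.
  apply: ccvg0_sqn; apply: (@squeeze_cvgr _ _ _ _ (fun=> 0) (fun n => normsq (u n - l) * normsq x)).
  - by apply: nearW => n; rewrite sqn_ge0 ip_cauchy_schwarz.
  - exact: cvg_cst.
  - by rewrite -(mul0r (normsq x)); apply: cvgM => //; exact: cvg_cst.
have := ccvgD h0 (@ccvg_cst _ (ip l x)); rewrite add0r.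
by apply: ccvg_ext => n; rewrite ipBl subrK.
Qed.

Lemma hcvg_unique (u : nat -> H) (l l' : H) :
  u @ \oo --> l -> u @ \oo --> l' -> l = l'.
Proof.
move=> h h'; apply/eqP; rewrite -subr_eq0; apply/eqP/normsq_eq0/complexI.
rewrite normsqE_ip ipBl; apply/eqP; rewrite subr_eq0; apply/eqP.
exact: ccvg_unique (hcvg_ip (x := l - l') h) (hcvg_ip (x := l - l') h').
Qed.

Lemma h_abs_series (d : nat -> H) (B : R) :
  (forall N, \sum_(0 <= n < N) hn (d n) <= B) -> exists l : H, series d @ \oo --> l.
Proof.
move=> dB; apply: h_complete => e e0.
have [N hN] := nneg_series_tail (fun n => hn_ge0 (d n)) dB e0.
exists N => n m Nn nm; rewrite /series /= sum_nat_eq//.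
exact: le_trans (hn_sum _ _ _) (hN _ _ Nn).
Qed.

Variables (g : nat -> H) (A B : R).
Hypotheses (A0 : 0 < A) (B0 : 0 < B).
Hypothesis frame_upper : forall x, l2bd (fun n => ip x (g n)) (B * normsq x).
(** The lower frame bound, tested against all upper bounds C of the partial sums instead of their
    supremum. *)
Hypothesis frame_lower : forall x C,
  l2bd (fun n => ip x (g n)) C -> A * normsq x <= C.

Local Notation an x := (fun n => ip x (g n)).

Definition synth (c : nat -> R[i]) y := series (fun n => c n *: g n) @ \oo --> y.

Lemma synth_unique c y y' : synth c y -> synth c y' -> y = y'.
Proof. exact: hcvg_unique. Qed.

Lemma synth_dot c y x : synth c y -> dotcvg c (an x) (ip y x).
Proof.
move=> h; have := hcvg_ip (x := x) h; apply: ccvg_ext => N; rewrite /series /= ip_suml.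
by apply: eq_bigr => i _; rewrite ipZl -ipC.
Qed.

(** Synthesis is adjoint to analysis: |y|^2 is the pairing of c with the coefficients <y, g_k>, so
    Cauchy-Schwarz and the upper frame bound give |y|^4 <= S B |y|^2. *)
Lemma synth_bound_fin (c : nat -> R[i]) n m :
  normsq (\sum_(n <= k < m) c k *: g k) <= B * \sum_(n <= k < m) sqn (c k).
Proof.
set y := \sum_(n <= k < m) _; set S := \sum_(n <= k < m) sqn _.
have S0 : 0 <= S by apply: sumr_ge0 => i _; exact: sqn_ge0.
have e : (normsq y)%:C = \sum_(n <= k < m) c k * cj (ip y (g k)).
  by rewrite normsqE_ip {1}/y ip_suml; apply: eq_bigr => i _; rewrite ipZl -ipC.
have := sum_cauchy_schwarz (index_iota n m) c (an y).
rewrite -e sqn_real -/S => h.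
have h2 : \sum_(n <= k < m) sqn (ip y (g k)) <= B * normsq y.
  apply: le_trans (frame_upper y (maxn n m)); rewrite (big_cat_nat (leq0n n) (leq_maxl n m)) /=.
  rewrite -[X in X <= _]add0r lerD//; first by apply: sumr_ge0 => i _; exact: sqn_ge0.
  have [nm|/ltnW mn] := leqP n m.
    by [].
  by rewrite [leLHS]big_geq// sumr_ge0// => i _; exact: sqn_ge0.
have h3 : normsq y ^+ 2 <= S * (B * normsq y) by apply: le_trans h _; rewrite ler_wpM2l.
have [->|y0] := eqVneq (normsq y) 0; first by rewrite mulr_ge0// ltW.
have yp : 0 < normsq y by rewrite lt_def y0 normsq_ge0.
by rewrite -(ler_pM2r yp); nra.
Qed.

Lemma synth_exists c C : l2bd c C -> exists y, synth c y.
Proof.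
move=> cC; apply: h_complete => e e0.
have e2 : 0 < e ^+ 2 / B by rewrite divr_gt0// exprn_gt0.
have [N hN] := l2bd_tail cC e2.
exists N => n m Nn nm; rewrite /series /= sum_nat_eq//.
rewrite -ler_sqr ?nnegrE ?hn_ge0 ?(ltW e0)// -normsq_hn.
apply: le_trans (synth_bound_fin _ _ _) _.
by rewrite mulrC -ler_pdivlMr// hN.
Qed.

Lemma synth_bound c C y : l2bd c C -> synth c y -> normsq y <= B * C.
Proof.
move=> cC yc.
have h := ccvg_sqn (hcvg_ip (x := y) yc).
have e : sqn (ip y y) = normsq y ^+ 2 by rewrite -normsqE_ip sqn_real.
have : normsq y ^+ 2 <= B * C * normsq y.
  rewrite -e -(cvg_lim _ h)//; apply: limr_le.
    by apply/cvg_ex; eexists; exact: h.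
  apply: nearW => N; apply: le_trans (ip_cauchy_schwarz _ _) _.
  rewrite ler_wpM2r ?normsq_ge0//.
  by apply: le_trans (synth_bound_fin _ _ _) _; rewrite ler_wpM2l ?(ltW B0).
have [->|y0] := eqVneq (normsq y) 0.
  by rewrite mulr_ge0 ?(ltW B0)// (l2bd_ge0 cC).
have yp : 0 < normsq y by rewrite lt_def y0 normsq_ge0.
by rewrite expr2 ler_pM2r.
Qed.

Lemma synthB c c' y y' : synth c y -> synth c' y' ->
  synth (fun n => c n - c' n) (y - y').
Proof.
move=> h h'; have := [elaborate cvgB h h']; rewrite /synth.
suff -> : series (fun n => (c n - c' n) *: g n) =
  series (fun n => c n *: g n) \- series (fun n => c' n *: g n) by apply.
apply/funext => N; rewrite /series /= -sumrB.
by apply: eq_bigr => i _; rewrite scalerBl.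
Qed.

Lemma synth_linear (k : R[i]) c c' y y' : synth c y -> synth c' y' ->
  synth (fun n => k * c n + c' n) (k *: y + y').
Proof.
move=> h h'; have := [elaborate cvgD (cvgZl_tmp (k := k) h) h']; rewrite /synth.
suff -> : series (fun n => (k * c n + c' n) *: g n) =
  (fun N => k *: series (fun n => c n *: g n) N + series (fun n => c' n *: g n) N) by apply.
apply/funext => N; rewrite /series /= scaler_sumr -big_split /=.
by apply: eq_bigr => i _; rewrite scalerDl scalerA.
Qed.

Lemma synth_eq0 c C : l2bd c C -> (forall x, dotcvg c (an x) 0) -> synth c 0.
Proof.
move=> cC h; have [y hy] := synth_exists cC.
suff <- : y = 0 by [].
apply: normsq_eq0; apply: complexI; rewrite normsqE_ip.
exact: dotcvg_unique (synth_dot (x := y) hy) (h y).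
Qed.

(** Here y = S x for the frame operator S, and <S x, x> is the sum of the |<x, g_n>|^2. It therefore
    serves as the bound C in both the lower frame bound and [synth_bound]. *)
Lemma frame_op_lower x y : synth (an x) y ->
  A * normsq x <= complex.Re (ip y x) /\ normsq y <= B * complex.Re (ip y x).
Proof.
move=> h.
suff bd : l2bd (an x) (complex.Re (ip y x)).
  by split; [exact: frame_lower|exact: synth_bound bd h].
move=> N; have /ccvgP[h1 _] := synth_dot (x := x) h.
have e M : complex.Re (series (fun n => an x n * cj (an x n)) M) =
    series (fun n => sqn (an x n)) M.
  by rewrite /series /= Re_sum; apply: eq_bigr => i _; rewrite mulC_conj.
move: h1; under eq_cvg do rewrite e; move=> h1.
rewrite -(cvg_lim _ h1)//.
have := @nondecreasing_cvgn_le _ (series (fun n => sqn (an x n))); apply.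
  by apply: nondecreasing_series => i _ _; exact: sqn_ge0.
by apply/cvg_ex; eexists; exact: h1.
Qed.

(** Expanding the square, |S x|^2 / B^2 is at most <S x, x> / B and cancels half of the cross term;
    the other half is at least (A / B) |x|^2. *)
Lemma frame_op_contract x y : synth (an x) y ->
  normsq (x - B^-1%:C *: y) <= (1 - A / B) * normsq x.
Proof.
move=> /frame_op_lower [h1 h2].
rewrite normsqB normsqZ ipZl sqn_real.
have -> : complex.Re (B^-1%:C * ip y x) = B^-1 * complex.Re (ip y x).
  by case: (ip y x) => a b /=; ring.
set s := complex.Re _ in h1 h2 *.
have Bi : 0 < B^-1 by rewrite invr_gt0.
have e1 : B^-1 ^+ 2 * normsq y <= B^-1 * s.
  have -> : B^-1 * s = B^-1 ^+ 2 * (B * s) by field; rewrite gt_eqF.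
  by rewrite ler_wpM2l// sqr_ge0.
have e2 : A / B * normsq x <= B^-1 * s.
  by rewrite mulrAC mulrC ler_wpM2l// ltW.
lra.
Qed.

(* Richardson iteration [x + B^-1 (y - S x)] for the frame operator S. *)
Lemma frame_op_surj y : exists x, synth (an x) y.
Proof.
have [S hS] := choice (fun x => synth_exists (frame_upper x)).
have Slin x z : S (x - z) = S x - S z.
  apply: (synth_unique (hS _)); have := synthB (hS x) (hS z).
  by congr synth; apply/funext => n; rewrite ipBl.
pose f x := x + B^-1%:C *: (y - S x).
pose X n := iter n f 0.
pose d n := X n.+1 - X n.
have fB u v : f u - f v = (u - v) - B^-1%:C *: S (u - v).
  rewrite /f opprD addrACA -scalerBr Slin -scalerN; congr (_ + _ *: _).
  by rewrite !opprB addrC subrKA.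
have dS n : d n.+1 = d n - B^-1%:C *: S (d n) by rewrite /d /X !iterS fB.
(* The frame bounds do not force A <= B when H is trivial, hence the cut-off at 0 before the square
   root. *)
pose rho := Num.max 0 (1 - A / B); pose s := Num.sqrt rho.
have rho0 : 0 <= rho by rewrite le_max lexx.
have s01 : 0 <= s < 1.
  rewrite sqrtr_ge0 /= -sqrtr1 ltr_sqrt ?ltr01// gt_max ltr01 /=.
  by rewrite gtrBl divr_gt0.
have dle n : hn (d n) <= hn (d 0%N) * s ^+ n.
  elim: n => [|n IH]; first by rewrite expr0 mulr1.
  suff h : hn (d n.+1) <= s * hn (d n).
    apply: le_trans h _; rewrite exprS mulrCA ler_wpM2l//.
    by case/andP: s01.
  rewrite -ler_sqr ?nnegrE ?mulr_ge0 ?hn_ge0 ?sqrtr_ge0// exprMn sqr_sqrtr//.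
  rewrite -!normsq_hn dS; apply: le_trans (frame_op_contract (hS _)) _.
  by rewrite ler_wpM2r ?normsq_ge0// le_max lexx orbT.
have [l dl] : exists l : H, series d @ \oo --> l.
  apply: (@h_abs_series _ (hn (d 0%N) * (1 - s)^-1)) => N.
  apply: (@le_trans _ _ (\sum_(0 <= n < N) hn (d 0%N) * s ^+ n)).
    by apply: ler_sum => i _; exact: dle.
  by rewrite -mulr_sumr ler_wpM2l ?hn_ge0// geo_sum_le.
have Xl : (fun n => normsq (X n - l)) @ \oo --> (0 : R).
  apply/hcvgP; suff <- : series d = X by [].
  by apply/funext => N; rewrite /series /= telescope_sumr// subr0.
have XSl : (fun n => normsq (X n.+1 - l)) @ \oo --> (0 : R).
  by rewrite (@cvg_shiftS _ (fun n => normsq (X n - l))).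
exists l; suff -> : y = S l by exact: hS.
apply/eqP; rewrite -subr_eq0; apply/eqP/normsq_eq0/eqP.
rewrite eq_le normsq_ge0 andbT.
(* By definition of the iteration y - S X_n = B d_n, so y - S l = B d_n + S (X_n - l). Both terms
   are bounded by distances from iterates to l, and v collects these bounds. *)
pose v n := 2 * (B ^+ 2 * (2 * (normsq (X n.+1 - l) + normsq (X n - l)))
  + B ^+ 2 * normsq (X n - l)).
have v0 : v @ \oo --> (0 : R).
  rewrite (_ : 0 = 2 * (B ^+ 2 * (2 * (0 + 0)) + B ^+ 2 * 0) :> R); last by ring.
  apply: cvgMl_tmp; apply: cvgD; apply: cvgMl_tmp => //.
  by apply: cvgMl_tmp; exact: cvgD.
rewrite -(cvg_lim _ v0)//; apply: limr_ge; first by apply/cvg_ex; exists 0.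
apply: nearW => n; rewrite /v.
have -> : y - S l = B%:C *: d n + S (X n - l).
  rewrite /d /X iterS -/(X n) /f addrAC subrr add0r scalerA -rmorphM /=.
  by rewrite divff ?gt_eqF// scale1r Slin addrA subrK.
apply: le_trans (normsqD_le _ _) _; rewrite ler_wpM2l// lerD//.
  rewrite normsqZ sqn_real ler_wpM2l ?sqr_ge0//.
  rewrite /d -[X n.+1 - X n](subrKA l) -[l - X n]opprB.
  by apply: le_trans (normsqD_le _ _) _; rewrite [normsq (- _)]normsq_hn hnN.
apply: le_trans (synth_bound (frame_upper _) (hS _)) _.
by rewrite expr2 mulrA.
Qed.

(** Solving S x = (synthesis of c) splits c into the analysis sequence of x and a kernel sequence;
    the two are orthogonal, so this is the projection onto the kernel. *)
Lemma frame_residual c C : l2bd c C ->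
  exists x, synth (fun n => c n - ip x (g n)) 0.
Proof.
move=> /synth_exists[y hy]; have [x hx] := frame_op_surj y.
by exists x; rewrite -(subrr y); exact: synthB.
Qed.

(** A |x|^2 <= <S x, x> <= |S x| |x|. This gives both uniqueness of the solution of S x = y and
    boundedness of the inverse. *)
Lemma frame_op_inv_bound x y : synth (an x) y ->
  A ^+ 2 * normsq x <= normsq y.
Proof.
move=> /frame_op_lower[h _].
have h2 : complex.Re (ip y x) ^+ 2 <= normsq y * normsq x.
  exact: le_trans (sqr_Re_le _) (ip_cauchy_schwarz _ _).
have [->|x0] := eqVneq (normsq x) 0; first by rewrite mulr0 normsq_ge0.
have xp : 0 < normsq x by rewrite lt_def x0 normsq_ge0.
rewrite -(ler_pM2r xp); apply: le_trans h2; rewrite -mulrA -expr2 -exprMn.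
have s0 : 0 <= complex.Re (ip y x) by apply: le_trans h; rewrite mulr_ge0 ?ltW.
by rewrite ler_sqr// nnegrE mulr_ge0 ?ltW.
Qed.

Definition ushift (c : nat -> R[i]) n := if n is m.+1 then c m else 0.

Lemma l2bd_shift c C : l2bd c C -> l2bd (ushift c) C.
Proof.
move=> cC [|N]; first by rewrite big_geq// (l2bd_ge0 cC).
by rewrite big_nat_recl//= sqn0 add0r.
Qed.

Lemma synth_shift c y :
  synth (ushift c) y <-> series (fun n => c n *: g n.+1) @ \oo --> y.
Proof.
rewrite /synth -(cvg_shiftS (series (fun n => ushift c n *: g n))).
suff -> : [sequence series (fun n => ushift c n *: g n) n.+1]_n =
  series (fun n => c n *: g n.+1) by [].
by apply/funext => N; rewrite /series /= big_nat_recl//= scale0r add0r.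
Qed.

(** T x is the synthesis of the shifted canonical coefficients <S^-1 x, g_n>; it is linear and
    bounded for any frame. Invariance of the kernel is what makes the choice of coefficients
    irrelevant, and hence T g_n = g_(n+1). *)
Lemma operator_of_shift_invariance :
  (forall c C, l2bd c C -> synth c 0 -> synth (ushift c) 0) ->
  exists2 T : {linear H -> H}, bounded_operator T & forall n, T (g n) = g n.+1.
Proof.
move=> inv; have [Q hQ] := choice frame_op_surj.
have Qbd x : l2bd (an (Q x)) (B * normsq (Q x)) by [].
have [T hT] := choice (fun x => synth_exists (l2bd_shift (Qbd x))).
have Qlin (k : R[i]) x y : Q (k *: x + y) = k *: Q x + Q y.
  apply/eqP; rewrite -subr_eq0; apply/eqP/normsq_eq0/eqP.
  rewrite eq_le normsq_ge0 andbT.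
  have : synth (an (Q (k *: x + y) - (k *: Q x + Q y))) 0.
    rewrite -(subrr (k *: x + y)).
    have := synthB (hQ (k *: x + y)) (synth_linear (k := k) (hQ x) (hQ y)).
    by congr synth; apply/funext => n; rewrite ipBl ipDl ipZl.
  move=> /frame_op_inv_bound; rewrite [normsq 0]normsq_hn hn0 expr0n /=.
  by rewrite pmulr_rle0// exprn_gt0.
have Tlin : linear T.
  move=> k x y; apply: (synth_unique (hT _)).
  have := synth_linear (k := k) (hT x) (hT y); congr synth; apply/funext => -[|n] /=.
    by rewrite mulr0 addr0.
  by rewrite Qlin ipDl ipZl.
pose TL := GRing.isLinear.Build _ _ _ _ T Tlin.
exists (HB.pack_for {linear H -> H} T TL) => /=.
  (* One factor B of |T x|^2 <= B (B |Q x|^2) comes from synthesis and one from analysis; |Q x|^2 <=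
     |x|^2 / A^2. *)
  exists (B / A) => x; rewrite !hnE -rmorphM lecR /=.
  have BA : 0 <= B / A by rewrite divr_ge0 ?ltW.
  have BAx : 0 <= B / A * hn x by apply: mulr_ge0 BA (hn_ge0 _).
  rewrite -ler_sqr ?nnegrE ?hn_ge0//.
  rewrite (exprMn_comm _ (mulrC _ _)) -!normsq_hn.
  apply: le_trans (synth_bound (l2bd_shift (Qbd x)) (hT x)) _.
  rewrite mulrA -expr2 expr_div_n -[leRHS]mulrA ler_wpM2l ?sqr_ge0//.
  by rewrite mulrC ler_pdivlMr ?exprn_gt0// mulrC frame_op_inv_bound.
(* The canonical coefficients of g_n and the unit sequence e both synthesize g_n, so their
   difference lies in the kernel and so does its shift. *)
move=> n; pose e k : R[i] := (k == n)%:R.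
have eS (h : nat -> H) : series (fun k => e k *: h k) @ \oo --> h n.
  apply: cvg_near_cst; exists n.+1 => // N /= nN.
  rewrite /series /= (bigD1_seq n) ?iota_uniq ?mem_index_iota//=.
  rewrite /e eqxx scale1r big1 ?addr0// => i /negPf ->.
  by rewrite scale0r.
have ebd : l2bd e 1.
  move=> N; have [nN|Nn] := ltnP n N.
    rewrite (bigD1_seq n) ?iota_uniq ?mem_index_iota//= /e eqxx sqn1.
    by rewrite big1 ?addr0// => i /negPf ->; rewrite sqn0.
  rewrite big_nat big1 ?ler01// => i /andP[_ iN].
  by rewrite /e ltn_eqF ?sqn0// (leq_trans iN Nn).
have := l2bdD (Qbd (g n)) (l2bdZ (-1) ebd).
move=> bd; have := inv _ _ bd.
have h0 : synth (fun k => an (Q (g n)) k + -1 * e k) 0.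
  rewrite -(subrr (g n)); have := synthB (hQ (g n)) (eS g).
  by congr synth; apply/funext => k; rewrite mulN1r.
move=> /(_ h0) h1.
have h2 : synth (ushift e) (g n.+1) by apply/synth_shift; exact: (eS (fun k => g k.+1)).
have := synth_unique h1 (_ : synth _ (T (g n) - g n.+1)).
move=> H0; apply/eqP; rewrite -subr_eq0 -H0//.
have := synthB (hT (g n)) h2; congr synth; apply/funext => -[|k] /=.
  by rewrite subrr.
by rewrite mulN1r.
Qed.

End HilbertFrames.

(** * Power series on the disk *)

Section PowerSeries.
Variable R : realType.
Implicit Types (a b : nat -> R[i]) (f h : disk R -> R[i]).

(** Each of the n terms t^k with k < n of the geometric sum is at least t^n. *)
Lemma natmul_geo_le (t : R) n : 0 <= t < 1 -> n%:R * t ^+ n <= (1 - t)^-1.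
Proof.
move=> /andP[t0 t1]; apply: le_trans (geo_sum_le n _); last by rewrite t0.
rewrite mulr_natl -[leLHS](_ : \sum_(0 <= k < n) t ^+ n = _); last first.
  by rewrite sumr_const_nat subn0.
rewrite !big_nat; apply: ler_sum => i /andP[_ iN].
by rewrite ler_wiXn2l ?(ltW t1)// ltnW.
Qed.

(** With t = sqrt r, m r^m = (m t^m) t^m, where the first factor is bounded and the second is
    summable. *)
Lemma natmul_geo_sum_le (r : R) : 0 <= r < 1 ->
  exists C, forall M, \sum_(0 <= m < M) m%:R * r ^+ m <= C.
Proof.
move=> /andP[r0 r1]; pose t := Num.sqrt r.
have t01 : 0 <= t < 1 by rewrite sqrtr_ge0 -sqrtr1 ltr_sqrt.
have /andP[t0 t1] := t01.
exists ((1 - t)^-1 * (1 - t)^-1) => M.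
apply: (@le_trans _ _ (\sum_(0 <= m < M) (1 - t)^-1 * t ^+ m)).
  apply: ler_sum => m _.
  rewrite -[in leLHS](sqr_sqrtr r0) -/t -exprM mulnC exprM expr2 mulrA.
  by rewrite ler_wpM2r ?exprn_ge0// natmul_geo_le.
rewrite -mulr_sumr ler_wpM2l ?geo_sum_le//.
by rewrite invr_ge0 subr_ge0 ltW.
Qed.

Lemma cvg_natmul_geometric (s : R) : 0 <= s < 1 ->
  (fun n : nat => n%:R * s ^+ n) @ \oo --> (0 : R).
Proof.
move=> s01; have [C hC] := natmul_geo_sum_le s01.
apply: cvg_series_cvg_0; apply: (nneg_series_cvg _ hC) => n.
by rewrite mulr_ge0// exprn_ge0//; case/andP: s01.
Qed.

Lemma disk_cabs (z : disk R) : cabs (val z) < 1.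
Proof. by move: (val z) (valP z) => w; rewrite cabsE => h; rewrite -ltcR. Qed.

Lemma cabs_lt1 (z : R[i]) : cabs z < 1 -> `|z| < 1.
Proof. by move=> h; rewrite cabsE ltcR. Qed.

Lemma geo_series_cvg (u : nat -> R[i]) (K t : R) : 0 <= t < 1 ->
  (forall n, cabs (u n) <= K * t ^+ n) ->
  exists l, ccvg (series u) l /\ cabs l <= K / (1 - t).
Proof.
move=> t01 uK; apply: abs_series_cvg => N.
have K0 : 0 <= K by have := uK 0%N; rewrite expr0 mulr1; exact: le_trans (cabs_ge0 _).
apply: (@le_trans _ _ (\sum_(0 <= n < N) K * t ^+ n)).
  by apply: ler_sum => i _; exact: uK.
by rewrite -mulr_sumr ler_wpM2l// geo_sum_le.
Qed.

Lemma bounded_power_terms a (C : R) (z : R[i]) n : (forall n, cabs (a n) <= C) ->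
  cabs (a n * z ^+ n) <= C * cabs z ^+ n.
Proof. by move=> aC; rewrite cabsM cabsX ler_wpM2r ?exprn_ge0 ?cabs_ge0. Qed.

Lemma l2bd_cabs a A n : l2bd a A -> cabs (a n) <= Num.sqrt A.
Proof. by move=> aA; rewrite ler_sqrt ?(l2bd_ge0 aA)// (l2bd_term _ aA). Qed.

Lemma power_series_exists a (C : R) : (forall n, cabs (a n) <= C) ->
  exists f, power_series f a.
Proof.
move=> aC.
have h (z : disk R) : exists l, ccvg (series (fun n => a n * val z ^+ n)) l.
  have t01 : 0 <= cabs (val z) < 1 by rewrite cabs_ge0 disk_cabs.
  have [l [hl _]] := geo_series_cvg t01 (fun n => bounded_power_terms (val z) n aC).
  by exists l.
by have [f hf] := choice h; exists f.
Qed.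

Lemma ccvg_bounded (u : nat -> R[i]) l : ccvg u l -> exists M : R, forall n, cabs (u n) <= M.
Proof.
move=> /ccvg_sqn h.
have /cvg_seq_bounded [M [_ hM]] : cvgn (fun n => sqn (u n)) by apply/cvg_ex; eexists; exact: h.
exists (Num.sqrt (M + 1)) => n.
have h1 : sqn (u n) <= M + 1.
  by apply: le_trans (ler_norm _) (hM (M + 1) _ n I); rewrite ltrDl.
by rewrite ler_sqrt// (le_trans (sqn_ge0 _) h1).
Qed.

Lemma series_terms_bounded (u : nat -> R[i]) l : ccvg (series u) l ->
  exists M : R, forall n, cabs (u n) <= M.
Proof.
move=> /ccvg_bounded[M hM]; exists (M + M) => n.
have -> : u n = series u n.+1 - series u n.
  by rewrite /series /= big_nat_recr//= addrAC subrr add0r.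
by apply: le_trans (cabsD_le _ _) _; rewrite cabsN lerD.
Qed.

(** With c = |z|, the terms are bounded at the larger radius (1 + c) / 2, and the ratio of the radii
    is 2 c / (1 + c) < 1. *)
Lemma power_series_geo f a (z : disk R) : power_series f a ->
  exists K : R, forall n,
    cabs (a n * val z ^+ n) <= K * (2 * cabs (val z) / (1 + cabs (val z))) ^+ n.
Proof.
move=> fa; set c := cabs (val z).
have c0 : 0 <= c by exact: cabs_ge0.
have c1 : c < 1 by exact: disk_cabs.
pose rho := (1 + c) / 2; have r0 : 0 < rho by rewrite divr_gt0// ltr_wpDr.
have r1 : cabs rho%:C < 1.
  rewrite /cabs sqn_real sqrtr_sqr ger0_norm ?ltW//.
  by rewrite ltr_pdivrMr//; lra.
have := fa (Sub rho%:C (cabs_lt1 r1)); rewrite SubK => /series_terms_bounded[M hM].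
exists M => n; have := hM n; rewrite !cabsM !cabsX -/c.
have -> : cabs rho%:C = rho by rewrite /cabs sqn_real sqrtr_sqr ger0_norm ?ltW.
move=> h; rewrite -(ler_pM2r (exprn_gt0 n r0)).
have -> : M * (2 * c / (1 + c)) ^+ n * rho ^+ n = M * c ^+ n.
  rewrite -mulrA -exprMn; congr (_ * _ ^+ _); rewrite /rho; field.
  by rewrite gt_eqF// ltr_wpDr.
by rewrite mulrAC ler_wpM2r// exprn_ge0.
Qed.

Lemma geo_ratio_lt1 (z : disk R) :
  0 <= 2 * cabs (val z) / (1 + cabs (val z)) < 1.
Proof.
have c0 := cabs_ge0 (val z); have c1 := disk_cabs z.
have p : 0 < 1 + cabs (val z) by rewrite ltr_wpDr.
by rewrite divr_ge0 ?mulr_ge0// ?ltW//= ltr_pdivrMr// mul1r; lra.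
Qed.

(** Boundedness of the terms at 1/2 gives |d_n| <= M 2^n; for r <= 1/4 the terms after d_0 then sum
    to at most 2 M r / (1 - 2 r) <= 4 M r, which tends to 0. The point 0 is excluded so that the
    hypothesis survives division by z in [power_series_eq0]. *)
Lemma power_series_head_eq0 (d : nat -> R[i]) :
  (forall z : disk R, val z != 0 ->
     ccvg (series (fun n => d n * val z ^+ n)) 0) -> d 0%N = 0.
Proof.
move=> hd.
pose D (r : R) (r01 : cabs r%:C < 1) : disk R := Sub r%:C (cabs_lt1 r01).
have cr (r : R) : 0 <= r -> cabs r%:C = r.
  by move=> r0; rewrite /cabs sqn_real sqrtr_sqr ger0_norm.
have h12 : cabs (2^-1 : R)%:C < 1 by rewrite cr// invf_lt1// ltr1n.
have [|M hM] := series_terms_bounded (hd (D _ h12) _).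
  by rewrite SubK eq_complex /= invr_eq0 pnatr_eq0.
have {}hM n : cabs (d n) <= M * 2 ^+ n.
  have := hM n; rewrite SubK cabsM cabsX cr// => h.
  by rewrite -ler_pdivrMr ?exprn_gt0// -exprVn.
have M0 : 0 <= M.
  by have := hM 0%N; rewrite expr0 mulr1; exact: le_trans (cabs_ge0 _).
suff key (r : R) : 0 < r -> r <= 4^-1 -> cabs (d 0%N) <= 4 * M * r.
  apply/eqP; rewrite -sqn_eq0 -sqr_cabs sqrf_eq0 eq_le cabs_ge0 andbT.
  apply/ler_addgt0Pl => e e0; rewrite addr0.
  pose r := Num.min 4^-1 (e / (4 * M + 1)).
  have p : 0 < 4 * M + 1 by rewrite ltr_wpDl ?mulr_ge0.
  have r0 : 0 < r by rewrite lt_min invr_gt0 ltr0n divr_gt0.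
  apply: (le_trans (key r r0 _)); first by rewrite ge_min lexx.
  apply: (@le_trans _ _ ((4 * M + 1) * r)).
    by rewrite ler_wpM2r ?(ltW r0)// lerDl.
  by rewrite mulrC -ler_pdivlMr// ge_min lexx orbT.
move=> r0 r4.
have r1 : cabs r%:C < 1.
  by rewrite cr ?ltW// (le_lt_trans r4)// invf_lt1// ltr1n.
have := hd (D r r1); rewrite SubK.
have -> : r%:C != 0 by rewrite eq_complex /= gt_eqF.
move=> /(_ isT) /(ccvg_shiftS _ _).2 h.
have [l [hl lb]] : exists l, ccvg (series (fun n => d n.+1 * r%:C ^+ n.+1)) l /\
    cabs l <= (2 * M * r) / (1 - 2 * r).
  apply: geo_series_cvg; first by apply/andP; split; lra.
  move=> n; rewrite cabsM cabsX cr ?(ltW r0)//.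
  apply: (@le_trans _ _ (M * 2 ^+ n.+1 * r ^+ n.+1)).
    by rewrite ler_wpM2r// exprn_ge0 ?(ltW r0).
  by rewrite !exprS exprMn le_eqVlt; apply/orP; left; apply/eqP; ring.
have e : d 0%N = - l.
  have h2 := ccvgD (@ccvg_cst _ (d 0%N)) hl.
  apply/eqP; rewrite -addr_eq0; apply/eqP.
  apply: ccvg_unique h2 _; move: h; apply: ccvg_ext => n.
  by rewrite /series /= big_nat_recl//= expr0 mulr1.
rewrite e cabsN; apply: le_trans lb _.
have p : 0 < 1 - 2 * r by lra.
have h4 : 0 <= M * r * (1 - 4 * r) by rewrite !mulr_ge0 ?(ltW r0)//; lra.
by rewrite ler_pdivrMr//; nra.
Qed.

Lemma power_series_eq0 (d : nat -> R[i]) :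
  (forall z : disk R, val z != 0 ->
     ccvg (series (fun n => d n * val z ^+ n)) 0) -> forall n, d n = 0.
Proof.
move=> hd n; elim: n d hd => [|n IH] d hd; first exact: power_series_head_eq0.
apply: (IH (fun n => d n.+1)) => z z0.
have := @ccvgZ _ (val z)^-1 _ _ (hd z z0); rewrite mulr0 -ccvg_shiftS.
apply: ccvg_ext => N; rewrite /series /= big_nat_recl//= (power_series_head_eq0 hd).
rewrite mul0r add0r mulr_sumr; apply: eq_bigr => i _.
by rewrite exprS mulrCA mulKf.
Qed.

Lemma power_series_unique f a b : power_series f a -> power_series f b -> a = b.
Proof.
move=> ha hb; apply/funext => n; apply/eqP; rewrite -subr_eq0; apply/eqP.
apply: (@power_series_eq0 (fun n => a n - b n)) => z _.
have := ccvgB (ha z) (hb z); rewrite subrr; apply: ccvg_ext => N.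
by rewrite /series /= -sumrB; apply: eq_bigr => i _; rewrite mulrBl.
Qed.

Lemma power_series_fun_unique f h a : power_series f a -> power_series h a -> f = h.
Proof.
by move=> ha hb; apply/funext => z; exact: ccvg_unique (ha z) (hb z).
Qed.

Lemma coefsE f a : power_series f a -> coefs f = a.
Proof.
move=> fa; apply: (power_series_unique _ fa); rewrite /coefs.
exact: (@xgetPex _ (fun=> 0) [set a | power_series f a] (ex_intro _ a fa)).
Qed.

Lemma H2P f : H2 f -> exists A, l2bd (coefs f) A /\ power_series f (coefs f).
Proof.
move=> [a /square_summableP[A aA] fa]; rewrite (coefsE fa).
by exists A.
Qed.

Lemma H2_intro f a A : l2bd a A -> power_series f a -> H2 f.
Proof. by move=> aA fa; exists a => //; apply/square_summableP; exists A. Qed.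

Definition conv a b n := \sum_(0 <= k < n.+1) a k * b (n - k)%N.

Lemma series_conv (u v : nat -> R[i]) N :
  series (conv u v) N = \sum_(0 <= i < N) u i * series v (N - i)%N.
Proof.
have SS (w : nat -> R[i]) n : series w n.+1 = series w n + w n.
  by rewrite /series /= big_nat_recr.
elim: N => [|N IH]; first by rewrite /series /= !big_geq.
rewrite SS IH /conv [in RHS]big_nat_recr//= subSnn SS [series v 0]big_geq// add0r.
rewrite big_nat_recr//= subnn addrA; congr (_ + _).
rewrite -big_split /= !big_nat; apply: eq_bigr => i /andP[_ iN].
by rewrite -mulrDr subSn 1?ltnW// SS.
Qed.

(* The square partial sums S_N T_N exceed the triangular ones by at most N^2
   terms, each of size O(t^N). *)
Lemma conv_series_cvg (u v : nat -> R[i]) (K L t : R) l m : 0 <= t < 1 ->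
  (forall n, cabs (u n) <= K * t ^+ n) -> (forall n, cabs (v n) <= L * t ^+ n) ->
  ccvg (series u) l -> ccvg (series v) m -> ccvg (series (conv u v)) (l * m).
Proof.
move=> /andP[t0 t1] uK vL ul vm.
have K0 : 0 <= K by have := uK 0%N; rewrite expr0 mulr1; exact: le_trans (cabs_ge0 _).
have L0 : 0 <= L by have := vL 0%N; rewrite expr0 mulr1; exact: le_trans (cabs_ge0 _).
suff h0 : ccvg (fun N => series u N * series v N - series (conv u v) N) 0.
  have := ccvgB (ccvgM ul vm) h0; rewrite subr0; apply: ccvg_ext => N.
  by rewrite opprB addrC subrK.
(* The error N^2 t^N is the square of N s^N, which tends to 0. *)
pose s := Num.sqrt t.
have s01 : 0 <= s < 1 by rewrite sqrtr_ge0 -sqrtr1 ltr_sqrt.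
have bd N : cabs (series u N * series v N - series (conv u v) N) <=
    K * L * (N%:R * s ^+ N) ^+ 2.
  rewrite series_conv {1}/series /= mulr_suml -sumrB.
  apply: le_trans (cabs_sum _ _ _) _.
  apply: (@le_trans _ _ (\sum_(0 <= i < N) N%:R * (K * L * t ^+ N))); last first.
    rewrite sumr_const_nat subn0 -[leLHS]mulr_natl exprMn -exprM mulnC exprM sqr_sqrtr//.
    by rewrite le_eqVlt; apply/orP; left; apply/eqP; ring.
  rewrite !big_nat; apply: ler_sum => i /andP[_ iN].
  rewrite -mulrBr /series /= sum_nat_eq ?leq_subr// mulr_sumr.
  apply: le_trans (cabs_sum _ _ _) _.
  apply: (@le_trans _ _ (\sum_(N - i <= j < N) K * L * t ^+ N)); last first.
    rewrite sumr_const_nat -[leLHS]mulr_natl ler_wpM2r//.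
      by rewrite !mulr_ge0// exprn_ge0.
    by rewrite ler_nat leq_subr.
  rewrite !big_nat; apply: ler_sum => j /andP[Nij jN].
  rewrite cabsM; apply: (@le_trans _ _ (K * t ^+ i * (L * t ^+ j))).
    by apply: ler_pM; rewrite ?cabs_ge0.
  rewrite mulrACA -exprD ler_wpM2l ?mulr_ge0//.
  by rewrite ler_wiXn2l ?(ltW t1)// -leq_subLR.
apply: ccvg0_sqn.
have c1 := cvg_natmul_geometric s01.
have c2 : (fun N : nat => (K * L * ((N%:R * s ^+ N) * (N%:R * s ^+ N)))) @ \oo --> (0 : R).
  by rewrite -(mulr0 (K * L)); apply: cvgMl_tmp; rewrite -[X in _ --> X](mulr0 0); apply: cvgM.
have c3 : (fun N : nat => (K * L * ((N%:R * s ^+ N) * (N%:R * s ^+ N))) ^+ 2) @ \oo --> (0 : R).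
  by rewrite -[X in _ --> X](mulr0 0); under eq_cvg do rewrite expr2; exact: cvgM.
apply: (@squeeze_cvgr _ _ _ _ (fun=> 0) _ _ _ _ _ c3); last exact: cvg_cst.
apply: nearW => N; rewrite sqn_ge0 -sqr_cabs -expr2 /=.
by rewrite ler_sqr ?nnegrE ?cabs_ge0 ?(le_trans (cabs_ge0 _) (bd N)).
Qed.

Lemma power_seriesM f h a b : power_series f a -> power_series h b ->
  power_series (f \* h) (conv a b).
Proof.
move=> fa hb z; have [K hK] := power_series_geo z fa.
have [L hL] := power_series_geo z hb.
have := conv_series_cvg (geo_ratio_lt1 z) hK hL (fa z) (hb z).
apply: ccvg_ext => N; rewrite /series /=; apply: eq_bigr => n _.
rewrite /conv mulr_suml !big_nat; apply: eq_bigr => k /andP[_ kn].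
by rewrite mulrACA -exprD subnKC.
Qed.

Lemma power_series_shift f a : power_series f a ->
  power_series (fun z => val z * f z) (ushift a).
Proof.
move=> fa z; apply/ccvg_shiftS; have := @ccvgZ _ (val z) _ _ (fa z).
apply: ccvg_ext => N; rewrite /series /= big_nat_recl//= mul0r add0r mulr_sumr.
by apply: eq_bigr => i _; rewrite exprS mulrCA.
Qed.

(** No convergence is involved: [lim] picks a point from the set of limits, and the two sets
    coincide. *)
Lemma lim_shiftS (u v : nat -> R[i]) : (forall n, u n.+1 = v n) ->
  lim ((u : nat -> R[i]^o) @ \oo) = lim ((v : nat -> R[i]^o) @ \oo).
Proof.
move=> uv; rewrite /lim; congr get; apply/seteqP; split => l /=.
  by move=> h; have := (ccvg_shiftS u l).2 h; exact: ccvg_ext.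
by move=> h; apply: (ccvg_shiftS u l).1; apply: ccvg_ext h.
Qed.

(** The backward shift is adjoint to multiplication by z, so pairing p with b h amounts to pairing f
    with b (z h), and z h is again in H^2. *)
Lemma model_space_backward_shift (b : disk R -> R[i]) f (p : disk R -> R[i]) a A : analytic_disk b ->
  model_space b f -> power_series f a -> l2bd a A ->
  power_series p (fun n => a n.+1) -> model_space b p.
Proof.
move=> [beta bb] [_ fb] fa aA pa.
have pA : l2bd (fun n => a n.+1) A.
  move=> N; apply: le_trans (aA N.+1).
  by rewrite big_nat_recl//= lerDr sqn_ge0.
split; first exact: H2_intro pA pa.
move=> h /H2P[C [hC hh]].
have zh2 : H2 (fun z => val z * h z) := H2_intro (l2bd_shift hC) (power_series_shift hh).
rewrite -(fb _ zh2) /H2_inner (coefsE fa) (coefsE pa).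
have bh := power_seriesM bb hh.
have -> : (b \* (fun z => val z * h z)) = (fun z => val z * (b \* h) z).
  by apply/funext => z; exact: mulrCA.
rewrite (coefsE (power_series_shift bh)) (coefsE bh).
symmetry; apply: lim_shiftS => N.
by rewrite /series /= big_nat_recl//= rmorph0 mulr0 add0r.
Qed.

End PowerSeries.

(** * Sequences orthogonal to their shifts *)

Section IsometricShifts.
Variable R : realType.
Implicit Types (a c phi psi : nat -> R[i]).

Lemma iter_shiftE c k n : iter k (@ushift R) c n = if (k <= n)%N then c (n - k)%N else 0.
Proof.
elim: k n => [|k IH] [|n] //=.
Qed.

Lemma l2bd_iter_shift c C k : l2bd c C -> l2bd (iter k (@ushift R) c) C.
Proof. by move=> cC; elim: k => //= k; exact: l2bd_shift. Qed.

Lemma ccvg_shiftn k (u : nat -> R[i]) l : ccvg (fun n => u (n + k)%N) l <-> ccvg u l.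
Proof. by rewrite /ccvg -(@cvg_shiftn k R[i]^o u (nbhs (l : R[i]^o))). Qed.

Lemma dotcvg_shift a c l : dotcvg a c l -> dotcvg (ushift a) (ushift c) l.
Proof.
move=> h; apply/ccvg_shiftS; apply: ccvg_ext h => N.
by rewrite /series /= big_nat_recl//= mul0r add0r.
Qed.

Lemma dotcvg_iter_shift a c l k : dotcvg a c l ->
  dotcvg (iter k (@ushift R) a) (iter k (@ushift R) c) l.
Proof. by move=> h; elim: k => //= k; exact: dotcvg_shift. Qed.

Lemma dotcvg_cs a c A C l : l2bd a A -> l2bd c C -> dotcvg a c l ->
  sqn l <= A * C.
Proof.
move=> aA cC /ccvg_sqn h; rewrite -(cvg_lim _ h)//; apply: limr_le.
  by apply/cvg_ex; eexists; exact: h.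
apply: nearW => N; apply: le_trans (sum_cauchy_schwarz _ _ _) _.
by apply: ler_pM; rewrite ?sumr_ge0// => i _; exact: sqn_ge0.
Qed.

Lemma dotcvg_selfP a (s : R) :
  dotcvg a a s%:C <-> series (fun n => sqn (a n)) @ \oo --> s.
Proof.
have e N : series (fun n => a n * cj (a n)) N = (series (fun n => sqn (a n)) N)%:C.
  by rewrite /series /= rmorph_sum; apply: eq_bigr => i _; rewrite mulC_conj.
split=> [/ccvgP[h _]|h].
  by move: h; under eq_cvg do rewrite e.
by apply: ccvg_ext (ccvg_real h) => N; rewrite e.
Qed.

Lemma dotcvg_self_bound a (s : R) : dotcvg a a s%:C -> l2bd a s.
Proof.
move=> /dotcvg_selfP h N; rewrite -(cvg_lim _ h)//.
apply: (@nondecreasing_cvgn_le _ (series (fun n => sqn (a n)))).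
  by apply: nondecreasing_series => i _ _; exact: sqn_ge0.
by apply/cvg_ex; eexists; exact: h.
Qed.

(** On the circle: the Fourier coefficients of |phi|^2 are those of the constant 1. Equivalently,
    the shifts of phi are orthonormal. *)
Definition isometric phi :=
  forall k, dotcvg (iter k (@ushift R) phi) phi (k == 0%N)%:R.

Section Isometric.
Variable phi : nat -> R[i].
Hypothesis iso : isometric phi.
Local Notation Sh k := (iter k (@ushift R) phi).

Lemma isometric_l2bd : l2bd phi 1.
Proof. by have := @iso 0%N; rewrite eqxx => h; exact: (@dotcvg_self_bound phi 1 h). Qed.

Lemma isometric_gram i j : dotcvg (Sh i) (Sh j) (i == j)%:R.
Proof.
wlog ij : i j / (j <= i)%N => [h|].
  case/orP: (leq_total i j) => [ij|]; last exact: h.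
  by have := dotcvg_conj (h _ _ ij); rewrite rmorph_nat eq_sym.
have := @dotcvg_iter_shift _ _ _ j (@iso (i - j)%N).
have <- : (i - j == 0)%N = (i == j) by rewrite subn_eq0 [RHS]eqn_leq ij andbT.
by rewrite -iterD subnKC// => h; exact: h.
Qed.

Lemma dotcvg_sumr a (r : seq nat) c (x : nat -> nat -> R[i]) (l : nat -> R[i]) :
  (forall j, dotcvg a (x j) (l j)) ->
  dotcvg a (fun n => \sum_(j <- r) c j * x j n) (\sum_(j <- r) cj (c j) * l j).
Proof.
move=> h; have := ccvg_sum (r := r) (fun j => @ccvgZ _ (cj (c j)) _ _ (h j)).
apply: ccvg_ext => N; rewrite /series /=.
under eq_bigr do rewrite mulr_sumr.
rewrite exchange_big /=; apply: eq_bigr => n _.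
rewrite rmorph_sum mulr_sumr; apply: eq_bigr => j _.
by rewrite rmorphM /= mulrCA.
Qed.

(** Pythagoras for the orthonormal shifts. The exponents e j are arbitrary distinct numbers because
    the correlation argument uses the decreasing exponents J - j. *)
Lemma isometric_comb (m J : nat) c (e : nat -> nat) :
  (forall i j, (i < J)%N -> (j < J)%N -> e i = e j -> i = j) ->
  let x n := \sum_(m <= j < J) c j * Sh (e j) n in
  dotcvg x x (\sum_(m <= j < J) sqn (c j))%:C.
Proof.
move=> einj x.
have h1 i : dotcvg (Sh (e i)) x (\sum_(m <= j < J) cj (c j) * (e i == e j)%:R).
  exact: (@dotcvg_sumr _ _ c _ _ (fun j => @isometric_gram (e i) (e j))).
have := dotcvg_conj (@dotcvg_sumr _ (index_iota m J) c _ _ (fun i => dotcvg_conj (h1 i))).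
congr (dotcvg _ _ _).
rewrite rmorph_sum /= [RHS]rmorph_sum !big_nat; apply: eq_bigr => i /andP[mi iJ] /=.
rewrite rmorphM /= !conjCK (bigD1_seq i) ?iota_uniq ?mem_index_iota ?mi//=.
rewrite eqxx mulr1 mulrDr mulC_conj big_nat_cond big1 ?mulr0 ?addr0//.
move=> j /andP[/andP[_ jJ] ji].
have [h|_] := eqVneq (e i) (e j); last by rewrite !mulr0.
by rewrite (einj i j iJ jJ h) eqxx in ji.
Qed.

(** Shifts of order above n vanish at n, so any N > n will do; below N the convolution is a finite
    combination of shifts, to which Pythagoras applies. *)
Lemma convE c n N : (n < N)%N -> conv c phi n = \sum_(0 <= j < N) c j * Sh j n.
Proof.
move=> nN; rewrite (big_cat_nat (leq0n n.+1) nN) /=.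
have -> : \sum_(n.+1 <= j < N) c j * Sh j n = 0.
  rewrite big_nat big1// => j /andP[nj _].
  by rewrite iter_shiftE leqNgt nj mulr0.
rewrite addr0 /conv !big_nat; apply: eq_bigr => k /andP[_].
by rewrite ltnS iter_shiftE => ->.
Qed.

Lemma l2bd_conv c C : l2bd c C -> l2bd (conv c phi) C.
Proof.
move=> cC N; apply: le_trans (cC N).
have := dotcvg_self_bound (@isometric_comb 0 N c id (fun _ _ _ _ h => h)).
move=> /(_ N); apply: le_trans; rewrite !big_nat.
by apply: ler_sum => i /andP[_ iN]; rewrite (convE _ iN).
Qed.

(** The first N coefficients of c contribute 0 by linearity. The tail c2 contributes at most A e /
    (A + 1) <= e in squared modulus, since convolution with phi does not increase l^2 bounds; the +
    1 covers A = 0. *)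
Lemma dotcvg_conv_eq0 a A c C : l2bd a A -> l2bd c C ->
  (forall j, dotcvg a (Sh j) 0) -> dotcvg a (conv c phi) 0.
Proof.
move=> aA cC h; have [l hl] := dotcvg_exists aA (l2bd_conv cC).
suff l0 : l = 0 by rewrite -l0.
apply/eqP; rewrite -sqn_eq0 eq_le sqn_ge0 andbT; apply/ler_addgt0Pl => e e0.
rewrite addr0; have A0 := l2bd_ge0 aA.
have e1 : 0 < e / (A + 1) by rewrite divr_gt0// ltr_wpDl.
have [N hN] := l2bd_tail cC e1.
pose c1 j := if (j < N)%N then c j else 0.
pose c2 j := if (j < N)%N then 0 else c j.
have c2b : l2bd c2 (e / (A + 1)).
  move=> M; have [MN|/ltnW NM] := leqP M N.
    rewrite big_nat big1 ?(ltW e1)// => i /andP[_ iM].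
    by rewrite /c2 (leq_trans iM MN) sqn0.
  rewrite (big_cat_nat (leq0n N) NM) /= [X in X + _]big_nat big1 ?add0r; last first.
    by move=> i /andP[_ iN]; rewrite /c2 iN sqn0.
  apply: le_trans (hN _ _ (leqnn N)); rewrite !big_nat; apply: ler_sum => i /andP[Ni _].
  by rewrite /c2 ltnNge Ni.
have hx : dotcvg a (fun n => \sum_(0 <= j < N) c j * Sh j n) 0.
  by have := @dotcvg_sumr _ (index_iota 0 N) c _ _ h; rewrite big1// => i _; rewrite mulr0.
have split n : conv c phi n = \sum_(0 <= j < N) c j * Sh j n + conv c2 phi n.
  rewrite !(@convE _ _ (maxn N n.+1)) ?leq_maxr//.
  rewrite !(big_cat_nat (leq0n N) (leq_maxl N n.+1)) /=.
  have -> : \sum_(0 <= i < N) c2 i * Sh i n = 0.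
    by rewrite big_nat big1// => i /andP[_ iN]; rewrite /c2 iN mul0r.
  rewrite add0r.
  congr (_ + _); rewrite !big_nat; apply: eq_bigr => i /andP[Ni _].
  by rewrite /c2 ltnNge Ni.
have hy : dotcvg a (conv c2 phi) l.
  have := ccvgB hl hx; rewrite subr0; apply: ccvg_ext => M.
  rewrite /series /= -sumrB; apply: eq_bigr => i _.
  by rewrite -mulrBr -rmorphB /= split addrC addKr.
apply: le_trans (dotcvg_cs aA (l2bd_conv c2b) hy) _.
rewrite mulrA ler_pdivrMr ?ltr_wpDl// mulrC ler_wpM2l ?(ltW e0)//.
by rewrite lerDl.
Qed.

(** Let p be the N-term truncation of the reproducing kernel at w. Then p b has squared norm s_N =
    p(w) and value s_N b(w) at w, so Cauchy-Schwarz against the reproducing kernel gives s_N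
    |b(w)|^2 <= 1 / (1 - |w|^2), and s_N tends to the right-hand side. *)
Lemma isometric_bounded (b : disk R -> R[i]) : power_series b phi ->
  forall z, sqn (b z) <= 1.
Proof.
move=> hb z; set w := val z; pose t := sqn w.
have t0 : 0 <= t := sqn_ge0 _.
have t1 : t < 1.
  by rewrite /t -sqr_cabs -(expr1n _ 2) ltr_sqr ?nnegrE ?cabs_ge0 ?disk_cabs.
have t1' : 0 < 1 - t by rewrite subr_gt0.
pose s N := \sum_(0 <= k < N) t ^+ k.
have sle N : s N <= (1 - t)^-1 by apply: geo_sum_le; rewrite t0 t1.
have key N : s N * sqn (b z) <= (1 - t)^-1.
  pose c j := cj w ^+ j; pose x n := \sum_(0 <= j < N) c j * Sh j n.
  have sc : \sum_(0 <= j < N) sqn (c j) = s N.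
    by apply: eq_bigr => j _; rewrite sqnX sqn_conj.
  have xs : l2bd x (s N).
    by rewrite -sc; apply: dotcvg_self_bound; exact: (@isometric_comb 0 N c id).
  have wl : l2bd (fun n => cj w ^+ n) (1 - t)^-1.
    move=> M; under eq_bigr do rewrite sqnX sqn_conj; exact: sle.
  have hx : dotcvg x (fun n => cj w ^+ n) ((s N)%:C * b z).
    have hj j : ccvg (series (fun n => Sh j n * w ^+ n)) (w ^+ j * b z).
      elim: j => [|j IH]; first by rewrite expr0 mul1r; exact: (hb z).
      apply/ccvg_shiftS; rewrite exprS -mulrA.
      have := @ccvgZ _ w _ _ IH; apply: ccvg_ext => M.
      rewrite /series /= big_nat_recl//= mul0r add0r mulr_sumr.
      by apply: eq_bigr => i _; rewrite exprS mulrCA.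
    have := ccvg_sum (r := index_iota 0 N) (fun j => @ccvgZ _ (c j) _ _ (hj j)).
    have -> : \sum_(0 <= i < N) c i * (w ^+ i * b z) = (s N)%:C * b z.
      rewrite -sc rmorph_sum mulr_suml; apply: eq_bigr => i _.
      by rewrite mulrA; congr (_ * _); rewrite /= -mulC_conj /c rmorphXn /= conjCK.
    apply: ccvg_ext => M; rewrite /series /=.
    under eq_bigr do rewrite mulr_sumr.
    rewrite exchange_big /=; apply: eq_bigr => n _.
    rewrite /x mulr_suml; apply: eq_bigr => j _.
    by rewrite rmorphXn /= conjCK mulrA.
  have := dotcvg_cs xs wl hx; rewrite sqnM sqn_real.
  have [s0|s0] := eqVneq (s N) 0; first by move=> _; rewrite s0 mul0r invr_ge0 ltW.
  have sp : 0 < s N by rewrite lt_def s0 sumr_ge0// => i _; exact: exprn_ge0.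
  by rewrite expr2 -mulrA ler_pM2l.
have slim : (fun N => s N * sqn (b z)) @ \oo --> (1 - t)^-1 * sqn (b z).
  apply: cvgMr_tmp.
  have := @cvg_geometric_series R 1 t; rewrite ger0_norm// mul1r => /(_ t1).
  suff -> : series (geometric 1 t) = s by [].
  by apply/funext => N; rewrite /series /s /=; apply: eq_bigr => i _; rewrite /geometric /= mul1r.
have : (1 - t)^-1 * sqn (b z) <= (1 - t)^-1.
  rewrite -[leLHS](cvg_lim _ slim)//; apply: limr_le; last by apply: nearW.
  by apply/cvg_ex; eexists; exact: slim.
by rewrite -[leRHS]mulr1 ler_pM2l ?invr_gt0.
Qed.

(* In l^2(Z), the correlation of phi and psi is the sum of conj(psi_j) S^-j phi
   and has norm ||psi||. The hypotheses say that all its entries vanish. *)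
Lemma isometric_corr_eq0 psi P : l2bd psi P ->
  (forall n, dotcvg psi (Sh n) 0) ->
  (forall n, dotcvg (iter n (@ushift R) psi) phi 0) -> forall n, psi n = 0.
Proof.
move=> psiP h1 h2.
(* The J-th partial sum of the correlation, moved J places to the right: position i stands for the
   index i - J in Z. *)
pose X J i := \sum_(0 <= j < J) cj (psi j) * Sh (J - j) i.
have inj J i j : (i < J)%N -> (j < J)%N -> (J - i = J - j)%N -> i = j by lia.
(* The index n - J0 in Z stays fixed along m, so the limit is one correlation entry: [h2] covers n
   >= J0 and [h1] covers n < J0. *)
have Xlim J0 n : ccvg (fun m => X (J0 + m)%N (n + m)%N) 0.
  have e m : X (J0 + m)%N (n + m)%N =
      \sum_(0 <= j < J0 + m) cj (psi j) * (if (J0 <= n + j)%N then phi (n + j - J0)%N else 0).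
    rewrite /X !big_nat; apply: eq_bigr => j /andP[_ jJ].
    rewrite iter_shiftE.
    have -> : (J0 + m - j <= n + m)%N = (J0 <= n + j)%N by lia.
    by case: ifP => // h; congr (_ * phi _); lia.
  suff : ccvg (fun J => \sum_(0 <= j < J) cj (psi j) * (if (J0 <= n + j)%N then phi (n + j - J0)%N else 0)) 0.
    move=> /(ccvg_shiftn J0 _ _).2; apply: ccvg_ext => m.
    by rewrite e addnC.
  have [Jn|/ltnW nJ] := leqP J0 n.
    have h := ccvg_conj (h2 (n - J0)%N); rewrite rmorph0 in h.
    have h' : ccvg (fun J => cj (series (fun i => iter (n - J0) (@ushift R) psi i * cj (phi i)) (n - J0 + J)%N)) 0.
      by move: h => /(ccvg_shiftn (n - J0) _ _).2; apply: ccvg_ext => J; rewrite addnC.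
    apply: ccvg_ext h' => J; rewrite rmorph_sum /=.
    rewrite (big_cat_nat (leq0n _) (leq_addr J (n - J0))) /= [X in X + _]big_nat big1 ?add0r.
      rewrite -{1}[(n - J0)%N]add0n big_addn addKn; apply: eq_bigr => j _.
      rewrite rmorphM /= conjCK iter_shiftE leq_addl addnK.
      by rewrite (leq_trans Jn (leq_addr _ _)); congr (_ * phi _); lia.
    by move=> i /andP[_ il]; rewrite iter_shiftE leqNgt il mul0r rmorph0.
  have h := ccvg_conj (h1 (J0 - n)%N); rewrite rmorph0 in h.
  apply: ccvg_ext h => J; rewrite rmorph_sum /=; apply: eq_bigr => j _.
  rewrite rmorphM /= conjCK iter_shiftE leq_subLR.
  by case: ifP => // _; congr (_ * phi _); lia.
(* The partial sum at J0 is the one at J0 + m minus a block y of squared norm at most e. As m grows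
   the former vanishes entrywise, so X J0 has squared norm at most 2 e; by Pythagoras that norm is
   the partial sum of |psi_j|^2. *)
have key e : 0 < e -> exists N, forall J0, (N <= J0)%N ->
    \sum_(0 <= j < J0) sqn (psi j) <= 2 * e.
  move=> e0; have [N hN] := l2bd_tail psiP e0; exists N => J0 NJ.
  suff W0 W : \sum_(0 <= n < W) sqn (X J0 n) <= 2 * e.
    have := @isometric_comb 0 J0 (fun j => cj (psi j)) (fun j => J0 - j)%N (@inj J0).
    move=> /dotcvg_selfP.
    have -> : \sum_(0 <= j < J0) sqn (cj (psi j)) = \sum_(0 <= j < J0) sqn (psi j).
      by apply: eq_bigr => j _; rewrite sqn_conj.
    move=> h; rewrite -(cvg_lim _ h)//; apply: limr_le.
      by apply/cvg_ex; eexists; exact: h.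
    by apply: nearW => W; exact: W0.
  have lim1 : (fun m => 2 * \sum_(0 <= n < W) sqn (X (J0 + m)%N (n + m)%N) + 2 * e)
      @ \oo --> 0 + 2 * e.
    apply: cvgD; last exact: cvg_cst.
    rewrite -[X in _ --> X](mulr0 2); apply: cvgMl_tmp.
    rewrite [X in _ --> X](_ : _ = \sum_(0 <= n < W) (0 : R)); last by rewrite big1.
    elim: (index_iota 0 W) => [|n r IH].
      by rewrite big_nil; under eq_cvg do rewrite big_nil; exact: cvg_cst.
    rewrite big_cons; under eq_cvg do rewrite big_cons.
    by apply: cvgD IH; have := ccvg_sqn (Xlim J0 n); rewrite sqn0.
  rewrite add0r in lim1; rewrite -(cvg_lim _ lim1)//; apply: limr_ge.
    by apply/cvg_ex; eexists; exact: lim1.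
  apply: nearW => m.
  pose y i := \sum_(J0 <= j < J0 + m) cj (psi j) * Sh (J0 + m - j) i.
  have yb : l2bd y e.
    move=> M; have := dotcvg_self_bound (@isometric_comb J0 (J0 + m) (fun j => cj (psi j)) (fun j => J0 + m - j)%N (@inj (J0 + m))).
    move=> /(_ M) /le_trans; apply; under eq_bigr do rewrite sqn_conj.
    exact: hN.
  apply: (@le_trans _ _ (\sum_(0 <= n < W) 2 * (sqn (X (J0 + m)%N (n + m)%N) + sqn (y (n + m)%N)))).
    apply: ler_sum => n _.
    have -> : X J0 n = X (J0 + m)%N (n + m)%N - y (n + m)%N.
      rewrite /X (big_cat_nat (leq0n _) (leq_addr m J0)) /= -/(y (n + m)%N) addrK.
      rewrite !big_nat; apply: eq_bigr => j /andP[_ jJ]; rewrite !iter_shiftE.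
      have -> : (J0 + m - j <= n + m)%N = (J0 - j <= n)%N by lia.
      by case: ifP => // _; congr (_ * phi _); lia.
    by apply: le_trans (sqnD_le _ _) _; rewrite sqnN.
  rewrite -mulr_sumr big_split /= mulrDr lerD// ler_pM2l//.
  apply: le_trans (yb (W + m)%N).
  rewrite (big_cat_nat (leq0n m) (leq_addl W m)) /=.
  have -> : \sum_(m <= i < W + m) sqn (y i) = \sum_(0 <= n < W) sqn (y (n + m)%N).
    by rewrite -{1}[m]add0n big_addn addnK.
  by rewrite lerDr sumr_ge0// => i _; exact: sqn_ge0.
move=> n; apply/eqP; rewrite -sqn_eq0 eq_le sqn_ge0 andbT.
apply/ler_addgt0Pl => e e0; rewrite addr0.
have [N hN] := key (e / 2) (divr_gt0 e0 (ltr0Sn _ 1)).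
have := hN (maxn N n.+1) (leq_maxl _ _); rewrite mulrC divfK// => h.
apply: le_trans h; rewrite (big_cat_nat (leq0n n.+1) (leq_maxr _ _)) /=.
rewrite big_nat_recr//= -addrA addrCA lerDl addr_ge0// sumr_ge0// => i _; exact: sqn_ge0.
Qed.

End Isometric.
End IsometricShifts.

(** * Fatou's theorem for sine series *)

Section TrigonometricMeans.
Variable R : realType.
Implicit Types (s t : R) (f F : R -> R).

Lemma is_derive1_continuous f (df : R -> R) :
  (forall t, is_derive t 1 f (df t)) -> continuous f.
Proof.
move=> h t; apply: differentiable_continuous; apply/derivable1_diffP.
exact: (@ex_derive _ _ _ _ _ _ _ (h t)).
Qed.

Lemma is_derive_scale (c t : R) : is_derive t 1 (fun t : R => c * t) c.
Proof. by apply: is_derive_eq (is_deriveZ c (is_derive_id t 1)) _; rewrite [_ *: _]mulr1. Qed.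

(* The mean over a period, read off from an antiderivative instead of an integral. *)
Definition has_mean f (v : R) := exists F, (forall t, is_derive t 1 F (f t)) /\
  forall t, F (t + pi *+ 2) = F t + pi *+ 2 * v.

Lemma has_mean_ext f h v : (forall t, f t = h t) -> has_mean f v -> has_mean h v.
Proof. by move=> /funext ->. Qed.

Lemma has_mean_cst (c : R) : has_mean (fun=> c) c.
Proof.
exists (fun t => c * t); split => t; last by ring.
exact: is_derive_scale.
Qed.

Lemma has_meanD f h u v : has_mean f u -> has_mean h v ->
  has_mean (fun t => f t + h t) (u + v).
Proof.
move=> [F [dF pF]] [G [dG pG]]; exists (fun t => F t + G t); split => t.
  have := dF t; have := dG t => ? ?; exact: is_deriveD.
by rewrite pF pG; ring.
Qed.

Lemma has_meanZ (k : R) f v : has_mean f v -> has_mean (fun t => k * f t) (k * v).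
Proof.
move=> [F [dF pF]]; exists (fun t => k * F t); split => t; last by rewrite pF; ring.
have := dF t => ?; exact: is_deriveZ.
Qed.

Lemma has_mean_sum (I : Type) (r : seq I) (f : I -> R -> R) (v : I -> R) :
  (forall i, has_mean (f i) (v i)) ->
  has_mean (fun t => \sum_(i <- r) f i t) (\sum_(i <- r) v i).
Proof.
move=> h; elim: r => [|i r IH].
  by rewrite big_nil; apply: has_mean_ext (has_mean_cst 0) => t; rewrite big_nil.
by rewrite big_cons; apply: has_mean_ext (has_meanD (h i) IH) => t; rewrite big_cons.
Qed.

Lemma periodic_sin_nat (n : nat) t : sin (n%:R * (t + pi *+ 2)) = sin (n%:R * t) :> R.
Proof.
by rewrite mulrDr [n%:R * (_ *+ _)]mulr_natl (periodicn (@sinD2pi R)).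
Qed.

Lemma periodic_cos_nat (n : nat) t : cos (n%:R * (t + pi *+ 2)) = cos (n%:R * t) :> R.
Proof.
by rewrite mulrDr [n%:R * (_ *+ _)]mulr_natl (periodicn (@cosD2pi R)).
Qed.

Lemma is_derive_sin_nat (n : nat) t :
  is_derive t 1 (fun t => sin (n%:R * t)) (n%:R * cos (n%:R * t)).
Proof.
have h : is_derive t 1 (fun t : R => n%:R * t) (n%:R : R) by exact: is_derive_scale.
rewrite mulrC.
exact: (@is_derive1_comp _ (@sin R) (fun t => n%:R * t) t _ _ (is_derive_sin _) h).
Qed.

Lemma is_derive_cos_nat (n : nat) t :
  is_derive t 1 (fun t => cos (n%:R * t)) (- (n%:R * sin (n%:R * t))).
Proof.
have h : is_derive t 1 (fun t : R => n%:R * t) (n%:R : R) by exact: is_derive_scale.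
rewrite mulrC -mulNr.
exact: (@is_derive1_comp _ (@cos R) (fun t => n%:R * t) t _ _ (is_derive_cos _) h).
Qed.

Lemma has_mean_cos (n : nat) : (0 < n)%N -> has_mean (fun t => cos (n%:R * t)) 0.
Proof.
move=> n0; have nn : n%:R != 0 :> R by rewrite pnatr_eq0 -lt0n.
exists (fun t => n%:R^-1 * sin (n%:R * t)); split => t.
  rewrite -[cos _](mulKf nn).
  have := is_derive_sin_nat n t => ?; exact: is_deriveZ.
by rewrite periodic_sin_nat mulr0 addr0.
Qed.

Lemma has_mean_sin (n : nat) : (0 < n)%N -> has_mean (fun t => sin (n%:R * t)) 0.
Proof.
move=> n0; have nn : n%:R != 0 :> R by rewrite pnatr_eq0 -lt0n.
exists (fun t => - n%:R^-1 * cos (n%:R * t)); split => t.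
  have -> : sin (n%:R * t) = - n%:R^-1 * - (n%:R * sin (n%:R * t)).
    by rewrite mulrNN mulKf.
  have := is_derive_cos_nat n t => ?; exact: is_deriveZ.
by rewrite periodic_cos_nat mulr0 addr0.
Qed.

Lemma has_mean_sin_sin (n m : nat) : (0 < n)%N ->
  has_mean (fun t => sin (n%:R * t) * sin (m%:R * t)) ((n == m)%:R / 2).
Proof.
wlog nm : n m / (m <= n)%N => [h n0|n0].
  have [mn|nm] := leqP m n; first exact: h.
  have := h m n (ltnW nm) (ltn_trans n0 nm); rewrite [m == n]eq_sym.
  by apply: has_mean_ext => t; exact: mulrC.
have e t : sin (n%:R * t) * sin (m%:R * t) =
    2^-1 * cos ((n - m)%:R * t) + - 2^-1 * cos ((n + m)%:R * t) :> R.
  by rewrite natrB// natrD mulrBl mulrDl cosB cosD; field.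
apply: (has_mean_ext (fun t => esym (e t))).
have h2 := has_meanZ (- 2^-1) (has_mean_cos (ltn_addr m n0)).
have h1 : has_mean (fun t => cos ((n - m)%:R * t)) (n == m)%:R.
  have [->|nm'] := eqVneq n m.
    by apply: has_mean_ext (has_mean_cst 1) => t; rewrite subnn mul0r cos0.
  by apply: has_mean_cos; rewrite subn_gt0 ltn_neqAle eq_sym nm' nm.
have := has_meanD (has_meanZ 2^-1 h1) h2.
by rewrite mulr0 addr0 mulrC.
Qed.

(** By the mean value theorem over one period, v is a value of f. *)
Lemma has_mean_ge f v (a : R) : has_mean f v ->
  (forall t, - pi <= t <= pi -> a <= f t) -> a <= v.
Proof.
move=> [F [dF pF]] fa; have p := @pi_gt0 R.
have pp : - pi < pi :> R by lra.
have [] := @MVT R F f (- pi) pi pp (fun t _ => dF t).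
  by apply: continuous_subspaceT; exact: is_derive1_continuous dF.
move=> x; rewrite in_itv /= => /andP[x1 x2].
have -> : F pi = F (- pi) + pi *+ 2 * v by rewrite -pF; congr F; rewrite mulr2n; ring.
have := fa x; rewrite (ltW x1) (ltW x2) => /(_ isT) h e.
have : pi *+ 2 * (f x - v) = 0 by move: e; rewrite mulr2n; lra.
have p2 : pi *+ 2 != 0 :> R by rewrite mulr2n gt_eqF// addr_gt0.
by move/eqP; rewrite mulf_eq0 (negPf p2) subr_eq0 => /eqP <-.
Qed.

(** The increment over a symmetric interval of 2 n periods, ready to be read as a Lebesgue
    integral. *)
Lemma has_mean_const f v n : has_mean f v -> exists F,
  (forall t, is_derive t 1 F (f t)) /\
  F (pi *+ 2 *+ n) - F (- (pi *+ 2 *+ n)) = pi *+ 2 *+ (n + n) * v.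
Proof.
move=> [F [dF pF]]; exists F; split => //.
have pk k t : F (t + pi *+ 2 *+ k) = F t + pi *+ 2 *+ k * v.
  elim: k => [|k IH]; first by rewrite !mulr0n mul0r !addr0.
  by rewrite mulrSr addrA pF IH; ring.
have e : pi *+ 2 *+ n = - (pi *+ 2 *+ n) + pi *+ 2 *+ (n + n) :> R.
  by rewrite mulrnDr addKr.
by rewrite [X in F X - _]e pk; ring.
Qed.

Lemma expiD s t : expi (s + t) = expi s * expi t.
Proof. by apply: complex_ext; rewrite ?ReM ?ImM /= ?cosD ?sinD; ring. Qed.

Lemma expi0 : expi 0 = 1 :> R[i].
Proof. by rewrite /expi cos0 sin0. Qed.

Lemma expiN t : expi (- t) = cj (expi t).
Proof. by rewrite /expi cosN sinN. Qed.

Lemma expi_nat n t : expi (n%:R * t) = expi t ^+ n.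
Proof.
elim: n => [|n IH]; first by rewrite mul0r expi0.
by rewrite mulrSr mulrDl mul1r expiD IH exprSr.
Qed.

Lemma sqn_expi t : sqn (expi t) = 1.
Proof. by rewrite /sqn /= cos2Dsin2. Qed.

Lemma cabs_expi t : cabs (expi t) = 1.
Proof. by rewrite /cabs sqn_expi sqrtr1. Qed.

Definition tpoly (c : nat -> R[i]) N t := \sum_(0 <= n < N) c n * expi (n%:R * t).

(** Parseval by induction on N: the cross terms of the new exponential with the earlier ones have
    positive frequencies N - n, hence mean 0. *)
Lemma has_mean_tpoly c N :
  has_mean (fun t => sqn (tpoly c N t)) (\sum_(0 <= n < N) sqn (c n)).
Proof.
elim: N => [|N IH].
  rewrite big_geq//; apply: has_mean_ext (has_mean_cst 0) => t.
  by rewrite /tpoly big_geq// sqn0.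
rewrite big_nat_recr//=.
pose d n := cj (c N) * c n.
pose cross n t := complex.Re (d n) * cos ((N - n)%:R * t) +
  complex.Im (d n) * sin ((N - n)%:R * t).
(* [has_mean_sum] asks for a mean at every index; the guard n < N keeps the frequency N - n
   positive. *)
have hcross : has_mean (fun t => \sum_(0 <= n < N) (if (n < N)%N then 2 * cross n t else 0)) 0.
  suff h n : has_mean (fun t => if (n < N)%N then 2 * cross n t else 0) 0.
    by have := has_mean_sum (index_iota 0 N) h; rewrite big1.
  case: (boolP (n < N)%N) => [nN|_]; last exact: has_mean_cst.
  have nN' : (0 < N - n)%N by rewrite subn_gt0.
  have h1 := has_meanZ (complex.Re (d n)) (has_mean_cos nN').
  have h2 := has_meanZ (complex.Im (d n)) (has_mean_sin nN').
  by have := has_meanZ 2 (has_meanD h1 h2); rewrite !mulr0 addr0 mulr0.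
have := has_meanD (has_meanD IH (has_mean_cst (sqn (c N)))) hcross.
rewrite addr0; apply: has_mean_ext => t.
rewrite {2}/tpoly big_nat_recr//= -/(tpoly c N t).
have sqnD z w : sqn (z + w) = sqn z + sqn w + 2 * complex.Re (cj w * z).
  by case: z w => a b [a' b']; rewrite /sqn /=; ring.
rewrite sqnD sqnM sqn_expi mulr1; congr (_ + _).
rewrite /tpoly mulr_sumr Re_sum mulr_sumr !big_nat; apply: eq_bigr => n /andP[_ nN].
rewrite nN; congr (_ * _).
rewrite rmorphM /= mulrACA -/(d n) /cross.
rewrite -expiN -expiD.
have -> : - (N%:R * t) + n%:R * t = - ((N - n)%:R * t) :> R.
  by rewrite natrB ?(ltnW nN)// mulrBl; ring.
case: (d n) => u v; rewrite /expi cosN sinN /=; ring.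
Qed.

End TrigonometricMeans.

(** * Positivity of sine series and of their Abel means *)

Section SineSeries.
Variable R : realType.

Definition sine_kernel (r : R) M (s : R) :=
  \sum_(0 <= m < M) m%:R * r ^+ m * sin (m%:R * s).

Lemma sum_nat_geo (z : R[i]) M : (0 < M)%N ->
  (1 - z) ^+ 2 * \sum_(0 <= m < M) m%:R * z ^+ m =
  z - (M%:R * z ^+ M - M.-1%:R * z ^+ M.+1).
Proof.
case: M => // M _; elim: M => [|M IH].
  by rewrite big_nat1 /= !mulr0n !mul0r mulr0 expr1 mul1r subr0 subrr.
rewrite big_nat_recr//= mulrDr IH /= !exprS.
have -> : M.+2%:R = M%:R + 2 :> R[i] by rewrite -addn2 natrD.
have -> : M.+1%:R = M%:R + 1 :> R[i] by rewrite -addn1 natrD.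
set y := z ^+ M; ring.
Qed.

(* The limit of sine_kernel is r (1 - r^2) sin s / |1 - r e^{is}|^4, minus the
   s-derivative of half the Poisson kernel. *)
Lemma sine_kernel_ge (r : R) M s : 0 <= r < 1 -> (0 < M)%N -> 0 <= s <= pi ->
  - (2 * (M%:R * r ^+ M) / (1 - r) ^+ 2) <= sine_kernel r M s.
Proof.
move=> /andP[r0 r1] M0 s0pi.
pose z := r%:C * expi s.
have zX m : z ^+ m = (r ^+ m)%:C * expi (m%:R * s).
  by rewrite /z exprMn expi_nat rmorphXn.
pose T := \sum_(0 <= m < M) m%:R * z ^+ m.
have Im_real (x : R) w : complex.Im (x%:C * w) = x * complex.Im w.
  by rewrite ImM /=; ring.
have KT : sine_kernel r M s = complex.Im T.
  rewrite /T Im_sum; apply: eq_bigr => m _.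
  by rewrite zX mulrA -(rmorph_nat (real_complex R)) -rmorphM Im_real.
pose E : R[i] := M%:R * z ^+ M - M.-1%:R * z ^+ M.+1.
have eT : (1 - z) ^+ 2 * T = z - E by exact: sum_nat_geo.
have sz : sqn z = r ^+ 2 by rewrite sqnM sqn_real sqn_expi mulr1.
pose D := sqn (1 - z).
have D1 : (1 - r) ^+ 2 <= D.
  have := cos_le1 s; rewrite /D /sqn /z /=.
  have := cos2Dsin2 s; set cs := cos s; set sn := sin s => h1 h2.
  rewrite !mul0r !subr0 !addr0.
  have -> : (1 - r * cs) ^+ 2 + (0 - r * sn) ^+ 2 = 1 - 2 * r * cs + r ^+ 2 * (cs ^+ 2 + sn ^+ 2) by ring.
  rewrite h1 mulr1 sqrrB; nra.
have D0 : 0 < D by apply: lt_le_trans D1; rewrite exprn_gt0// subr_gt0.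
(* Multiplying (1 - z)^2 T = z - E by conj(1 - z)^2 isolates Im T. The main term has imaginary part
   (1 - |z|^2) Im z, which is nonnegative on [0, pi]; E is the truncation error. *)
have e2 : D ^+ 2 * complex.Im T = complex.Im (z * cj (1 - z) ^+ 2) - complex.Im (E * cj (1 - z) ^+ 2).
  have -> : D ^+ 2 * complex.Im T = complex.Im ((D ^+ 2)%:C * T) by rewrite Im_real.
  by rewrite -ImB -mulrBl -eT rmorphXn /= -mulC_conj exprMn mulrAC.
have e3 : complex.Im (z * cj (1 - z) ^+ 2) = (1 - sqn z) * complex.Im z.
  by case: z {zX T KT E eT sz D D1 D0 e2} => x y; rewrite /sqn /=; ring.
have zpos : 0 <= complex.Im z.
  by rewrite Im_real /= mulr_ge0// sin_ge0_pi.
have e4 : 0 <= complex.Im (z * cj (1 - z) ^+ 2).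
  rewrite e3 mulr_ge0// sz subr_ge0; rewrite -(expr1n _ 2).
  by rewrite ler_sqr ?nnegrE ?(ltW r1).
have cE : cabs E <= 2 * (M%:R * r ^+ M).
  apply: le_trans (cabsD_le _ _) _; rewrite cabsN !cabsM !cabsX.
  have cz : cabs z = r by rewrite /cabs sz sqrtr_sqr ger0_norm.
  have cn (n : nat) : cabs (n%:R : R[i]) = n%:R.
    by rewrite -(rmorph_nat (real_complex R)) /cabs sqn_real sqrtr_sqr ger0_norm.
  rewrite cz !cn mulrDl mul1r lerD//; apply: ler_pM; rewrite ?exprn_ge0//.
    by rewrite ler_nat leq_pred.
  by rewrite ler_wiXn2l ?(ltW r1).
have e5 : complex.Im (E * cj (1 - z) ^+ 2) <= 2 * (M%:R * r ^+ M) * D.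
  apply: le_trans (ler_norm _) _; apply: le_trans (Im_le_cabs _) _.
  rewrite cabsM cabsX cabs_conj sqr_cabs -/D.
  by rewrite ler_wpM2r// ltW.
rewrite KT lerNl.
have e6 : D * (- complex.Im T) <= 2 * (M%:R * r ^+ M).
  rewrite -(ler_pM2r D0); nra.
have q0 : 0 < (1 - r) ^+ 2 by rewrite exprn_gt0// subr_gt0.
rewrite ler_pdivlMr//.
have M1 : 0 <= 2 * (M%:R * r ^+ M) by rewrite mulr_ge0// mulr_ge0// exprn_ge0.
have [T0|T0] := leP 0 (- complex.Im T).
  by apply: le_trans e6; rewrite mulrC ler_wpM2r.
by apply: le_trans M1; rewrite pmulr_lle0// ltW.
Qed.

Lemma sine_kernel_le (r : R) M s : 0 <= r ->
  `|sine_kernel r M s| <= \sum_(0 <= m < M) m%:R * r ^+ m.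
Proof.
move=> r0; apply: le_trans (ler_norm_sum _ _ _) _; apply: ler_sum => m _.
rewrite normrM ger0_norm; last by rewrite mulr_ge0// exprn_ge0.
by rewrite ler_piMr ?sin_max// mulr_ge0// exprn_ge0.
Qed.

Section SinePositivity.
Variables (b : nat -> R) (B : R) (w : R -> R).
Hypothesis bB : forall N, \sum_(0 <= n < N) `|b n| <= B.
Hypothesis bw : forall s, 0 <= s <= pi ->
  series (fun n => b n * sin (n%:R * s)) @ \oo --> w s.

(** By orthogonality of the sines, L / 2 is the limit of the means of w_N times the sine kernel.
    Both factors are odd and almost nonnegative on [0, pi], so the even product is almost
    nonnegative on the whole period. *)
Lemma sine_positivity (r L : R) : 0 <= r < 1 ->
  series (fun n => n%:R * b n * r ^+ n) @ \oo --> L ->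
  (forall s, 0 <= s <= pi -> 0 <= w s) -> 0 <= L.
Proof.
move=> r01 hL w0; have /andP[r0 r1] := r01.
have [C hC] := natmul_geo_sum_le r01.
have C0 : 0 <= C by have := hC 0%N; rewrite big_geq.
have B0 : 0 <= B by have := bB 0%N; rewrite big_geq.
pose wN N s := \sum_(0 <= n < N) b n * sin (n%:R * s).
have wNB N s : `|wN N s| <= B.
  apply: le_trans (ler_norm_sum _ _ _) _; apply: le_trans (bB N).
  by apply: ler_sum => n _; rewrite normrM ler_piMr ?sin_max.
have wNodd N s : wN N (- s) = - wN N s.
  by rewrite /wN -sumrN; apply: eq_bigr => n _; rewrite mulrN sinN mulrN.
have Kodd M s : sine_kernel r M (- s) = - sine_kernel r M s.
  by rewrite /sine_kernel -sumrN; apply: eq_bigr => n _; rewrite mulrN sinN mulrN.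
(* N <= M ensures that each diagonal term m = n occurs in the kernel. *)
have mean N M : (N <= M)%N -> has_mean (fun s => wN N s * sine_kernel r M s)
    ((\sum_(0 <= n < N) n%:R * b n * r ^+ n) / 2).
  move=> NM.
  have h n : has_mean (fun s => if (n < N)%N then
      \sum_(0 <= m < M) (b n * (m%:R * r ^+ m)) * (sin (m%:R * s) * sin (n%:R * s)) else 0)
      (if (n < N)%N then n%:R * b n * r ^+ n / 2 else 0).
    case: ifP => nN; last exact: has_mean_cst.
    have -> : n%:R * b n * r ^+ n / 2 =
        \sum_(0 <= m < M) (b n * (m%:R * r ^+ m)) * ((m == n)%:R / 2).
      rewrite (bigD1_seq n) ?iota_uniq ?mem_index_iota ?(leq_trans nN)//=.
      rewrite eqxx big1 ?addr0 => [|m /negPf ->]; last by rewrite mul0r mulr0.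
      by rewrite /=; field.
    apply: has_mean_sum => -[|m].
      apply: has_mean_ext (has_mean_cst _) => s.
      by rewrite !mul0r !mulr0 !mul0r.
    by apply: has_meanZ; exact: has_mean_sin_sin.
  have := has_mean_sum (index_iota 0 N) h.
  have -> : \sum_(0 <= i < N) (if (i < N)%N then i%:R * b i * r ^+ i / 2 else 0) =
     (\sum_(0 <= n < N) n%:R * b n * r ^+ n) / 2.
    rewrite mulr_suml !big_nat; apply: eq_bigr => i /andP[_ ->]; by [].
  apply: has_mean_ext => s; rewrite /wN mulr_suml !big_nat; apply: eq_bigr => n /andP[_ nN].
  rewrite nN /sine_kernel mulr_sumr; apply: eq_bigr => m _; ring.
have step e : 0 < e -> exists N0, forall N, (N0 <= N)%N ->
    - (2 * e * C) <= \sum_(0 <= n < N) n%:R * b n * r ^+ n.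
  move=> e0; have [N0 hN0] := nneg_series_tail (fun n => normr_ge0 (b n)) bB e0.
  exists N0 => N NN.
  have wNe s : 0 <= s <= pi -> - e <= wN N s.
    move=> hs; have hw := bw hs.
    have : w s - wN N s <= e.
      have hh : (fun M => series (fun n => b n * sin (n%:R * s)) M - wN N s) @ \oo -->
          w s - wN N s by apply: cvgB hw _; exact: cvg_cst.
      rewrite -(cvg_lim _ hh)//; apply: limr_le; first by apply/cvg_ex; eexists; exact: hh.
      exists N => // M /= NM; rewrite /wN /series /= sum_nat_eq//.
      apply: le_trans (ler_norm _) _; apply: le_trans (ler_norm_sum _ _ _) _.
      apply: le_trans (hN0 N M NN); apply: ler_sum => n _.
      by rewrite normrM ler_piMr ?sin_max.
    have := w0 s hs; lra.
  pose k M := 2 * (M%:R * r ^+ M) / (1 - r) ^+ 2.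
  have lower M : (0 < M)%N -> (N <= M)%N ->
      - (2 * (e * C + k M * B + e * k M)) <= \sum_(0 <= n < N) n%:R * b n * r ^+ n.
    move=> M0 NM; set S := \sum_(0 <= n < N) _.
    suff : - (e * C + k M * B + e * k M) <= S / 2 by rewrite ler_pdivlMr//; lra.
    apply: (has_mean_ge (mean N M NM)) => s /andP[s1 s2].
    have k0 : 0 <= k M.
      by rewrite divr_ge0 ?sqr_ge0// !mulr_ge0// exprn_ge0.
    wlog s0 : s s1 s2 / 0 <= s => [h|].
      have [s0|/ltW s0] := leP 0 s; first exact: h.
      have := h (- s); rewrite wNodd Kodd mulrNN; apply; rewrite ?oppr_ge0//; lra.
    have hs : 0 <= s <= pi by rewrite s0.
    have := wNe s hs; have := sine_kernel_ge r01 M0 hs; rewrite -/(k M).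
    have := le_trans (sine_kernel_le M s r0) (hC M).
    have := wNB N s; rewrite !ler_norml.
    move: (wN N s) (sine_kernel r M s) (k M) k0 => x y q q0.
    move=> /andP[_ xB] /andP[_ yC] hy hx.
    (* Both factors are nonnegative, so x y >= - e y - q x - e q, where y <= C and x <= B. *)
    have p : 0 <= (x + e) * (y + q) by rewrite mulr_ge0//; lra.
    have p1 : e * y <= e * C by rewrite ler_wpM2l// ltW.
    have p2 : q * x <= q * B by rewrite ler_wpM2l.
    nra.
  have klim : (fun M => - (2 * (e * C + k M * B + e * k M))) @ \oo --> - (2 * (e * C + 0 * B + e * 0)).
    have k0 : k @ \oo --> (0 : R).
      rewrite /k -(mul0r ((1 - r) ^+ 2)^-1); apply: cvgMr_tmp.
      by rewrite -[X in _ --> X](mulr0 2); apply: cvgMl_tmp; exact: cvg_natmul_geometric.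
    apply: cvgN; apply: cvgMl_tmp; apply: cvgD; last exact: cvgMl_tmp.
    by apply: cvgD; [exact: cvg_cst|exact: cvgMr_tmp].
  rewrite mul0r mulr0 !addr0 mulrA in klim.
  rewrite -(cvg_lim _ klim)//; apply: limr_le; first by apply/cvg_ex; eexists; exact: klim.
  exists N.+1 => // M /= NM; apply: lower; last exact: ltnW.
  exact: leq_ltn_trans NM.
apply/ler_addgt0Pr => e e0.
have e1 : 0 < e / (2 * (C + 1)) by rewrite divr_gt0// mulr_gt0// ltr_wpDl.
have [N0 hN0] := step _ e1.
have : - e <= L.
  rewrite -(cvg_lim _ hL)//; apply: limr_ge; first by apply/cvg_ex; eexists; exact: hL.
  exists N0 => // N /= NN; apply: le_trans (hN0 N NN).
  rewrite lerN2.
  have -> : 2 * (e / (2 * (C + 1))) * C = e * (C / (C + 1)).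
    by field; rewrite gt_eqF// ltr_wpDl.
  by rewrite ler_piMr ?(ltW e0)// ler_pdivrMr ?ltr_wpDl// mul1r lerDl.
lra.
Qed.

End SinePositivity.
End SineSeries.

(** * Comparison of a sine series with sin s and sin 2s *)

Section FatouSine.
Variable R : realType.
Implicit Types (s x : R).

Lemma sin_ge_mul_cos x : 0 <= x <= pi -> x * cos x <= sin x.
Proof.
move=> /andP[x0 xp].
have [] := @MVT_segment R sin cos 0 x x0 (fun t _ => is_derive_sin t).
  by apply: continuous_subspaceT; exact: continuous_sin.
move=> y; rewrite in_itv /= sin0 !subr0 => /andP[y0 yx] ->.
rewrite mulrC ler_wpM2r//; have [->//|xy] := eqVneq x y.
apply/ltW; rewrite ltr_cos ?in_itv /= ?y0 ?x0 ?xp ?(le_trans yx xp)//.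
by rewrite lt_neqAle eq_sym xy.
Qed.

Lemma sin_le_id x : 0 <= x -> sin x <= x.
Proof.
move=> x0.
have [] := @MVT_segment R sin cos 0 x x0 (fun t _ => is_derive_sin t).
  by apply: continuous_subspaceT; exact: continuous_sin.
by move=> y _; rewrite sin0 !subr0 => ->; rewrite ler_piMl// cos_le1.
Qed.

(** With y = x / 2, sin x = 2 sin y cos y >= 2 y cos^2 y. Unlike x cos x, this lower bound stays
    nonnegative up to pi. *)
Lemma sin_ge_jordan x : 0 <= x <= pi -> x * (1 + cos x) / 2 <= sin x.
Proof.
move=> /andP[x0 xp]; pose y := x / 2.
have y0 : 0 <= y by rewrite divr_ge0.
have yp : y <= pi / 2 by rewrite ler_pM2r.
have p := @pi_gt0 R.
have xE : x = y *+ 2 by rewrite mulr2n /y; field.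
have cy : 0 <= cos y by apply: cos_ge0_pihalf; rewrite yp andbT; lra.
have h : y * cos y <= sin y by apply: sin_ge_mul_cos; rewrite y0; lra.
rewrite xE cos_mulr2n sin_mulr2n !mulr2n.
rewrite (_ : _ / 2 = cos y * (y * cos y) + cos y * (y * cos y)); last by field.
by rewrite lerD// ler_wpM2l.
Qed.

Variables (b : nat -> R) (B : R) (w : R -> R).
Hypothesis bB : forall N, \sum_(0 <= n < N) `|b n| <= B.
Hypothesis bw : forall s, 0 <= s <= pi ->
  series (fun n => b n * sin (n%:R * s)) @ \oo --> w s.

Lemma series_finite_support (u : nat -> R) m : (forall n, (m <= n)%N -> u n = 0) ->
  series u @ \oo --> series u m.
Proof.
move=> um; apply: cvg_near_cst; exists m => // N /= mN.
apply/eqP; rewrite -subr_eq0 /series /= sum_nat_eq// big_nat big1//.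
by move=> i /andP[mi _]; exact: um.
Qed.

(** Adding multiples of sin s and sin 2s changes only the coefficients 1 and 2. These two test
    functions suffice to express sin s (1 - cos s). *)
Lemma sine_positivity_comb (a1 a2 a3 r L : R) : 0 <= r < 1 ->
  series (fun n => n%:R * b n * r ^+ n) @ \oo --> L ->
  (forall s, 0 <= s <= pi -> 0 <= a1 * sin s + a2 * sin (2 * s) + a3 * w s) ->
  0 <= a1 * r + 2 * a2 * r ^+ 2 + a3 * L.
Proof.
move=> r01 hL pos.
pose d n := if n == 1%N then a1 else if n == 2%N then a2 else 0.
have d0 n : (3 <= n)%N -> d n = 0 by case: n => [|[|[|n]]].
pose b' n := d n + a3 * b n.
have serd (h : nat -> R) : series (fun n => d n * h n) @ \oo --> a1 * h 1%N + a2 * h 2%N.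
  have hs n : (3 <= n)%N -> d n * h n = 0 by move=> hn; rewrite d0// mul0r.
  have := series_finite_support hs.
  have -> : series (fun n => d n * h n) 3 = a1 * h 1%N + a2 * h 2%N.
    by rewrite /series /= !big_nat_recr//= big_geq// /d /= mul0r !add0r.
  by [].
have serb' (h : nat -> R) l : series (fun n => b n * h n) @ \oo --> l ->
    series (fun n => b' n * h n) @ \oo --> a1 * h 1%N + a2 * h 2%N + a3 * l.
  move=> hl.
  have -> : series (fun n => b' n * h n) =
     (fun N => series (fun n => d n * h n) N + a3 * series (fun n => b n * h n) N).
    apply/funext => N; rewrite /series /= mulr_sumr -big_split /=.
    by apply: eq_bigr => n _; rewrite /b' mulrDl mulrA.
  by apply: cvgD; [exact: serd|exact: cvgMl_tmp].
have b'B N : \sum_(0 <= n < N) `|b' n| <= \sum_(0 <= n < 3) `|d n| + `|a3| * B.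
  apply: (@le_trans _ _ (\sum_(0 <= n < N) (`|d n| + `|a3| * `|b n|))).
    by apply: ler_sum => n _; apply: le_trans (ler_normD _ _) _; rewrite normrM.
  rewrite big_split /= -mulr_sumr lerD// ?ler_wpM2l//.
  have [N3|/ltnW N3] := leqP N 3.
    by rewrite (big_cat_nat (leq0n N) N3) /= lerDl sumr_ge0.
  rewrite (big_cat_nat (leq0n 3) N3) /= gerDl big_nat big1// => n /andP[n3 _].
  by rewrite d0// normr0.
have bw' s : 0 <= s <= pi -> series (fun n => b' n * sin (n%:R * s)) @ \oo -->
    a1 * sin s + a2 * sin (2 * s) + a3 * w s.
  by move=> hs; have := serb' _ _ (bw hs); rewrite mul1r.
have hL' : series (fun n => n%:R * b' n * r ^+ n) @ \oo --> a1 * r + 2 * a2 * r ^+ 2 + a3 * L.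
  have e (u : nat -> R) : (fun n => n%:R * u n * r ^+ n) = (fun n => u n * (n%:R * r ^+ n)).
    by apply/funext => n; rewrite -mulrA mulrCA.
  rewrite e; move: hL; rewrite e => /serb'; rewrite mul1r expr1.
  suff -> : a1 * r + a2 * (2 * r ^+ 2) = a1 * r + 2 * a2 * r ^+ 2 by [].
  by ring.
exact: sine_positivity b'B bw' _ _ r01 hL' pos.
Qed.

Variable c C : R.
(** [w0] says that w has right derivative c at 0; [wpi] makes w vanish linearly at pi, as sin does,
    so that w / sin stays bounded there. *)
Hypothesis w0 : forall e, 0 < e -> exists2 d, 0 < d &
  forall s, 0 <= s < d -> `|w s - c * s| <= e * s.
Hypothesis wpi : forall s, 0 <= s <= pi -> `|w s| <= C * (pi - s).

Lemma sine_majorant e : 0 < e -> exists2 K, 0 <= K & forall s, 0 <= s <= pi ->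
  `|w s - c * sin s| <= e * sin s + K * (sin s * (1 - cos s)).
Proof.
move=> e0; have [d d0 hd] := w0 (divr_gt0 e0 (ltr0Sn R 1)).
have p := @pi_gt0 R.
(* Below m the estimate [w0] applies and cos s >= 0; above m the factor 1 - cos s is at least k >
   0. *)
pose m := Num.min (d / 2) (pi / 2).
have m0 : 0 < m by rewrite lt_min !divr_gt0.
have md : m < d by rewrite gt_min; apply/orP; left; lra.
have mp : m <= pi / 2 by rewrite ge_min lexx orbT.
pose k := 1 - cos m.
have k0 : 0 < k.
  by rewrite /k subr_gt0 -(cos0 R) ltr_cos ?in_itv /= ?lexx ?(ltW m0) ?(ltW p)//; lra.
have C0 : 0 <= C.
  have := wpi (s := 0); rewrite lexx (ltW p) subr0 => /(_ isT) h.
  by rewrite -(pmulr_lge0 _ p) (le_trans _ h).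
(* The terms absorb, in order, |c| (s - sin s) below m, then |w s| and |c| sin s above m. *)
exists (`|c| + 2 * C / k ^+ 2 + `|c| / k).
  by rewrite !addr_ge0// !divr_ge0// ?mulr_ge0// ?sqr_ge0// ltW.
move=> s /andP[s0 sp].
have ss0 : 0 <= sin s by rewrite sin_ge0_pi// s0.
have c1 : 0 <= 1 - cos s by rewrite subr_ge0 cos_le1.
have sc0 : 0 <= sin s * (1 - cos s) by rewrite mulr_ge0.
have cn0 := normr_ge0 c.
have [sm|ms] := ltP s m.
  have hsd : 0 <= s < d by rewrite s0 (lt_trans sm md).
  have cs0 : 0 <= cos s by apply: cos_ge0_pihalf; apply/andP; split; lra.
  have j : s * (1 + cos s) / 2 <= sin s by apply: sin_ge_jordan; rewrite s0.
  have j1 : s <= 2 * sin s by nra.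
  have j2 : s - sin s <= sin s * (1 - cos s) by nra.
  have -> : w s - c * sin s = (w s - c * s) + c * (s - sin s) by ring.
  apply: le_trans (ler_normD _ _) _; rewrite normrM.
  have := hd s hsd; have h1 := sin_le_id s0; rewrite [`|s - _|]ger0_norm; last by rewrite subr_ge0.
  move=> h2.
  have h3 : `|c| * (s - sin s) <= `|c| * (sin s * (1 - cos s)) by rewrite ler_wpM2l.
  have h4 : 0 <= (2 * C / k ^+ 2 + `|c| / k) * (sin s * (1 - cos s)).
    by rewrite mulr_ge0// addr_ge0// divr_ge0// ?mulr_ge0// ?sqr_ge0// ltW.
  have h5 : e / 2 * s <= e * sin s by nra.
  nra.
have ck : k <= 1 - cos s.
  rewrite /k lerD2l lerN2; have [->//|sm] := eqVneq m s.
  by apply/ltW; rewrite ltr_cos ?in_itv /= ?s0 ?sp ?(ltW m0) ?lt_neqAle ?sm//=; lra.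
have j : (pi - s) * k / 2 <= sin s.
  have := @sin_ge_jordan (pi - s); rewrite subr_ge0 sp lerBlDr lerDl s0 => /(_ isT).
  rewrite sinB cosB sinpi cospi !mul0r sub0r addr0 !mulN1r opprK.
  by apply: le_trans; rewrite ler_pM2r// ler_wpM2l// subr_ge0.
have j2 : pi - s <= 2 / k ^+ 2 * (sin s * (1 - cos s)).
  have h1 : pi - s <= 2 / k * sin s.
    have -> : pi - s = 2 / k * ((pi - s) * k / 2) by field; rewrite gt_eqF.
    by rewrite ler_wpM2l// divr_ge0// ltW.
  apply: le_trans h1 _.
  have -> : 2 / k ^+ 2 * (sin s * (1 - cos s)) = 2 / k * (sin s * ((1 - cos s) / k)).
    by field; rewrite gt_eqF.
  rewrite ler_wpM2l ?divr_ge0 ?(ltW k0)// ler_peMr//.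
  by rewrite ler_pdivlMr// mul1r.
have j3 : sin s <= k^-1 * (sin s * (1 - cos s)).
  have -> : k^-1 * (sin s * (1 - cos s)) = sin s * ((1 - cos s) / k) by ring.
  by rewrite ler_peMr// ler_pdivlMr// mul1r.
apply: le_trans (ler_normB _ _) _; rewrite normrM [`|sin s|]ger0_norm//.
have h := wpi (s := s); rewrite s0 sp in h; have {}h := h isT.
have h1 : C * (pi - s) <= 2 * C / k ^+ 2 * (sin s * (1 - cos s)).
  have -> : 2 * C / k ^+ 2 * (sin s * (1 - cos s)) = C * (2 / k ^+ 2 * (sin s * (1 - cos s))) by ring.
  by rewrite ler_wpM2l.
have h2 : `|c| * sin s <= `|c| / k * (sin s * (1 - cos s)).
  by rewrite -mulrA ler_wpM2l.
have h3 : 0 <= e * sin s by rewrite mulr_ge0// ltW.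
have h4 : 0 <= `|c| * (sin s * (1 - cos s)) by rewrite mulr_ge0.
rewrite !mulrDl; lra.
Qed.

(* Fatou's theorem for a sine series: testing sine_positivity on the majorant,
   |L(r) - c r| <= e r + K r (1 - r), as in Korovkin's theorem. *)
Lemma fatou_sine e : 0 < e -> exists2 d, 0 < d & forall r L,
  0 <= r -> 1 - d < r < 1 ->
  series (fun n => n%:R * b n * r ^+ n) @ \oo --> L -> `|L - c| <= e.
Proof.
move=> e0; have e2 : 0 < e / 2 by rewrite divr_gt0.
have [K K0 hK] := sine_majorant e2.
have q : 0 < K + `|c| + 1 by rewrite ltr_wpDl// addr_ge0.
exists (e / 2 / (K + `|c| + 1)); first by rewrite divr_gt0.
move=> r L r0 /andP[dr r1] hL; have r01 : 0 <= r < 1 by rewrite r0.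
have sin2 s : sin (2 * s) = 2 * (cos s * sin s).
  by rewrite mulr_natl sin_mulr2n -mulr_natl.
(* The coefficient - K / 2 comes from sin s (1 - cos s) = sin s - sin(2 s) / 2. *)
have h1 : 0 <= (e / 2 + K + c) * r + 2 * (- (K / 2)) * r ^+ 2 + -1 * L.
  apply: sine_positivity_comb r01 hL _ => s hs; rewrite sin2.
  have := hK s hs; rewrite ler_norml => /andP[_ h]; nra.
have h2 : 0 <= (e / 2 + K - c) * r + 2 * (- (K / 2)) * r ^+ 2 + 1 * L.
  apply: sine_positivity_comb r01 hL _ => s hs; rewrite sin2.
  have := hK s hs; rewrite ler_norml => /andP[h _]; nra.
have h3 : `|L - c * r| <= e / 2 * r + K * r * (1 - r).
  by rewrite ler_norml; apply/andP; split; lra.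
have -> : L - c = (L - c * r) - c * (1 - r) by ring.
apply: le_trans (ler_normB _ _) _; rewrite normrM [`|1 - r|]ger0_norm; last by lra.
have h4 : (K + `|c| + 1) * (1 - r) <= e / 2.
  by rewrite mulrC -ler_pdivlMr//; lra.
have h5 : K * r * (1 - r) <= K * (1 - r).
  by rewrite -mulrA ler_wpM2l// ler_piMl//; lra.
have h6 : e / 2 * r <= e / 2 by rewrite ler_piMr// ltW.
have h7 : 0 <= 1 - r by lra.
nra.
Qed.

End FatouSine.

(** * Boundary values almost everywhere *)

Section AlmostEverywhere.
Variable R : realType.
Notation mu := (@lebesgue_measure R).

Lemma integral_antiderivative (f F : R -> R) (a b : R) : a < b -> continuous f ->
  (forall t : R, is_derive t 1 F (f t)) ->
  (\int[mu]_(x in `[a, b]) (f x)%:E = (F b - F a)%:E)%E.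
Proof.
move=> ab cf dF.
have dF' t : derivable F t 1 by exact: (@ex_derive _ _ _ _ _ _ _ (dF t)).
have cF := is_derive1_continuous dF.
rewrite EFinB; apply: continuous_FTC2 => //.
- exact: continuous_subspaceT.
- split => //; [exact: (cvg_at_right_filter (cF a))|exact: (cvg_at_left_filter (cF b))].
- by move=> t _; rewrite derive1E; exact: (@derive_val _ _ _ _ _ _ _ (dF t)).
Qed.

Lemma ae_all_nat (P : nat -> R -> Prop) :
  (forall n, {ae mu, forall t, P n t}) -> {ae mu, forall t, forall n, P n t}.
Proof.
move=> h; rewrite /almost_everywhere.
have := @negligible_bigcup _ _ _ mu (fun n => ~` [set t | P n t]) h.
apply: negligibleS => t /= /existsNP[n hn].
by exists n.
Qed.

(** Monotone convergence: summable means make the sum of the f k integrable over every interval of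
    whole periods, hence finite almost everywhere. *)
Lemma ae_bounded_series (f : nat -> R -> R) (v : nat -> R) (C : R) :
  (forall k t, 0 <= f k t) -> (forall k, continuous (f k)) ->
  (forall k, has_mean (f k) (v k)) -> (forall N, \sum_(0 <= k < N) v k <= C) ->
  {ae mu, forall t, exists B, forall N, \sum_(0 <= k < N) f k t <= B}.
Proof.
move=> f0 fc fv vC.
pose a n : R := pi *+ 2 *+ n.+1.
have a0 n : - a n < a n.
  by rewrite gtrN// /a pmulrn_lgt0// pmulrn_lgt0// pi_gt0.
pose S t := (\sum_(0 <= k <oo) (f k t)%:E)%E.
have mf k (D : set R) : measurable_fun D (fun x : R => (f k x)%:E).
  by apply/measurable_EFinP; apply: measurable_funTS; exact: continuous_measurable_fun.
have S0 t : (0 <= S t)%E by apply: nneseries_ge0 => k _ _; rewrite lee_fin.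
have intS n : mu.-integrable `[- a n, a n] S.
  apply/integrableP; split.
    apply: (@ge0_emeasurable_sum _ _ _ _ (fun k t => (f k t)%:E) xpredT) => [k t _ _|k _].
      by rewrite lee_fin.
    exact: mf.
  under eq_integral => t _ do rewrite gee0_abs//.
  rewrite integral_nneseries//=; last 2 first.
  - by move=> k; exact: mf.
  - by move=> k t _; rewrite lee_fin.
  have e k : (\int[mu]_(t in `[(- a n)%R, a n]) (f k t)%:E)%E = (pi *+ 2 *+ (n.+1 + n.+1) * v k)%:E.
    have [F [dF <-]] := has_mean_const n.+1 (fv k).
    exact: integral_antiderivative.
  under eq_eseriesr => k _ do rewrite e.
  apply: (@le_lt_trans _ _ (pi *+ 2 *+ (n.+1 + n.+1) * C)%:E); last exact: ltry.
  apply: lime_le.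
    apply: is_cvg_nneseries => k _ _; rewrite -e; apply: integral_ge0 => t _.
    by rewrite lee_fin.
  apply: nearW => N; rewrite sumEFin lee_fin -mulr_sumr ler_wpM2l//.
  by rewrite mulrn_wge0// mulrn_wge0// pi_ge0.
have h n : {ae mu, forall t, `[- a n, a n]%classic t -> exists B, forall N, \sum_(0 <= k < N) f k t <= B}.
  have hS : {ae mu, forall t, `[- a n, a n]%classic t -> S t \is a fin_num}.
    by apply: integrable_ae (intS n); exact: measurable_itv.
  move: hS.
  apply: filterS; first exact: (ae_filter_ringOfSetsType mu).
  move=> t ht Dt; exists (fine (S t)) => N; rewrite -lee_fin fineK ?ht//.
  rewrite -sumEFin; apply: nneseries_lim_ge => k _ _; by rewrite lee_fin.
have := ae_all_nat h; apply: filterS; first exact: (ae_filter_ringOfSetsType mu).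
move=> t ht; apply: (ht (Num.truncn `|t|)) => /=.
rewrite in_itv /= -ler_norml.
have : `|t| < (Num.truncn `|t|).+1%:R by rewrite truncnS_gt.
set m := (Num.truncn _).+1 => /ltW/le_trans; apply.
rewrite /a -/m -[leRHS]mulr_natr ler_peMl//.
have := @pi_ge2 R; rewrite mulr2n; lra.
Qed.

Lemma is_derive1_bigsum (I : Type) (r : seq I) (F : I -> R -> R) (f : I -> R) (t : R) :
  (forall i, is_derive t 1 (F i) (f i)) ->
  is_derive t 1 (fun t => \sum_(i <- r) F i t) (\sum_(i <- r) f i).
Proof.
move=> h; elim: r => [|i r IH].
  rewrite big_nil; have -> : (fun t => \sum_(i <- [::]) F i t) = cst 0.
    by apply/funext => x; rewrite big_nil.
  exact: is_derive_cst.
rewrite big_cons; have -> : (fun t => \sum_(i <- i :: r) F i t) =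
    F i + (fun t => \sum_(i <- r) F i t).
  by apply/funext => x; rewrite big_cons.
have := h i => ?; exact: is_deriveD.
Qed.

Lemma Re_tpoly (c : nat -> R[i]) N t : complex.Re (tpoly c N t) =
  \sum_(0 <= n < N) (complex.Re (c n) * cos (n%:R * t) + - complex.Im (c n) * sin (n%:R * t)).
Proof. by rewrite Re_sum; apply: eq_bigr => n _; rewrite ReM /=; ring. Qed.

Lemma continuous_Re_tpoly (c : nat -> R[i]) N :
  continuous (fun t => complex.Re (tpoly c N t)).
Proof.
rewrite (_ : (fun t => _) = fun t => \sum_(0 <= n < N)
  (complex.Re (c n) * cos (n%:R * t) + - complex.Im (c n) * sin (n%:R * t))); last first.
  by apply/funext => t; exact: Re_tpoly.
pose df n t := complex.Re (c n) * - (n%:R * sin (n%:R * t)) + - complex.Im (c n) * (n%:R * cos (n%:R * t)).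
apply: (@is_derive1_continuous _ _ (fun t => \sum_(0 <= n < N) df n t)) => t.
apply: (@is_derive1_bigsum _ _ _ (fun n => df n t)) => n.
have := is_derive_sin_nat n t => h1; have := is_derive_cos_nat n t => h2.
have h3 := is_deriveZ (complex.Re (c n)) h2.
have h4 := is_deriveZ (- complex.Im (c n)) h1.
exact: is_deriveD h3 h4.
Qed.

(* The primitive of Re (c_n e^{int}); for n = 0 the quotient by n is 0. *)
Definition tprim (c : nat -> R[i]) N t := complex.Re (c 0%N) * t +
  \sum_(0 <= n < N) n%:R^-1 * (complex.Re (c n) * sin (n%:R * t) + complex.Im (c n) * cos (n%:R * t)).

Lemma is_derive_tprim (c : nat -> R[i]) N (t : R) : (0 < N)%N ->
  is_derive t 1 (tprim c N) (complex.Re (tpoly c N t)).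
Proof.
move=> N0.
have h n : is_derive t 1
    (fun t => n%:R^-1 * (complex.Re (c n) * sin (n%:R * t) + complex.Im (c n) * cos (n%:R * t)))
    (n%:R^-1 * (complex.Re (c n) * (n%:R * cos (n%:R * t)) + complex.Im (c n) * - (n%:R * sin (n%:R * t)))).
  have := is_derive_sin_nat n t => h1; have := is_derive_cos_nat n t => h2.
  have h3 := is_deriveZ (complex.Re (c n)) h1.
  have h4 := is_deriveZ (complex.Im (c n)) h2.
  exact: is_deriveZ (is_deriveD h3 h4).
have := is_deriveD (is_derive_scale (complex.Re (c 0%N)) t) (is_derive1_bigsum (index_iota 0 N) h).
move=> hd; apply: (is_derive_eq (hd : is_derive t 1 (tprim c N) _)); rewrite Re_tpoly.
move: {hd} N0; case: N {h} => // N _; rewrite !big_nat_recl//= invr0 !mul0r cos0 sin0 add0r mulr0 addr0 mulr1.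
congr (_ + _); apply: eq_bigr => n _; field.
by rewrite addrC natr1 pnatr_eq0.
Qed.

(** The symmetric difference is odd in s, so only sines of n s survive, with coefficients depending
    on t. *)
Lemma tprim_diff (c : nat -> R[i]) N t s : tprim c N (t + s) - tprim c N (t - s) =
  2 * (s * complex.Re (c 0%N) +
  \sum_(0 <= n < N) n%:R^-1 * complex.Re (c n * expi (n%:R * t)) * sin (n%:R * s)).
Proof.
rewrite /tprim opprD addrACA -sumrB [RHS]mulrDr; congr (_ + _); first by ring.
rewrite mulr_sumr; apply: eq_bigr => n _.
rewrite -mulrBr !mulrDr !mulrN sinD cosD sinB cosB ReM /=; ring.
Qed.

End AlmostEverywhere.

(** * Approximation of b by almost contractive trigonometric polynomials *)

Section BoundaryApproximation.
Variable R : realType.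
Implicit Types (phi c : nat -> R[i]) (t : R).

Lemma cabs_real (x : R) : 0 <= x -> cabs x%:C = x.
Proof. by move=> x0; rewrite /cabs sqn_real sqrtr_sqr ger0_norm. Qed.

Lemma ccvg_series_finite (u : nat -> R[i]) m : (forall n, (m <= n)%N -> u n = 0) ->
  ccvg (series u) (series u m).
Proof.
move=> um; apply: cvg_near_cst; exists m => // N /= mN.
apply/eqP; rewrite -subr_eq0 /series /= sum_nat_eq// big_nat big1//.
by move=> i /andP[mi _]; exact: um.
Qed.

Lemma exists_mul_onem_le (K e : R) : 0 < e -> 0 <= K -> exists2 r : R, 0 < r < 1 & K * (1 - r) <= e.
Proof.
move=> e0 K0; exists (1 - Num.min (1 / 2) (e / (K + 1))).
  have : 0 < Num.min (1 / 2) (e / (K + 1)) by rewrite lt_min !divr_gt0// ltr_wpDl.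
  have : Num.min (1 / 2) (e / (K + 1)) <= 1 / 2 by rewrite ge_min lexx.
  lra.
have -> : 1 - (1 - Num.min (1 / 2) (e / (K + 1))) = Num.min (1 / 2) (e / (K + 1)) by ring.
apply: (@le_trans _ _ (K * (e / (K + 1)))).
  by rewrite ler_wpM2l// ge_min lexx orbT.
rewrite mulrA ler_pdivrMr ?ltr_wpDl// mulrC ler_pM2l//; lra.
Qed.

(** Plain truncations of b need not be bounded by 1, so a dilate is truncated instead. N1 leaves a
    tail of phi of at most e / 2; r is so close to 1 that the coefficients up to N1 move by a factor
    of at most dl; and r^N <= e (1 - r) makes the discarded part of b(r e^{it}) at most e, uniformly
    in t. *)
Lemma boundary_poly phi (b : disk R -> R[i]) (e : R) : l2bd phi 1 ->
  power_series b phi -> (forall z, sqn (b z) <= 1) -> 0 < e ->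
  exists c N, [/\ (0 < N)%N, forall n, (N <= n)%N -> c n = 0, c 0%N = phi 0%N,
    l2bd (fun n => c n - phi n) e & forall t, cabs (tpoly c N t) <= 1 + e].
Proof.
move=> phi1 bphi b1 e0; have e2 : 0 < e / 2 by rewrite divr_gt0.
have [N1 hN1] := l2bd_tail phi1 e2.
pose dl : R := Num.min (1 / 2) (e / 2).
have dl0 : 0 < dl by rewrite lt_min e2 divr_gt0.
have [dlh dle] : dl <= 1 / 2 /\ dl <= e / 2 by rewrite !ge_min !lexx orbT.
have [r /andP[r0 r1] hr] := exists_mul_onem_le dl0 (ler0n R N1).
have rn n : 0 <= r ^+ n <= 1 by rewrite exprn_ge0 ?(ltW r0)// exprn_ile1 ?(ltW r0) ?(ltW r1).
have rb n : (n <= N1)%N -> 0 <= 1 - r ^+ n <= dl.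
  move=> nN; rewrite subr_ge0 (andP (rn n)).2 /=; apply: le_trans hr.
  apply: (@le_trans _ _ (n%:R * (1 - r))); last first.
    by rewrite ler_wpM2r ?ler_nat// subr_ge0 ltW.
  elim: n {nN} => [|n IH]; first by rewrite expr0 subrr mul0r.
  have -> : 1 - r ^+ n.+1 = (1 - r ^+ n) + r ^+ n * (1 - r) by rewrite exprS; ring.
  rewrite -natr1 mulrDl mul1r lerD// ler_piMl ?subr_ge0 ?(ltW r1)//.
  by have /andP[] := rn n.
have phic n : cabs (phi n) <= 1 by rewrite -[leRHS]sqrtr1; exact: l2bd_cabs.
have er : 0 < e * (1 - r) by rewrite mulr_gt0// subr_gt0.
have [N [hN N0 N1N]] : exists N, [/\ r ^+ N <= e * (1 - r), (0 < N)%N & (N1 <= N)%N].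
  have := @cvg_geometric R 1 r; rewrite ger0_norm ?(ltW r0)// r1 => /(_ isT).
  move=> /cvgr0Pnorm_le/(_ _ er)[M _ hM].
  exists (maxn M (maxn 1 N1)).
  rewrite !leq_max !leqnn /= !orbT; split => //.
  have := hM (maxn M (maxn 1 N1)); rewrite /= leq_maxl => /(_ isT).
  by rewrite mul1r ger0_norm// exprn_ge0// ltW.
exists (fun n => if (n < N)%N then phi n * (r ^+ n)%:C else 0), N; split => //.
- by move=> n; rewrite leqNgt => /negbTE ->.
- by rewrite N0 expr0 mulr1.
- move=> M.
  apply: (@le_trans _ _ (\sum_(0 <= n < M) (dl ^+ 2 * sqn (phi n) +
      (if (N1 <= n)%N then sqn (phi n) else 0)))).
    apply: ler_sum => n _; case: ifPn => nN; last first.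
      rewrite sub0r sqnN ifT; last by rewrite -leqNgt in nN; exact: leq_trans nN.
      by rewrite lerDr mulr_ge0 ?sqn_ge0// sqr_ge0.
    have -> : phi n * (r ^+ n)%:C - phi n = phi n * (r ^+ n - 1)%:C.
      by rewrite rmorphB /= mulrBr mulr1.
    rewrite sqnM sqn_real; case: ifPn => nN1.
      apply: ler_wpDl; first by rewrite mulr_ge0 ?sqn_ge0 ?sqr_ge0.
      by rewrite ler_piMr ?sqn_ge0//; have := rn n; nra.
    rewrite addr0 mulrC ler_wpM2r ?sqn_ge0//.
    by have := rb n; rewrite ltnW ?ltnNge// => /(_ isT); nra.
  rewrite big_split /= -mulr_sumr -big_mkcond.
  rewrite -(@big_nat_widenl _ _ _ N1 0 M xpredT)//.
  have := hN1 N1 M (leqnn _); have := phi1 M.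
  have : dl ^+ 2 <= dl / 2 by nra.
  have : 0 <= dl ^+ 2 by nra.
  nra.
- move=> t; pose z : R[i] := r%:C * expi t.
  have cz : cabs z = r by rewrite cabsM cabs_expi mulr1 cabs_real ?(ltW r0).
  have hz : `|z| < 1 by apply: cabs_lt1; rewrite cz.
  pose w : disk R := exist _ z hz.
  have tz n : phi n * (r ^+ n)%:C * expi (n%:R * t) = phi n * z ^+ n.
    by rewrite expi_nat exprMn rmorphXn mulrA.
  have [l [hl hle]] : exists l, ccvg (series (fun n => phi n * z ^+ n - (if (n < N)%N then phi n * z ^+ n else 0))) l
      /\ cabs l <= e.
    apply: abs_series_cvg => M.
    apply: (@le_trans _ _ (\sum_(0 <= n < M) (if (N <= n)%N then r ^+ n else 0))).
      apply: ler_sum => n _; rewrite ltnNge; case: leqP => _ /=; last by rewrite subrr cabs0.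
      by rewrite subr0 cabsM cabsX cz ler_piMl// exprn_ge0// ltW.
    rewrite -big_mkcond -(@big_nat_widenl _ _ _ N 0 M xpredT)//.
    apply: (@le_trans _ _ (\sum_(0 <= n < (M - N)) r ^+ N * r ^+ n)).
      rewrite -{1}[N]add0n big_addn; apply: ler_sum => n _; by rewrite addnC exprD.
    rewrite -mulr_sumr; apply: (@le_trans _ _ (e * (1 - r) * (1 - r)^-1)).
      apply: ler_pM => //; first by rewrite exprn_ge0// ltW.
        by apply: sumr_ge0 => n _; rewrite exprn_ge0// ltW.
      by apply: geo_sum_le; rewrite (ltW r0).
    by rewrite mulfK// subr_eq0 gt_eqF.
  have hs : ccvg (series (fun n => if (n < N)%N then phi n * z ^+ n else 0))
      (\sum_(0 <= n < N) phi n * z ^+ n).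
    have -> : \sum_(0 <= n < N) phi n * z ^+ n = \sum_(0 <= n < N) (if (n < N)%N then phi n * z ^+ n else 0).
      by apply: eq_big_nat => n /andP[_ ->].
    apply: ccvg_series_finite => n nN.
    by rewrite ltnNge nN.
  have hb : ccvg (series (fun n => phi n * z ^+ n)) (b w) := bphi w.
  have e1 : b w - \sum_(0 <= n < N) phi n * z ^+ n = l.
    apply: (ccvg_unique _ hl); apply: ccvg_ext (ccvgB hb hs) => M.
    by rewrite /series /= -sumrB.
  have -> : tpoly (fun n => if (n < N)%N then phi n * (r ^+ n)%:C else 0) N t = b w - l.
    rewrite -e1 opprB addrCA subrr addr0 /tpoly; apply: eq_big_nat => n /andP[_ nN].
    by rewrite nN tz.
  apply: le_trans (cabsD_le _ _) _; rewrite cabsN lerD//.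
  by rewrite /cabs -[leRHS]sqrtr1 ler_sqrt.
Qed.

End BoundaryApproximation.

(** * Almost everywhere convergence to values of modulus one *)

Section BoundaryModulus.
Variable R : realType.
Implicit Types (c : nat -> R[i]) (t : R).
Notation mu := (@lebesgue_measure R).

Lemma tpolyZ (k : R[i]) c M t : tpoly (fun n => k * c n) M t = k * tpoly c M t.
Proof. by rewrite /tpoly mulr_sumr; apply: eq_bigr => n _; rewrite mulrA. Qed.

Lemma tpolyB c c' M t : tpoly (fun n => c n - c' n) M t = tpoly c M t - tpoly c' M t.
Proof. by rewrite /tpoly -sumrB; apply: eq_bigr => n _; rewrite mulrBl. Qed.

Lemma Im_mulNi (z : R[i]) : complex.Im z = complex.Re (- 'i%C * z).
Proof. by case: z => x y; rewrite ReM /=; ring. Qed.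

Lemma continuous_sqn_tpoly c M : continuous (fun t => sqn (tpoly c M t)).
Proof.
have -> : (fun t => sqn (tpoly c M t)) = (fun t => complex.Re (tpoly c M t) ^+ 2 +
    complex.Re (tpoly (fun n => - 'i%C * c n) M t) ^+ 2).
  by apply/funext => t; rewrite tpolyZ -Im_mulNi /sqn.
move=> t; apply: cvgD; apply: cvgM; exact: continuous_Re_tpoly.
Qed.

Lemma sum_finite_le (F : nat -> R) M M' : (forall n, 0 <= F n) ->
  (forall n, (M <= n)%N -> F n = 0) ->
  \sum_(0 <= n < M') F n <= \sum_(0 <= n < M) F n.
Proof.
move=> F0 FM; case: (leqP M' M) => h; rewrite -subr_ge0.
  by rewrite sum_nat_eq// sumr_ge0.
rewrite -opprB sum_nat_eq ?(ltnW h)// big_nat big1 ?oppr0// => n /andP[Mn _].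
exact: FM.
Qed.

Lemma tpoly_widen c M M' t : (M <= M')%N -> (forall n, (M <= n)%N -> c n = 0) ->
  tpoly c M t = tpoly c M' t.
Proof.
move=> MM cM; apply/eqP; rewrite eq_sym -subr_eq0 /tpoly sum_nat_eq// big_nat big1// => n /andP[Mn _].
by rewrite cM// mul0r.
Qed.

Variables (phi : nat -> R[i]) (q : nat -> nat -> R[i]) (N : nat -> nat).
Hypothesis phi1 : l2bd phi 1.
Hypothesis phi_norm : forall e : R, 0 < e -> exists M, 1 - e <= \sum_(0 <= n < M) sqn (phi n).
Hypothesis qN : forall k n, (N k <= n)%N -> q k n = 0.
Hypothesis qphi : forall k, l2bd (fun n => q k n - phi n) (16^-1 ^+ k).
Hypothesis q1 : forall k t, cabs (tpoly (q k) (N k) t) <= 1 + 16^-1 ^+ k.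

Let h k t := tpoly (q k) (N k) t.

Lemma sqn_young (z w : R[i]) (x : R) : 0 < x ->
  sqn z <= (1 + x) * sqn w + (1 + x^-1) * sqn (w - z).
Proof.
move=> x0; case: z => a b; case: w => c d; rewrite /sqn /=.
have y1 : x * x^-1 = 1 by rewrite mulfV// gt_eqF.
have y0 : 0 < x^-1 by rewrite invr_gt0.
move: (x^-1) y1 y0 => y y1 y0.
have hs (u v : R) : 0 <= x * u ^+ 2 + y * v ^+ 2 + 2 * u * v.
  have -> : x * u ^+ 2 + y * v ^+ 2 + 2 * u * v = y * (x * u + v) ^+ 2.
    transitivity ((x * y) * x * u ^+ 2 + y * v ^+ 2 + 2 * (x * y) * u * v); last by ring.
    by rewrite y1; ring.
  by rewrite mulr_ge0 ?(ltW y0)// sqr_ge0.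
have := hs c (c - a); have := hs d (d - b); lra.
Qed.

(** Both claims reduce to series of nonnegative functions with summable means. [A1] gives
    convergence; [A2] forces |h_k|^2 to 1, because the polynomials are almost bounded by 1 and yet
    their mean squares tend to 1. *)
Lemma boundary_unimodular : {ae mu, forall t, exists2 l, ccvg (h ^~ t) l & sqn l = 1}.
Proof.
pose M k := maxn (N k) (N k.+1).
have hM k t : tpoly (fun n => q k.+1 n - q k n) (M k) t = h k.+1 t - h k t.
  rewrite tpolyB /h; congr (_ - _); apply/esym/tpoly_widen.
  - exact: leq_maxr.
  - exact: qN.
  - exact: leq_maxl.
  - exact: qN.
have geo4 K : \sum_(0 <= k < K) (4^-1 : R) ^+ k <= 2.
  apply: le_trans (geo_sum_le _ _) _; first by apply/andP; split; lra.
  have -> : (1 - 4^-1)^-1 = 4 / 3 :> R by field.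
  lra.
have geo2 K : \sum_(0 <= k < K) (2^-1 : R) ^+ k <= 2.
  apply: le_trans (geo_sum_le _ _) _; first by apply/andP; split; lra.
  have -> : (1 - 2^-1)^-1 = 2 :> R by field.
  lra.
have e416 k : 4 ^+ k * (16^-1 : R) ^+ k = 4^-1 ^+ k.
  by rewrite -exprMn; congr (_ ^+ _); lra.
have e16_0 k : 0 <= (16^-1 : R) ^+ k <= 1.
  by rewrite exprn_ge0 ?exprn_ile1//; lra.
have e4_0 k : 0 <= (4^-1 : R) ^+ k <= 1.
  by rewrite exprn_ge0 ?exprn_ile1//; lra.
have e164 k : (16^-1 : R) ^+ k <= 4^-1 ^+ k.
  by rewrite lerXn2r ?nnegrE//; lra.
(* The means of the squared differences are at most 4 16^-k, so they remain summable under the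
   weight 4^k. *)
have A1 : {ae mu, forall t, exists B, forall K,
    \sum_(0 <= k < K) 4 ^+ k * sqn (h k.+1 t - h k t) <= B}.
  apply: (@ae_bounded_series _ _ (fun k => 4 ^+ k * \sum_(0 <= n < M k) sqn (q k.+1 n - q k n)) 8).
  - by move=> k t; rewrite mulr_ge0 ?sqn_ge0// exprn_ge0.
  - move=> k t; apply: cvgM; first exact: cvg_cst.
    have hc : continuous (fun t => sqn (h k.+1 t - h k t)).
      under eq_fun => s do rewrite -hM.
      exact: continuous_sqn_tpoly.
    exact: hc.
  - move=> k; apply: has_meanZ.
    apply: (@has_mean_ext _ (fun t => sqn (tpoly (fun n => q k.+1 n - q k n) (M k) t))).
      by move=> t; rewrite hM.
    exact: has_mean_tpoly.
  - move=> K; apply: (@le_trans _ _ (\sum_(0 <= k < K) 4 * (4^-1 : R) ^+ k)); last first.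
      by rewrite -mulr_sumr; have := geo4 K; lra.
    apply: ler_sum => k _; rewrite -e416.
    have hl : l2bd (fun n => q k.+1 n - q k n) (2 * (16^-1 ^+ k.+1 + 16^-1 ^+ k)).
      by apply: l2bd_ext (l2bdB (qphi k.+1) (qphi k)) => n; ring.
    have {hl} : \sum_(0 <= n < M k) sqn (q k.+1 n - q k n) <= 4 * 16^-1 ^+ k.
      by apply: le_trans (hl (M k)) _; rewrite exprS; have := e16_0 k; lra.
    have : 0 < (4 : R) ^+ k by rewrite exprn_gt0.
    move: (4 ^+ k) => x x0 hl; nra.
(* The summand 6 16^-k keeps the terms nonnegative, since |h_k|^2 <= (1 + 16^-k)^2. *)
have A2 : {ae mu, forall t, exists B, forall K,
    \sum_(0 <= k < K) (1 + 6 * 16^-1 ^+ k - sqn (h k t)) <= B}.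
  apply: (@ae_bounded_series _ _ (fun k => 1 + 6 * 16^-1 ^+ k - \sum_(0 <= n < N k) sqn (q k n)) 30).
  - move=> k t; rewrite -sqr_cabs.
    have := q1 k t; have := cabs_ge0 (h k t); rewrite -/(h k t).
    by have := e16_0 k; nra.
  - move=> k t; apply: cvgB; first exact: cvg_cst.
    exact: continuous_sqn_tpoly.
  - move=> k; have := has_meanD (has_mean_cst (1 + 6 * 16^-1 ^+ k)) (has_meanZ (-1) (has_mean_tpoly (q k) (N k))).
    by rewrite mulN1r; apply: has_mean_ext => t; rewrite mulN1r.
  - move=> K; apply: (@le_trans _ _ (\sum_(0 <= k < K) 15 * (4^-1 : R) ^+ k)); last first.
      by rewrite -mulr_sumr; have := geo4 K; lra.
    apply: ler_sum => k _.
    set Q := \sum_(_ <= n < _) _.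
    have hQ K' : \sum_(0 <= n < K') sqn (q k n) <= Q.
      by apply: sum_finite_le => n; rewrite ?sqn_ge0// => /qN ->; rewrite sqn0.
    have Q4 : Q <= 4.
      apply: (@le_trans _ _ (2 * (16^-1 ^+ k + 1))); last by have := e16_0 k; lra.
      have h' : l2bd (q k) (2 * (16^-1 ^+ k + 1)).
        by apply: l2bd_ext (l2bdD (qphi k) phi1) => n; rewrite subrK.
      exact: h'.
    (* Young's inequality with x = 4^-k: the large factor 1 + 4^k meets the error 16^-k, so the
       defect of Q from 1 is O(4^-k). *)
    have hy : 1 <= (1 + 4^-1 ^+ k) * Q + (1 + 4 ^+ k) * 16^-1 ^+ k.
      apply/ler_addgt0Pr => e e0; have [K' hK'] := phi_norm e0.
      rewrite -lerBlDr; apply: le_trans hK' _.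
      apply: (@le_trans _ _ (\sum_(0 <= n < K') ((1 + 4^-1 ^+ k) * sqn (q k n) +
          (1 + (4^-1 ^+ k)^-1) * sqn (q k n - phi n)))).
        by apply: ler_sum => n _; apply: sqn_young; rewrite exprn_gt0.
      rewrite big_split /= -!mulr_sumr exprVn invrK lerD//.
        by rewrite ler_wpM2l// addr_ge0// ?invr_ge0 exprn_ge0.
      by rewrite ler_wpM2l//; last exact: qphi.
    rewrite [X in _ + X]mulrDl mul1r e416 in hy.
    have := e4_0 k; have := e164 k; nra.
move: A1 A2; apply: filterS2; first exact: (ae_filter_ringOfSetsType mu).
move=> t [B1 hB1] [B2 hB2].
have [l [hl _]] : exists l, ccvg (series (fun k => h k.+1 t - h k t)) l /\ cabs l <= 2 + B1.
  apply: abs_series_cvg => K.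
  (* For x = |h_(k+1) - h_k|, either x <= 2^-k, or 2^k x >= 1 and then x <= (2^k x)^2. *)
  apply: (@le_trans _ _ (\sum_(0 <= k < K) (2^-1 ^+ k + 4 ^+ k * sqn (h k.+1 t - h k t)))).
    apply: ler_sum => k _; rewrite -sqr_cabs.
    have := cabs_ge0 (h k.+1 t - h k t); move: (cabs _) => x x0.
    have : (2^-1 : R) ^+ k * 2 ^+ k = 1 by rewrite -exprMn mulVf ?expr1n.
    have : (4 : R) ^+ k = 2 ^+ k * 2 ^+ k by rewrite -exprMn; congr (_ ^+ _); ring.
    move=> ->; have : (1 : R) <= 2 ^+ k by rewrite exprn_ege1// ler1n.
    have : 0 <= (2^-1 : R) ^+ k by rewrite exprn_ge0.
    move: (2^-1 ^+ k) (2 ^+ k) => y z y0 z1 yz.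
    have -> : z * z * x ^+ 2 = z * x * (z * x) by ring.
    case: (lerP x y) => xy; first by rewrite ler_wpDr// mulr_ge0// mulr_ge0//; lra.
    have h1 : 1 <= z * x by rewrite -yz mulrC ler_pM2l//; lra.
    have h2 : x <= z * x by rewrite ler_peMl.
    have : z * x <= z * x * (z * x) by rewrite ler_peMl//; lra.
    lra.
  by rewrite big_split /= lerD.
exists (l + h 0%N t).
  have := ccvgD hl (@ccvg_cst _ (h 0%N t)).
  apply: ccvg_ext => K; rewrite /series /=.
  by rewrite telescope_sumr// subrK.
have h0 : (fun k => 1 + 6 * 16^-1 ^+ k - sqn (h k t)) @ \oo --> (0 : R).
  apply: cvg_series_cvg_0; apply: (@nneg_series_cvg _ _ B2) => // k.
  rewrite -sqr_cabs; have := q1 k t; have := cabs_ge0 (h k t); rewrite -/(h k t).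
  by have := e16_0 k; nra.
have h1 : (fun k => sqn (h k t)) @ \oo --> (1 : R).
  have g0 : (fun k => geometric 6 16^-1 k) @ \oo --> (0 : R).
    by apply: cvg_geometric; rewrite ger0_norm; lra.
  have h1 := cvgB (cvgD (@cvg_cst _ (1 : R) _ \oo _) g0) h0.
  have -> : 1 = 1 + 0 - 0 :> R by rewrite addr0 subr0.
  have -> : (fun k => sqn (h k t)) =
      (cst 1 + (fun k => geometric 6 16^-1 k)) - (fun k => 1 + 6 * 16^-1 ^+ k - sqn (h k t)).
    by apply/funext => k; rewrite !fctE /=; ring.
  exact: h1.
have h2 : (fun k => sqn (h k t)) @ \oo --> sqn (l + h 0%N t).
  apply: ccvg_sqn; have := ccvgD hl (@ccvg_cst _ (h 0%N t)).
  apply: ccvg_ext => K; rewrite /series /=.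
  by rewrite telescope_sumr// subrK.
exact: (cvg_unique _ h2 h1).
Qed.

End BoundaryModulus.

(** * Lebesgue differentiation of a bounded limit *)

Section SymmetricDifferentiation.
Variable R : realType.
Notation mu := (@lebesgue_measure R).

Lemma derivable_estimate (F : R -> R) (t l : R) :
  derivable F t 1 -> F^`()%classic t = l ->
  forall e, 0 < e -> exists2 d, 0 < d & forall s, `|s| < d ->
    `|F (t + s) - F t - l * s| <= e * `|s|.
Proof.
move=> dF Fl e e0.
have h : (fun s : R => s^-1 *: (F (s + t) - F t)) @ 0^' --> l.
  rewrite -Fl derive1E.
  have -> : (fun s : R => s^-1 *: (F (s + t) - F t)) =
      (fun s => s^-1 *: ((F \o shift t) (s *: 1) - F t)).
    by apply/funext => s /=; rewrite [s *: 1]mulr1.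
  exact: dF.
have /cvgrPdist_le/(_ e e0) := h; rewrite near_withinE.
case=> d /= d0 hd; exists d => // s sd.
have [->|s0] := eqVneq s 0; first by rewrite addr0 subrr mulr0 subr0 normr0 mulr0.
have := hd s; rewrite /= sub0r normrN => /(_ sd s0).
have ns : 0 < `|s| by rewrite normr_gt0.
rewrite -(ler_pM2r ns) -normrM.
have -> : (l - s^-1 *: (F (s + t) - F t)) * s = - (F (t + s) - F t - l * s).
  by rewrite /GRing.scale /= [s + t]addrC; field.
by rewrite normrN.
Qed.

(* Lebesgue's differentiation theorem for a bounded pointwise limit, read off
   from the primitives U k. *)
Lemma ae_symmetric_derivative (u U : nat -> R -> R) (C : R) :
  (forall k, continuous (u k)) -> (forall k (t : R), is_derive t 1 (U k) (u k t)) ->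
  (forall k t, `|u k t| <= C) -> {ae mu, forall t, exists l : R, u ^~ t @ \oo --> l} ->
  {ae mu, forall t, forall (l : R) (W : R -> R), u ^~ t @ \oo --> l ->
    (forall s, 0 <= s -> (fun k => U k (t + s) - U k (t - s)) @ \oo --> W s) ->
    forall e, 0 < e -> exists2 d, 0 < d & forall s, 0 <= s < d ->
      `|W s - 2 * l * s| <= e * s}.
Proof.
(* The limsup is an everywhere defined measurable representative of the limit. *)
move=> cu dU uC hu; pose V t : R := limn_sup (u ^~ t).
have mu_ k D : measurable_fun D (u k).
  by apply: measurable_funTS; exact: continuous_measurable_fun.
have mV : measurable_fun setT V.
  apply: measurable_fun_limn_sup => // t _.
  - by exists C => _ [k _ <-]; have := uC k t; rewrite ler_norml => /andP[].
  - by exists (- C) => _ [k _ <-]; have := uC k t; rewrite ler_norml => /andP[].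
have hV : {ae mu, forall t, u ^~ t @ \oo --> V t}.
  move: hu; apply: filterS; first exact: (ae_filter_ringOfSetsType mu).
  move=> t [l hl]; have -> // : V t = l.
  by rewrite /V cvg_limn_supE; [exact: cvg_lim|apply/cvg_ex; exists l].
have dom (a b : R) : mu.-integrable `[a, b] (EFin \o V) /\
    (\int[mu]_(x in `[a, b]) (u k x)%:E)%E @[k --> \oo] --> (\int[mu]_(x in `[a, b]) (V x)%:E)%E.
  have [||||||h1 _ h2] := @dominated_convergence _ _ _ mu `[a, b]%classic _
      (fun k x => (u k x)%:E) (EFin \o V) (cst C%:E) => //.
  - by move=> k; apply/measurable_EFinP; exact: mu_.
  - by apply/measurable_EFinP; exact: measurable_funTS.
  - move: hV; apply: filterS; first exact: (ae_filter_ringOfSetsType mu).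
    by move=> t ht _; apply: cvg_EFin => //; exact: nearW.
  - apply: (@measurable_bounded_integrable _ _ _ mu (cst C)) => //.
    + by have /= -> := @lebesgue_measure_itv R `[a, b]; case: ifP => _; rewrite -?EFinB ltry.
    + exact: bounded_cst.
  - by apply: aeW => t k _; rewrite lee_fin.
have locV : locally_integrable setT V.
  split => //; first exact: openT.
  move=> K _ cK; have [M [_ hM]] := compact_bounded cK.
  have KM : K `<=` `[- (M + 1), M + 1]%classic.
    by move=> x Kx; rewrite /= in_itv /= -ler_norml; apply: hM => //; rewrite ltrDl.
  have mK := compact_measurable cK.
  have : mu.-integrable K (EFin \o V).
    have := @integrableS _ _ _ mu _ _ (EFin \o V) (measurable_itv `[- (M + 1), M + 1]) mK KM.
    by apply; exact: (dom _ _).1.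
  by move=> /integrableP[_].
(* Primitives need a base point to the left of t; the countably many base points -n leave a single
   null set. *)
have dF n : {ae mu, forall t, - n%:R < t ->
    derivable (fun x : R => \int[mu]_(t in `[- n%:R, x]) V t) t 1 /\
    (fun x : R => \int[mu]_(t in `[- n%:R, x]) V t)^`()%classic t = V t}.
  have := @FTC1 _ V (BLeft (- n%:R)) (fun y => (dom (- n%:R) y).1) locV.
  apply: filterS; first exact: (ae_filter_ringOfSetsType mu).
  by move=> t ht nt; apply: ht; exact: nt.
have := ae_all_nat dF; move: hV; apply: filterS2; first exact: (ae_filter_ringOfSetsType mu).
move=> t ht hd l W hl hW e e0.
have <- : V t = l by exact: (cvg_unique _ ht hl).
pose n := (Num.truncn (`|t| + 1)).+1.
have tn : `|t| + 1 < n%:R by rewrite /n truncnS_gt.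
have tn' : - n%:R + 1 < t by have := lerNnormlW (lexx `|t|); lra.
have [|d1 d1F] := hd n; first by lra.
have e2 : 0 < e / 2 by rewrite divr_gt0.
pose F (x : R) := \int[mu]_(y in `[- n%:R, x]) V y.
have [d d0 hde] := @derivable_estimate F t (V t) d1 d1F _ e2.
have hF y : - n%:R < y -> (fun k => U k y - U k (- n%:R)) @ \oo --> F y.
  move=> ny; have := (dom (- n%:R) y).2.
  have -> : (fun k => \int[mu]_(x in `[(- n%:R)%R, y]) (u k x)%:E)%E =
     (fun k => (U k y - U k (- n%:R))%:E).
    by apply/funext => k; exact: integral_antiderivative.
  have fV : (\int[mu]_(x in `[(- n%:R)%R, y]) (V x)%:E)%E = (F y)%:E.
    rewrite /F /Rintegral /= fineK//; apply: integrable_fin_num; first exact: measurable_itv.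
    exact: (dom _ _).1.
  by rewrite fV => /fine_cvgP[].
have hWF s : 0 <= s < 1 -> W s = F (t + s) - F (t - s).
  move=> /andP[s0 s1]; apply: (cvg_unique _ (hW s s0)) => //.
  have h1 := hF (t + s); have h2 := hF (t - s).
  have {}h1 := h1 ltac:(lra); have {}h2 := h2 ltac:(lra).
  have -> : (fun k => U k (t + s) - U k (t - s)) =
    (fun k => U k (t + s) - U k (- n%:R)) - (fun k => U k (t - s) - U k (- n%:R)).
    by apply/funext => k; rewrite !fctE; ring.
  exact: cvgB h1 h2.
exists (Num.min d 1); first by rewrite lt_min d0 /=.
move=> s; rewrite lt_min => /and3P[s0 sd s1].
rewrite hWF ?s0//.
have h1 := hde s; have h2 := hde (- s).
rewrite normrN ger0_norm// in h1 h2; have {}h1 := h1 sd; have {}h2 := h2 sd.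
have -> : F (t + s) - F (t - s) - 2 * V t * s =
  (F (t + s) - F t - V t * s) - (F (t - s) - F t - V t * - s) by ring.
apply: le_trans (ler_normB _ _) _; lra.
Qed.

End SymmetricDifferentiation.

(** * Radial limits of the real part *)

Section RadialLimits.
Variable R : realType.
Notation mu := (@lebesgue_measure R).

Lemma lipschitz_of_derive (F f : R -> R) (C a b : R) : a <= b ->
  (forall t : R, is_derive t 1 F (f t)) -> (forall t, `|f t| <= C) ->
  `|F b - F a| <= C * (b - a).
Proof.
rewrite le_eqVlt => /predU1P[->|ab] dF fC; first by rewrite !subrr normr0 mulr0.
have cF := is_derive1_continuous dF.
have [c _ ->] := MVT ab (fun t _ => dF t) (continuous_subspaceT cF).
by rewrite normrM [`|b - a|]gtr0_norm ?subr_gt0// ler_pM2r ?subr_gt0.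
Qed.

Lemma sin_mul_nat_pi n : sin (n%:R * pi) = 0 :> R.
Proof.
elim: n => [|n IH]; first by rewrite mul0r sin0.
by rewrite -natr1 mulrDl mul1r sinDpi IH oppr0.
Qed.

(** Telescoping of 1 / n^2 <= 1 / (n - 1) - 1 / n for n >= 2; the term n = 0 is 0 because 0^-1 =
    0. *)
Lemma sum_invr_sqr_le N : \sum_(0 <= n < N) (n%:R^-1 : R) ^+ 2 <= 2.
Proof.
case: N => [|N]; first by rewrite big_nil.
suff h : \sum_(0 <= n < N.+1) (n%:R^-1 : R) ^+ 2 <= 2 - N%:R^-1.
  by apply: le_trans h _; rewrite lerBlDr lerDl invr_ge0.
elim: N => [|N IH]; first by rewrite big_nat1 invr0 expr0n subr0.
case: N IH => [_|N IH].
  by rewrite big_nat_recr// big_nat1 /= invr0 expr0n add0r invr1 expr1n; lra.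
rewrite big_nat_recr//=; apply: le_trans (lerD IH (lexx _)) _.
have x0 : 0 < (N.+1%:R : R) by rewrite ltr0n.
rewrite -[N.+2%:R]natr1; move: (N.+1%:R) x0 => x x0.
have x1 : 0 < x + 1 by lra.
have : (x + 1)^-1 ^+ 2 <= x^-1 - (x + 1)^-1; last by lra.
have -> : x^-1 - (x + 1)^-1 = x^-1 * (x + 1)^-1 by field; rewrite !gt_eqF.
by rewrite expr2 ler_pM2r ?invr_gt0// lef_pV2 ?posrE//; lra.
Qed.

Section RealPart.
Variables (phi : nat -> R[i]) (q : nat -> nat -> R[i]) (N : nat -> nat).
Hypothesis phi1 : l2bd phi 1.
Hypothesis N0 : forall k, (0 < N k)%N.
Hypothesis qN : forall k n, (N k <= n)%N -> q k n = 0.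
Hypothesis q0 : forall k, q k 0%N = phi 0%N.
Hypothesis qphi : forall k, l2bd (fun n => q k n - phi n) (16^-1 ^+ k).
Hypothesis q1 : forall k t, cabs (tpoly (q k) (N k) t) <= 1 + 16^-1 ^+ k.
Hypothesis q_cvg : {ae mu, forall t, exists l, ccvg (fun k => tpoly (q k) (N k) t) l}.

Let u k t := complex.Re (tpoly (q k) (N k) t).
(** The sum of n (beta t n) r^n is Re b(r e^{it}) - Re phi_0: the entry at n = 0 is 0. *)
Let beta t n := n%:R^-1 * complex.Re (phi n * expi (n%:R * t)).

(** Weighted arithmetic-geometric mean. The weight y = 1 gives summability of beta; y = 4^k balances
    the error 16^-k of the k-th polynomial against the sum of n^-2, each contributing O(4^-k). *)
Lemma beta_le (c : R[i]) n t (y : R) : 0 < y ->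
  `|n%:R^-1 * complex.Re (c * expi (n%:R * t))| <= y * sqn c + y^-1 * n%:R^-1 ^+ 2.
Proof.
move=> y0; rewrite normrM.
have h : `|complex.Re (c * expi (n%:R * t))| <= cabs c.
  by apply: le_trans (Re_le_cabs _) _; rewrite cabsM cabs_expi mulr1.
have n0 : 0 <= (n%:R^-1 : R) by rewrite invr_ge0.
rewrite (ger0_norm n0); apply: le_trans (ler_wpM2l n0 h) _.
rewrite -sqr_cabs; move: (cabs_ge0 c); move: (n%:R^-1) (cabs c) n0 => a x a0 x0.
have yy : y * y^-1 = 1 by rewrite mulfV// gt_eqF.
have y1 : 0 < y^-1 by rewrite invr_gt0.
have : 0 <= y * (x - y^-1 * a) ^+ 2 by rewrite mulr_ge0 ?(ltW y0)// sqr_ge0.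
have -> : y * (x - y^-1 * a) ^+ 2 = y * x ^+ 2 - 2 * (y * y^-1) * (a * x) + (y * y^-1) * y^-1 * a ^+ 2.
  by ring.
rewrite yy; have : 0 <= a * x by rewrite mulr_ge0.
lra.
Qed.

(** The symmetric differences of the primitives tend to 2 (s Re phi_0 + w s), with w the sine series
    of beta. Lebesgue's theorem gives w the derivative Re l - Re phi_0 at 0, and [fatou_sine]
    carries it over to the Abel means. *)
Lemma fatou_real_part : {ae mu, forall t, forall l, ccvg (fun k => tpoly (q k) (N k) t) l ->
  forall e, 0 < e -> exists2 d, 0 < d & forall r x, 0 <= r -> 1 - d < r < 1 ->
    series (fun n => complex.Re (phi n * (r%:C * expi t) ^+ n)) @ \oo --> x ->
    `|x - complex.Re l| <= e}.
Proof.
have e16 k : 0 <= (16^-1 : R) ^+ k <= 1 by rewrite exprn_ge0 ?exprn_ile1//; lra.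
have uC k t : `|u k t| <= 2.
  apply: le_trans (Re_le_cabs _) _; apply: le_trans (q1 k t) _.
  by have := e16 k; lra.
have dU k (t : R) : is_derive t 1 (tprim (q k) (N k)) (u k t) by exact: is_derive_tprim.
have u_cvg : {ae mu, forall t, exists l : R, u ^~ t @ \oo --> l}.
  move: q_cvg; apply: filterS; first exact: (ae_filter_ringOfSetsType mu).
  by move=> t [l /ccvgP[h _]]; exists (complex.Re l).
have := ae_symmetric_derivative (fun k => @continuous_Re_tpoly R (q k) (N k)) dU uC u_cvg.
apply: filterS; first exact: (ae_filter_ringOfSetsType mu).
move=> t ht l hl.
have hb M : \sum_(0 <= n < M) `|beta t n| <= 3.
  apply: (@le_trans _ _ (\sum_(0 <= n < M) (sqn (phi n) + n%:R^-1 ^+ 2))).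
    by apply: ler_sum => n _; have := beta_le (phi n) n t ltr01; rewrite invr1 !mul1r.
  by rewrite big_split /=; have := phi1 M; have := sum_invr_sqr_le M; lra.
have bs n (x s : R) : `|x * sin (n%:R * s)| <= `|x|.
  by rewrite normrM ler_piMr// ler_norml sin_geN1 sin_le1.
have ws s : cvgn (series (fun n => beta t n * sin (n%:R * s))).
  apply: normed_cvg; apply: (@nneg_series_cvg _ _ 3) => [n|M]; first exact: normr_ge0.
  by apply: (le_trans _ (hb M)); apply: ler_sum => n _; exact: bs.
pose w s := limn (series (fun n => beta t n * sin (n%:R * s))).
pose Us k s := \sum_(0 <= n < N k) n%:R^-1 * complex.Re (q k n * expi (n%:R * t)) * sin (n%:R * s).
have UsE k s : tprim (q k) (N k) (t + s) - tprim (q k) (N k) (t - s) =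
    2 * (s * complex.Re (phi 0%N) + Us k s) by rewrite tprim_diff q0.
have Usw k s : `|Us k s - w s| <= 3 * 4^-1 ^+ k.
  have hc : (fun M => `|Us k s - series (fun n => beta t n * sin (n%:R * s)) M|) @ \oo --> `|Us k s - w s|.
    by apply: cvg_norm; apply: cvgB; [exact: cvg_cst|exact: ws].
  rewrite -(cvg_lim (@Rhausdorff R) hc); apply: limr_le; first by apply/cvg_ex; eexists; exact: hc.
  exists (N k) => // M /= NM; rewrite /series /=.
  have -> : Us k s = \sum_(0 <= n < M) n%:R^-1 * complex.Re (q k n * expi (n%:R * t)) * sin (n%:R * s).
    apply/eqP; rewrite eq_sym -subr_eq0 sum_nat_eq// big_nat big1// => n /andP[Nn _].
    by rewrite qN// mul0r mulr0 mul0r.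
  rewrite -sumrB; apply: le_trans (ler_norm_sum _ _ _) _.
  apply: (@le_trans _ _ (\sum_(0 <= n < M) (4 ^+ k * sqn (q k n - phi n) + 4^-1 ^+ k * n%:R^-1 ^+ 2))).
    apply: ler_sum => n _; rewrite -mulrBl -mulrBr -ReB -mulrBl.
    apply: le_trans (bs _ _ _) _; rewrite exprVn; apply: beta_le.
    by rewrite exprn_gt0.
  rewrite big_split /= -!mulr_sumr.
  have := qphi k M; have := sum_invr_sqr_le M.
  have e4 : 0 <= (4^-1 : R) ^+ k by rewrite exprn_ge0.
  have f4 : 0 <= (4 : R) ^+ k by rewrite exprn_ge0.
  have e416 : 4 ^+ k * (16^-1 : R) ^+ k = 4^-1 ^+ k.
    by rewrite -exprMn; congr (_ ^+ _); lra.
  move=> h1 h2.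
  have := ler_wpM2l e4 h1; have := ler_wpM2l f4 h2; rewrite e416; lra.
have Uw s : (fun k => Us k s) @ \oo --> w s.
  have g0 : (fun k => geometric 3 4^-1 k : R) @ \oo --> (0 : R).
    by apply: cvg_geometric; rewrite ger0_norm; lra.
  apply/cvgrPdist_le => e e0; have /cvgr0Pnorm_le/(_ e e0)[M _ hM] := g0.
  exists M => // k /= Mk; rewrite distrC; apply: le_trans (Usw k s) _.
  by apply: le_trans (hM k Mk); exact: ler_norm.
have UW s : (fun k => tprim (q k) (N k) (t + s) - tprim (q k) (N k) (t - s)) @ \oo -->
    2 * (s * complex.Re (phi 0%N) + w s).
  under eq_cvg => k do rewrite UsE.
  by apply: cvgM; [exact: cvg_cst|apply: cvgD; [exact: cvg_cst|exact: Uw]].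
have [hl1 _] := (ccvgP _ _).1 hl.
have hd := ht _ _ hl1 (fun s _ => UW s).
have w0 e : 0 < e -> exists2 d, 0 < d & forall s, 0 <= s < d ->
    `|w s - (complex.Re l - complex.Re (phi 0%N)) * s| <= e * s.
  move=> e0; have [d d0 hde] := hd e e0; exists d => // s sd.
  have s0 : 0 <= s by case/andP: sd.
  apply: le_trans (_ : _ <= `|2 * (w s - (complex.Re l - complex.Re (phi 0%N)) * s)|) _.
    by rewrite normrM ger0_norm// ler_peMl//; lra.
  apply: le_trans (hde s sd); rewrite le_eqVlt; apply/orP; left; apply/eqP.
  by congr (`|_|); ring.
(* Since |u k| <= 2, the symmetric differences are 4-Lipschitz in s; halving gives the 2, and the
   linear term gives |Re phi_0|. *)
have wpi s : 0 <= s <= pi -> `|w s| <= (2 + `|complex.Re (phi 0%N)|) * (pi - s).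
  move=> /andP[s0 sp].
  have w_pi : w pi = 0.
    rewrite /w; apply: cvg_lim => //; apply: cvg_near_cst; apply: nearW => M.
    by apply/eqP; rewrite /series /= big1// => n _; rewrite sin_mul_nat_pi mulr0.
  have h : `|2 * (pi * complex.Re (phi 0%N) + w pi) - 2 * (s * complex.Re (phi 0%N) + w s)| <= 4 * (pi - s).
    have hc : (fun k => `|(tprim (q k) (N k) (t + pi) - tprim (q k) (N k) (t - pi)) -
        (tprim (q k) (N k) (t + s) - tprim (q k) (N k) (t - s))|) @ \oo -->
        `|2 * (pi * complex.Re (phi 0%N) + w pi) - 2 * (s * complex.Re (phi 0%N) + w s)|.
      by apply: cvg_norm; apply: cvgB; exact: UW.
    rewrite -(cvg_lim (@Rhausdorff R) hc); apply: limr_le; first by apply/cvg_ex; eexists; exact: hc.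
    apply: nearW => k.
    set U := tprim (q k) (N k).
    have -> : U (t + pi) - U (t - pi) - (U (t + s) - U (t - s)) =
      (U (t + pi) - U (t + s)) + (U (t - s) - U (t - pi)) by ring.
    have h1 := @lipschitz_of_derive U (u k) 2 (t + s) (t + pi) _ (dU k) (uC k).
    have h2 := @lipschitz_of_derive U (u k) 2 (t - pi) (t - s) _ (dU k) (uC k).
    have {}h1 := h1 ltac:(lra); have {}h2 := h2 ltac:(lra).
    apply: le_trans (ler_normD _ _) _; lra.
  rewrite w_pi in h.
  have h1 : `|w s| <= `|(pi - s) * complex.Re (phi 0%N)| + 2 * (pi - s).
    have -> : w s = (pi - s) * complex.Re (phi 0%N) -
      (2 * (pi * complex.Re (phi 0%N) + 0) - 2 * (s * complex.Re (phi 0%N) + w s)) / 2 by field.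
    apply: le_trans (ler_normB _ _) _; rewrite lerD2l normrM [`|2^-1|]ger0_norm ?invr_ge0//; lra.
  by rewrite normrM ger0_norm ?subr_ge0// in h1; lra.
move=> e e0; have [d d0 hde] := fatou_sine hb (fun s _ => ws s) w0 wpi e0.
exists d => // r x r0 rd hx.
have -> : x - complex.Re l = (x - complex.Re (phi 0%N)) - (complex.Re l - complex.Re (phi 0%N)).
  by ring.
(* The two series differ by their terms at n = 0, so shifted partial sums are compared. *)
apply: (hde _ _ r0 rd); rewrite -cvg_shiftS.
have -> : (fun M => series (fun n => n%:R * beta t n * r ^+ n) M.+1) =
    (fun M => series (fun n => complex.Re (phi n * (r%:C * expi t) ^+ n)) M.+1 - complex.Re (phi 0%N)).
  apply/funext => M; rewrite /series /= !big_nat_recl//= !mul0r expr0 mulr1 addrAC subrr !add0r.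
  apply: eq_bigr => n _; rewrite /beta mulrA mulfV ?pnatr_eq0// mul1r exprMn -expi_nat.
  by rewrite -rmorphXn !ReM !ImM /=; ring.
apply: cvgB; last exact: cvg_cst.
by rewrite cvg_shiftS.
Qed.

End RealPart.
End RadialLimits.

(** * From isometric sequences to inner functions *)

Section InnerFunctions.
Variable R : realType.
Notation mu := (@lebesgue_measure R).

Lemma disk_ext_val (b : disk R -> R[i]) (w : disk R) : disk_ext b (\val w) = b w.
Proof. by rewrite /disk_ext valK. Qed.

Lemma near_left_1 (P : R -> Prop) (d : R) : 0 < d ->
  (forall r, 0 <= r -> 1 - d < r < 1 -> P r) -> \forall r \near 1^'-, P r.
Proof.
move=> d0 h; near=> r; apply: h.
  by apply: ltW; near: r; apply: nbhs_left_gt.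
apply/andP; split.
  by near: r; apply: nbhs_left_gt; rewrite gtrBl.
by near: r; exact: nbhs_left_lt.
Unshelve. all: by end_near.
Qed.

(* Truncated dilates of b converge a.e. on the circle, to a function of modulus
   one since no l2-norm is lost; by Fatou's theorem the limit is the radial limit
   of b.  Imaginary parts are the real parts for - 'i b. *)
Lemma isometric_inner (phi : nat -> R[i]) (b : disk R -> R[i]) :
  isometric phi -> power_series b phi -> inner_function b.
Proof.
move=> iso bphi; have phi1 := isometric_l2bd iso.
have b1 := isometric_bounded iso bphi.
split; first by exists phi.
  exists 1 => z; rewrite normcEsqrt lecR -[leRHS]sqrtr1 ler_sqrt//; exact: b1.
have e16 k : 0 < (16^-1 : R) ^+ k by rewrite exprn_gt0.
have /choice[q /choice[N hN]] k := boundary_poly phi1 bphi b1 (e16 k).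
have N0 k : (0 < N k)%N by have [] := hN k.
have qN k n : (N k <= n)%N -> q k n = 0 by have [_ h _ _ _] := hN k; exact: h.
have q0 k : q k 0%N = phi 0%N by have [] := hN k.
have qphi k : l2bd (fun n => q k n - phi n) (16^-1 ^+ k) by have [] := hN k.
have q1 k t : cabs (tpoly (q k) (N k) t) <= 1 + 16^-1 ^+ k by have [_ _ _ _ h] := hN k; exact: h.
have phi_norm e : 0 < e -> exists M, 1 - e <= \sum_(0 <= n < M) sqn (phi n).
  have h := (@dotcvg_selfP _ phi 1).1 (@iso 0%N).
  move=> e0; have /cvgrPdist_le/(_ e e0)[M _ hM] := h.
  exists M; have := hM M (leqnn _); rewrite /= ler_norml => /andP[_]; rewrite /series /=; lra.
have hm := boundary_unimodular phi1 phi_norm qN qphi q1.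
have hc : {ae mu, forall t, exists l, ccvg (fun k => tpoly (q k) (N k) t) l}.
  move: hm; apply: filterS; first exact: (ae_filter_ringOfSetsType mu).
  by move=> t [l hl _]; exists l.
pose c : R[i] := - 'i%C.
have c1 : sqn c = 1 by rewrite /c sqnN /sqn /= expr0n expr1n add0r.
have cc1 : cabs c = 1 by rewrite /cabs c1 sqrtr1.
have phi1' : l2bd (fun n => c * phi n) 1 by have := l2bdZ c phi1; rewrite c1 mul1r.
have hre := fatou_real_part phi1 N0 qN q0 qphi q1 hc.
have him : {ae mu, forall t, forall l, ccvg (fun k => tpoly (fun n => c * q k n) (N k) t) l ->
  forall e, 0 < e -> exists2 d, 0 < d & forall r x, 0 <= r -> 1 - d < r < 1 ->
    series (fun n => complex.Re (c * phi n * (r%:C * expi t) ^+ n)) @ \oo --> x ->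
    `|x - complex.Re l| <= e}.
  apply: (@fatou_real_part _ (fun n => c * phi n) (fun k n => c * q k n)) => //.
  - by move=> k n h; rewrite qN// mulr0.
  - by move=> k; rewrite q0.
  - move=> k; have := l2bdZ c (qphi k); rewrite c1 mul1r.
    by apply: l2bd_ext => n; rewrite mulrBr.
  - by move=> k t; rewrite tpolyZ cabsM cc1 mul1r.
  - move: hc; apply: filterS; first exact: (ae_filter_ringOfSetsType mu).
    move=> t [l hl]; exists (c * l).
    by have := @ccvgZ _ c _ _ hl; apply: ccvg_ext => k; rewrite tpolyZ.
move: hm hre him; apply: filterS3; first exact: (ae_filter_ringOfSetsType mu).
move=> t [l hl l1] hre him; exists l; last by rewrite normcEsqrt l1 sqrtr1.
have hl' : ccvg (fun k => tpoly (fun n => c * q k n) (N k) t) (c * l).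
  by have := @ccvgZ _ c _ _ hl; apply: ccvg_ext => k; rewrite tpolyZ.
have bS r : 0 <= r -> r < 1 -> let z := r%:C * expi t in
    ccvg (series (fun n => phi n * z ^+ n)) (disk_ext b z).
  move=> r0 r1 z.
  have hz : `|z| < 1 by apply: cabs_lt1; rewrite cabsM cabs_expi mulr1 cabs_real.
  pose w : disk R := exist _ z hz.
  by rewrite -[z]/(\val w) disk_ext_val; exact: bphi.
rewrite /radial_limit; apply/cvg_complexP; split.
  apply/cvgrPdist_le => e e0; have [d d0 hd] := hre l hl e e0.
  apply: (near_left_1 d0) => r r0 rd; have r1 : r < 1 by case/andP: rd.
  rewrite distrC; apply: (hd _ _ r0 rd).
  have [h _] := (ccvgP _ _).1 (bS r r0 r1).
  have -> // : series (fun n => complex.Re (phi n * (r%:C * expi t) ^+ n)) =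
     (fun M => complex.Re (series (fun n => phi n * (r%:C * expi t) ^+ n) M)).
  by apply/funext => M; rewrite /series /= Re_sum.
apply/cvgrPdist_le => e e0; have [d d0 hd] := him _ hl' e e0.
apply: (near_left_1 d0) => r r0 rd; have r1 : r < 1 by case/andP: rd.
rewrite distrC [complex.Im l]Im_mulNi [complex.Im (disk_ext _ _)]Im_mulNi; apply: (hd _ _ r0 rd).
have [h _] := (ccvgP _ _).1 (@ccvgZ _ c _ _ (bS r r0 r1)).
have -> // : series (fun n => complex.Re (c * phi n * (r%:C * expi t) ^+ n)) =
   (fun M => complex.Re (c * series (fun n => phi n * (r%:C * expi t) ^+ n) M)).
by apply/funext => M; rewrite /series /= mulr_sumr Re_sum; apply: eq_bigr => n _; rewrite mulrA.
Qed.

End InnerFunctions.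

(** * Frame spaces and model spaces *)

Section Delta.
Variable R : realType.

Lemma ccvg_series_delta m (v : R[i]) : ccvg (series (fun n => if n == m then v else 0)) v.
Proof.
have {2}-> : v = series (fun n => if n == m then v else 0) m.+1.
  rewrite /series /= big_nat_recr//= eqxx big_nat big1 ?add0r// => n /andP[_ nm].
  by rewrite ltn_eqF.
by apply: ccvg_series_finite => n mn; rewrite gtn_eqF.
Qed.

Lemma l2bd_delta m : l2bd (fun n => (n == m)%:R : R[i]) 1.
Proof.
have h : dotcvg (fun n => (n == m)%:R : R[i]) (fun n => (n == m)%:R) 1%:C.
  apply: ccvg_ext (@ccvg_series_delta m 1%:C) => N; apply: eq_bigr => n _.
  by case: eqP => _; rewrite ?rmorph1 ?mulr1// mul0r.
exact: dotcvg_self_bound h.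
Qed.

End Delta.

Section FrameSpaces.
Variables (R : realType) (H : completeNormedModType R[i]).
Variables (ip : {dot H for Num.conj}) (Hip : hilbert_inner ip).
Variables (g : nat -> H) (A B : R).
Hypotheses (A0 : 0 < A) (B0 : 0 < B).
Hypothesis frame_upper : forall x, l2bd (fun n => ip x (g n)) (B * normsq x).
Hypothesis frame_lower : forall x C,
  l2bd (fun n => ip x (g n)) C -> A * normsq x <= C.
Local Notation an x := (fun n => ip x (g n)).
Local Notation shiftn k := (iter k (@ushift R)).

Lemma analysis_power_series x : power_series (analysis_map ip g x) (an x).
Proof.
have [f fa] := power_series_exists (fun n => l2bd_cabs n (frame_upper x)).
suff -> : analysis_map ip g x = f by exact: fa.
by apply/funext => z; exact: ccvg_lim (fa z).
Qed.

Lemma synth_orthogonal c x : synth g c 0 -> dotcvg c (an x) 0.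
Proof. by move=> /(synth_dot Hip (x := x)); rewrite ip0l. Qed.

(** The shift of c pairs with an analysis sequence as c pairs with its backward shift, which is
    again an analysis sequence. *)
Lemma shift_operator_of_model_space (b : disk R -> R[i]) : analytic_disk b ->
  frame_space ip g = model_space b ->
  exists2 T : {linear H -> H}, bounded_operator T & forall n, T (g n) = g n.+1.
Proof.
move=> ba gb; apply: (operator_of_shift_invariance Hip A0 B0 frame_upper frame_lower).
move=> c C cC c0; apply: (synth_eq0 Hip B0 frame_upper (l2bd_shift cC)) => x.
have [p pa] := power_series_exists (fun n => l2bd_cabs n.+1 (frame_upper x)).
have mx : model_space b (analysis_map ip g x) by rewrite -gb; exists x.
have := model_space_backward_shift ba mx (@analysis_power_series x) (frame_upper x) pa.
rewrite -gb => -[x' _ x'p]; rewrite -x'p in pa.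
have xx' := power_series_unique (@analysis_power_series x') pa.
apply/ccvg_shiftS; apply: ccvg_ext (synth_orthogonal x' c0) => N.
rewrite /series /= big_nat_recl//= mul0r add0r; apply: eq_bigr => n _.
by rewrite (congr1 (fun a => a n) xx').
Qed.

Lemma bounded_operator_cvg0 (T : {linear H -> H}) (u : nat -> H) : bounded_operator T ->
  u @ \oo --> (0 : H) -> (fun n => T (u n)) @ \oo --> (0 : H).
Proof.
move=> [M hM] /hcvgP h; apply/hcvgP.
apply: (@squeeze_cvgr _ _ _ _ (fun=> 0) (fun n => M ^+ 2 * normsq (u n - 0))).
- apply: nearW => n; rewrite normsq_ge0 /= !subr0 !normsq_hn -exprMn.
  have h1 : hn (T (u n)) <= M * hn (u n) by rewrite -lecR rmorphM /= -!hnE.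
  by rewrite ler_sqr ?nnegrE ?hn_ge0// (le_trans _ h1)// hn_ge0.
- exact: cvg_cst.
- by rewrite -[X in _ --> X](mulr0 (M ^+ 2)); apply: cvgM => //; exact: cvg_cst.
Qed.

Section ShiftInvariant.
Hypothesis inv : forall c C, l2bd c C -> synth g c 0 -> synth g (ushift c) 0.

Definition synth_ker c := (exists C, l2bd c C) /\ synth g c 0.

Lemma synth_ker_shiftn k c : synth_ker c -> synth_ker (shiftn k c).
Proof.
move=> [[C cC] c0]; split; first by exists C; exact: l2bd_iter_shift.
by elim: k => //= k; apply: inv; exact: l2bd_iter_shift.
Qed.

Lemma synth_ker_scale (k : R[i]) c : synth_ker c -> synth_ker (fun n => k * c n).
Proof.
move=> [[C cC] c0]; split; first by exists (sqn k * C); exact: l2bdZ.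
have := synth_linear (k := k - 1) c0 c0; rewrite scaler0 addr0.
by congr synth; apply/funext => n; ring.
Qed.

Lemma synth_ker_residual c C : l2bd c C -> exists x, synth_ker (fun n => c n - ip x (g n)).
Proof.
move=> cC; have [x hx] := frame_residual Hip A0 B0 frame_upper frame_lower cC.
by exists x; split => //; eexists; exact: l2bdB cC (frame_upper x).
Qed.

(* As in Beurling's theorem, phi is the normalized projection onto the kernel of
   the first basis vector e_m that is not orthogonal to it. *)
Lemma synth_ker_generator c : synth_ker c -> (exists n, c n != 0) ->
  exists phi, [/\ synth_ker phi, isometric phi &
    forall psi, synth_ker psi -> forall k, dotcvg (shiftn k.+1 psi) phi 0].
Proof.
move=> c0 [n0 cn0].
pose P n := `[< exists2 d, synth_ker d & d n != 0 >].
have [m /asboolP[d dM dm] mP] := ex_minnP (ex_intro P n0 (introT (asboolP _) (ex_intro2 _ _ c c0 cn0))).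
have low e n : synth_ker e -> (n < m)%N -> e n = 0.
  move=> eM nm; apply/eqP/negPn/negP => en.
  by have := mP n; rewrite leqNgt nm => h; apply/notF/h/asboolP; exists e.
pose em (n : nat) : R[i] := (n == m)%:R.
have dot_em e : dotcvg e em (e m).
  apply: ccvg_ext (@ccvg_series_delta _ m (e m)) => N; apply: eq_bigr => n _.
  by rewrite /em; case: eqP => [->|_]; rewrite ?rmorph1 ?mulr1// rmorph0 mulr0.
have [x phi0M] := synth_ker_residual (l2bd_delta R m).
set phi0 := (fun n => _) in phi0M.
(* phi0 differs from e_m by an analysis sequence, which is orthogonal to the kernel; pairing with
   phi0 thus reads off coordinate m. *)
have dot_phi0 e : synth_ker e -> dotcvg e phi0 (e m).
  move=> [_ e0]; have := dotcvg_conj (dotcvgB (dotcvg_conj (dot_em e)) (dotcvg_conj (synth_orthogonal x e0))).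
  by rewrite rmorph0 subr0 conjCK.
have [[P0 phi0P] _] := phi0M.
have [s hs] : exists s : R, dotcvg phi0 phi0 s%:C.
  have /cvg_ex[s hs] := nneg_series_cvg (fun n => sqn_ge0 (phi0 n)) phi0P.
  by exists s; apply/dotcvg_selfP.
have phi0m : phi0 m = s%:C by apply: dotcvg_unique (dot_phi0 _ phi0M) hs.
have s0 : s != 0.
  apply: contra dm => /eqP s0; rewrite s0 in hs.
  have z := dotcvg_self_eq0 hs; apply/eqP.
  apply: dotcvg_unique (dot_phi0 _ dM) _.
  apply: (@ccvg_ext _ (fun=> 0)); last exact: ccvg_cst.
  by move=> N; rewrite /series /= big1// => n _; rewrite z rmorph0 mulr0.
have s_gt0 : 0 < s.
  by rewrite lt_def s0; exact: l2bd_ge0 (dotcvg_self_bound hs).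
pose k : R := (Num.sqrt s)^-1.
have ks : k * (k * s) = 1.
  rewrite /k -[X in _ * (_ * X)](sqr_sqrtr (ltW s_gt0)); field.
  by rewrite gt_eqF// sqrtr_gt0.
pose phi n := k%:C * phi0 n.
have phiM : synth_ker phi by exact: synth_ker_scale.
have dot_phi e : synth_ker e -> dotcvg e phi (k%:C * e m).
  move=> /dot_phi0/dotcvg_conj h; have := dotcvg_conj (@dotcvgZ _ k%:C _ _ _ h).
  suff -> : cj (k%:C * cj (e m)) = k%:C * e m by [].
  by case: (e m) => a1 a2; apply: complex_ext => /=; ring.
(* Coordinate m of the shifted e is 0 or a coordinate of e below m, which vanishes by minimality of
   m. *)
have phiS e j : synth_ker e -> dotcvg (shiftn j.+1 e) phi 0.
  move=> eM; have := dot_phi _ (synth_ker_shiftn j.+1 eM).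
  rewrite iter_shiftE; case: ltnP => jm; last by rewrite mulr0.
  by rewrite low ?mulr0//; lia.
exists phi; split; [exact: phiM| |by move=> psi psiM j; exact: phiS].
case=> [|j]; last exact: (phiS phi j phiM).
have := dot_phi _ phiM; suff -> : k%:C * phi m = 1 by [].
by rewrite /phi phi0m -!rmorphM ks.
Qed.

(** Analysis sequences are orthogonal to the shifts of phi, hence to all of b H^2. Conversely, the
    kernel residual psi of an f in H(b) is orthogonal to the shifts of phi, and phi to the positive
    shifts of psi, so psi = 0 by [isometric_corr_eq0]. *)
Lemma model_space_of_generator phi (b : disk R -> R[i]) :
  synth_ker phi -> isometric phi ->
  (forall psi, synth_ker psi -> forall k, dotcvg (shiftn k.+1 psi) phi 0) ->
  power_series b phi -> frame_space ip g = model_space b.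
Proof.
move=> phiM iso phiS bphi; apply/seteqP; split => [_ [x _ <-]|f [fH fb]].
- split; first exact: H2_intro (frame_upper x) (@analysis_power_series x).
  move=> h /H2P[C [hC ha]].
  have bh : power_series (b \* h) (conv (coefs h) phi).
    have -> : b \* h = h \* b by apply/funext => z /=; rewrite mulrC.
    exact: power_seriesM.
  rewrite /H2_inner (coefsE bh) (coefsE (@analysis_power_series x)); apply: ccvg_lim.
  apply: (dotcvg_conv_eq0 iso (frame_upper x) hC) => j.
  have [_ h0] := synth_ker_shiftn j phiM.
  by have := dotcvg_conj (synth_orthogonal x h0); rewrite rmorph0.
- have [C [fC fa]] := H2P fH.
  have orth j : dotcvg (coefs f) (shiftn j phi) 0.
    have [l hl] := dotcvg_exists fC (l2bd_iter_shift j (isometric_l2bd iso)).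
    (* The monomials z^j as test functions h recover the individual shifts of phi. *)
    pose zj (z : disk R) := \val z ^+ j; pose ej (n : nat) : R[i] := (n == j)%:R.
    have zje : power_series zj ej.
      move=> z; apply: ccvg_ext (@ccvg_series_delta _ j (zj z)) => N; apply: eq_bigr => n _.
      by rewrite /ej /zj; case: eqP => [->|_]; rewrite ?mul1r// mul0r.
    have bz : power_series (b \* zj) (shiftn j phi).
      have -> : b \* zj = zj \* b by apply/funext => z /=; rewrite mulrC.
      have := power_seriesM zje bphi; suff -> : conv ej phi = shiftn j phi by [].
      apply/funext => n; rewrite iter_shiftE /conv; case: leqP => jn.
        rewrite (bigD1_seq j) ?iota_uniq ?mem_index_iota//= {1}/ej eqxx mul1r.
        by rewrite big1 ?addr0// => i ij; rewrite /ej (negPf ij) mul0r.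
      by rewrite big_nat big1// => i /andP[_ ij]; rewrite /ej ltn_eqF ?mul0r//; lia.
    have := fb zj (H2_intro (l2bd_delta R j) zje); rewrite /H2_inner (coefsE bz) (ccvg_lim hl) => l0.
    by rewrite -l0.
  have [x psiM] := synth_ker_residual fC; set psi := (fun n => _) in psiM.
  have psi_orth j : dotcvg psi (shiftn j phi) 0.
    have [_ h0] := synth_ker_shiftn j phiM.
    have := dotcvgB (orth j) (dotcvg_conj (synth_orthogonal x h0)).
    by rewrite rmorph0 subr0.
  have [[P psiP] _] := psiM.
  have psi0 := isometric_corr_eq0 iso psiP psi_orth.
  exists x => //; apply: (power_series_fun_unique (@analysis_power_series x)).
  suff -> : an x = coefs f by [].
  apply/funext => n; apply/eqP; rewrite eq_sym -subr_eq0; apply/eqP.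
  by apply: psi0 => -[|j]; [exact: (psi_orth 0%N)|exact: phiS].
Qed.

End ShiftInvariant.
End FrameSpaces.

Lemma frame_bounds (R : realType) (H : completeNormedModType R[i])
    (ip : H -> H -> R[i]) (g : nat -> H) : frame ip g -> exists A B : R,
  [/\ 0 < A, 0 < B, forall x, l2bd (fun n => ip x (g n)) (B * normsq x) &
    forall x C, l2bd (fun n => ip x (g n)) C -> A * normsq x <= C].
Proof.
move=> [A [B [A0 B0 hAB]]]; exists A, B; split => // [x|x C].
  by apply/nneseries_leP; have /andP[] := hAB x.
move=> /nneseries_leP h; have /andP[h1 _] := hAB x.
by rewrite -lee_fin; exact: le_trans h1 h.
Qed.

Theorem proposition5p3 (R : realType) (H : completeNormedModType R[i])
    (ip : {dot H for Num.conj}) (Hip : hilbert_inner ip)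
    (g : nat -> H) (Hframe : frame ip g) (Hriesz : ~ riesz_basis ip g) :
  (exists2 b : disk R -> R[i], inner_function b &
     frame_space ip g = model_space b) <->
  (exists2 T : {linear H -> H}, bounded_operator T &
     forall n : nat, T (g n) = g n.+1).
Proof.
have [A [B [A0 B0 gB gA]]] := frame_bounds Hframe; split.
  move=> [b [ba _ _] gb].
  exact: (shift_operator_of_model_space Hip A0 B0 gB gA ba gb).
move=> [T Tb Tg].
have inv c C : l2bd c C -> synth g c 0 -> synth g (ushift c) 0.
  move=> _ /(bounded_operator_cvg0 Tb) h; apply/synth_shift.
  suff -> : series (fun n => c n *: g n.+1) = (fun N => T (series (fun n => c n *: g n) N)) by [].
  apply/funext => N; rewrite /series /= linear_sum; apply: eq_bigr => n _.
  by rewrite linearZ Tg.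
(* A frame with trivial kernel would be a Riesz basis. *)
have [c cM cn0] : exists2 c, synth_ker g c & exists n, c n != 0.
  apply: contrapT => /forall2NP h; apply: Hriesz; split => // c /square_summableP cC c0 n.
  have [//|/forallNP/(_ n)/negP/negPn/eqP//] := h c.
  by case; split.
have [phi [phiM iso phiS]] := synth_ker_generator Hip A0 B0 gB gA inv cM cn0.
have [b bphi] := power_series_exists (fun n => l2bd_cabs n (isometric_l2bd iso)).
exists b; first exact: isometric_inner iso bphi.
exact: (model_space_of_generator Hip A0 B0 gB gA inv phiM iso phiS bphi).
Qed.
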